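(* Let $r,a$ be positive integers with $\gcd(r,a)=1$ and $a<r-a$, let $G\subset \mathrm{GL}(3,\mathbb{C})$ be the cyclic group of type $\frac{1}{r}(1,a,r-a)$ and let $X:=G\text{-}\mathrm{Hilb}(\mathbb{C}^3)$. For $\chi\in G^\vee$ let $\mathcal R_\chi$ be the tautological sheaf on $X$, and let $D_\chi$ be the union of all compact exceptional toric divisors $D\subset X$ with $\chi\in\mathrm{SC}(D)$. Then for every nontrivial character $\chi$ of $G$ there is an isomorphism $$\mathcal R_\chi|_{D_\chi}\cong\mathcal O_{D_\chi}.$$
   Context: Group and weights. $G$ is cyclic of order $r$, generated by $g=\mathrm{diag}(\varepsilon,\varepsilon^{a},\varepsilon^{r-a})$, $\varepsilon$ a primitive $r$-th root of unity; $G^\vee$ is its character group and $\chi_i\in G^\vee$ is defined by $\chi_i(g)=\varepsilon^i$; $\otimes$ is multiplication of characters. Let $\mathcal M$ be the set of monomials in $\mathbb{C}[x,y,z]$. For $m\in\mathcal M$, $\mathrm{wt}(m)\in G^\vee$ is the character with $m(h\cdot p)=\mathrm{wt}(m)(h)m(p)$ for all $h\in G,p\in\mathbb{C}^3$; so $\mathrm{wt}(x)=\chi_1$, $\mathrm{wt}(y)=\chi_a$, $\mathrm{wt}(z)=\chi_{r-a}$. $G$-graphs and the fan. A $G$-graph is a set $\Gamma=\{m\in\mathcal M: m\notin I\}$, $I$ a monomial ideal, such that $\mathrm{wt}:\Gamma\to G^\vee$ is bijective. For a monomial $m$, $\mathrm{wt}_\Gamma(m)$ is the unique element of $\Gamma$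 with the same weight as $m$. $\mathrm{Span}(u_1,\dots,u_n)$ is the set of all monomials dividing some $u_i$. Let $N=\mathbb{Z}^3+\mathbb{Z}\cdot\frac1r(1,a,r-a)\subset\mathbb{Q}^3$, $N_{\mathbb R}=N\otimes\mathbb R$, $M$ the dual lattice (invariant Laurent monomials). With $A_\Gamma$ the minimal generators of the ideal of monomials not in $\Gamma$, put $\sigma(\Gamma)=\{w\in N_{\mathbb R}: w\cdot m\ge w\cdot \mathrm{wt}_\Gamma(m)\ \forall m\in A_\Gamma\}$, where $w\cdot m$ is the inner product of $w$ with the exponent vector. For this $G$ every $\sigma(\Gamma)$ is three-dimensional, and these cones with their faces form a fan $\mathrm{Fan}(G)$ supported on the positive octant; write $\Gamma_\sigma$ for the $G$-graph of a three-dimensional cone $\sigma$, $U_\sigma$ for the affine toric chart. $X=G\text{-}\mathrm{Hilb}(\mathbb{C}^3)$ denotes the toric variety of $\mathrm{Fan}(G)$ (the normalization of the component of the $G$-Hilbert scheme dominating $\mathbb{C}^3/G$). Let $e_1,e_2,e_3$ be the standard basis of $\mathbb{R}^3$. A vertex $v$ means a ray of $\mathrm{Fan}(G)$ other than those of $e_1,e_2,e_3$; the compact exceptional toric divisors are the torus-invariant prime divisors $D_v$ of vertices $v$. Tautological sheaves. Let $\mathcal Z\subset X\times\mathbb{C}^3$ be the universal family of $G$-clusters and $p:\mathcal Z\to X$ the projection (finite and flat of degree $r$). For $\chi\in G^\vee$, $\mathcal R_\chi:=\mathrm{Hom}_G(\chi,p_*\mathcal O_{\mathcal Z})$; it is a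 line bundle on $X$. On $U_\sigma$ it is freely generated by the section represented by the unique monomial $m_{\chi,\sigma}\in\Gamma_\sigma$ of weight $\chi$. Edges and markings. The edges at $v$ are the two-dimensional cones of $\mathrm{Fan}(G)$ containing $v$; the valency of $v$ is their number, which is 3, 4 or 5. For a two-dimensional cone meeting the interior of the octant, the primitive vector of $M$ orthogonal to it (unique up to sign) is a quotient $m_1/m_2$ of coprime monomials; its monomial ratio is $m_1:m_2$ and it is marked by the character $\mathrm{wt}(m_1)=\mathrm{wt}(m_2)$. Write $e_iv$ for the edge spanned by $e_i$ and $v$. Valleys. A $y$-valley (resp. $z$-valley) of $\Gamma$ is a monomial $x^my^n$ (resp. $x^mz^n$) in $\Gamma$ with $x^{m+1}y^n,x^my^{n+1}\in\Gamma$, $x^{m+1}y^{n+1}\notin\Gamma$ (resp. with $z$ in place of $y$). If $\Gamma$ has two valleys, they are of the form $x^{k_x}y^{k_y}$ and $x^{j_x}z^{j_z}$; letting $i_x,j_y,k_z$ be the least exponents with $x^{i_x},y^{j_y},z^{k_z}\notin\Gamma$, one has $\Gamma=\mathrm{Span}(x^{i_x-1}y^{k_y},x^{k_x}y^{j_y-1},x^{i_x-1}z^{j_z},x^{j_x}z^{k_z-1})$, $i_x=k_x+j_x+2$, $\mathrm{wt}(z^{k_z-1})=\mathrm{wt}(x^{k_x+1}y^{k_y+1})$, $\mathrm{wt}(y^{j_y-1})=\mathrm{wt}(x^{j_x+1}z^{j_z+1})$, and $\sigma(\Gamma)$ has four facets. Special characters. The set $\mathrm{SC}(D_v)$ is defined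 by cases. Case 1: $v$ has valency 3 (the unique vertex where lines from $e_1,e_2,e_3$ meet): $\mathrm{SC}(D_v)=\{\mathrm{wt}(x)\otimes\mathrm{wt}(x)\}=\{\chi_2\}$. Case 2: $v$ has valency 4 and its edges do not form two straight lines. Then $v$ is joined to $e_1$ and to $e_2$ or $e_3$; if $e_1v$ has ratio $y^j:z^i$, then $\mathrm{SC}(D_v)=\{\mathrm{wt}(x)\otimes\mathrm{wt}(y^j)\}$. Case 3: $v$ has valency 4 and its four edges lie two by two in two planes (two straight lines in a planar slice). Then there is a three-dimensional cone $\sigma(\Gamma)$ containing $v$, with $\Gamma$ having two valleys, such that (in the notation above) the two facets of $\sigma(\Gamma)$ containing $v$ have monomial ratios $y^{j_y-1}:x^{j_x+1}z^{j_z+1}$ and $z^{k_z-1}:x^{k_x+1}y^{k_y+1}$; and $\mathrm{SC}(D_v)=\{\mathrm{wt}(x^{i_x}y^{k_y+1}),\ \mathrm{wt}(x^{i_x}z^{j_z+1})\}$. Case 4: $v$ has valency 5. Then there are uniquely determined characters $\chi_l,\chi_m$ each marking a pair of edges at $v$, the fifth edge being marked by a distinct character; $\mathrm{SC}(D_v)=\{\chi_l\otimes\chi_m\}$. *)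

(* Defs.v *)
From HB Require Import structures.
From mathcomp Require Import all_boot all_order all_algebra fraction.
From mathcomp Require Import complex mpoly.
From mathcomp Require Import classical_sets functions cardinality reals.

Set Implicit Arguments.
Unset Strict Implicit.
Unset Printing Implicit Defensive.

Import Order.TTheory GRing.Theory Num.Theory.

Local Open Scope ring_scope.
Local Open Scope complex_scope.
Local Open Scope classical_set_scope.
Local Open Scope card_scope.

(** A Laurent monomial [x^i y^j z^k] is its exponent vector in ['rV[int]_3];
    multiplication of monomials is addition of vectors.  The character
    [chi_i], i.e. [g |-> eps^i], is the element [i] of ['Z_r], and the product
    of characters is the addition of ['Z_r].  (The hypotheses on [r] and [a]
    force [r >= 3], so that ['Z_r] is really the ring of integers mod [r].) *)

Definition ismon (u : 'rV[int]_3) : Prop := forall i, 0 <= u 0 i.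

Definition mon (i j k : nat) : 'rV[int]_3 :=
  \row_(l < 3) (nth 0%N [:: i; j; k] l)%:Z.

Definition mdvd (u v : 'rV[int]_3) : Prop := ismon (v - u).

Definition wt (r a : nat) (u : 'rV[int]_3) : 'Z_r :=
  \sum_(i < 3) (nth 0%N [:: 1%N; a; (r - a)%N] i)%:R * (u 0 i)%:~R.

Definition gen (F : fieldType) (r a : nat) (eps : F) : 'M[F]_3 :=
  diag_mx (\row_(i < 3) eps ^+ nth 0%N [:: 1%N; a; (r - a)%N] i).

Definition mon_eval (F : fieldType) (u : 'rV[int]_3) (p : 'cV[F]_3) : F :=
  \prod_(i < 3) p i 0 ^ u 0 i.

(* [wt u] is the character [chi] with [u(g p) = chi(g) u(p)]. *)
Lemma wtP (F : fieldType) (r a : nat) (eps : F) (u : 'rV[int]_3)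
    (p : 'cV[F]_3) : (1 < r)%N -> r.-primitive_root eps ->
  mon_eval u (gen r a eps *m p) = eps ^+ wt r a u * mon_eval u p.
Proof.
move=> r1 pe.
have e0 : eps != 0.
  have := oner_neq0 F; rewrite -(prim_expr_order pe) expf_eq0 (ltnW r1).
  by [].
have em (n : nat) : eps ^+ (n %% (Zp_trunc r).+2) = eps ^+ n.
  by rewrite Zp_cast // (prim_expr_mod pe).
have eD (k l : 'Z_r) : eps ^+ (k + l)%R = eps ^+ k * eps ^+ l.
  by rewrite -exprD -[RHS]em.
have eN (k : 'Z_r) : eps ^+ (- k)%R = (eps ^+ k)^-1.
  by apply: (mulIf (expf_neq0 k e0)); rewrite -eD addNr expr0 mulVf ?expf_neq0.
have en (n : nat) : eps ^+ (n%:R : 'Z_r) = eps ^+ n.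
  by rewrite val_Zp_nat // (prim_expr_mod pe).
have ez (n : int) (k : nat) :
    eps ^+ (k%:R * n%:~R : 'Z_r)%R = (eps ^+ k) ^ n.
  case: n => n; first by rewrite -pmulrn -natrM en exprM.
  by rewrite NegzE mulrNz mulrN eN -pmulrn -natrM en exprM exprnN.
have es (f : 'I_3 -> 'Z_r) :
    eps ^+ (\sum_i f i)%R = \prod_i eps ^+ f i.
  by elim/big_rec2: _ => [|i x y _ <-]; rewrite ?eD.
rewrite /mon_eval /wt es -big_split /=; apply: eq_bigr => i _.
by rewrite ez -expfzMl mul_diag_mx !mxE.
Qed.

Definition invariant (r a : nat) (u : 'rV[int]_3) : Prop := wt r a u = 0.

Definition primitive (r a : nat) (u : 'rV[int]_3) : Prop :=
  [/\ invariant r a u, u <> 0 &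
    forall (n : int) (u' : 'rV[int]_3),
      invariant r a u' -> u = n *: u' -> n = 1 \/ n = -1].

Definition monomial_ideal (I : set 'rV[int]_3) : Prop :=
  I `<=` ismon /\ forall u v, I u -> ismon v -> I (u + v).

Definition Ggraph (r a : nat) (Gam : set 'rV[int]_3) : Prop :=
  (exists2 I, monomial_ideal I & Gam = ismon `\` I) /\
  set_bij Gam setT (wt r a).

Definition min_gens (Gam : set 'rV[int]_3) : set 'rV[int]_3 :=
  [set m | [/\ ismon m, ~ Gam m &
    forall m', ismon m' -> ~ Gam m' -> mdvd m' m -> m' = m]].

Definition yvalley (Gam : set 'rV[int]_3) (m n : nat) : Prop :=
  [/\ Gam (mon m n 0), Gam (mon m.+1 n 0), Gam (mon m n.+1 0) &
      ~ Gam (mon m.+1 n.+1 0)].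

Definition zvalley (Gam : set 'rV[int]_3) (m n : nat) : Prop :=
  [/\ Gam (mon m 0 n), Gam (mon m.+1 0 n), Gam (mon m 0 n.+1) &
      ~ Gam (mon m.+1 0 n.+1)].

Definition least_notin (Gam : set 'rV[int]_3) (pw : nat -> 'rV[int]_3)
    (n : nat) : Prop :=
  ~ Gam (pw n) /\ forall k, (k < n)%N -> Gam (pw k).

Definition dot (R : realType) (w : 'rV[R]_3) (u : 'rV[int]_3) : R :=
  \sum_(i < 3) w 0 i * (u 0 i)%:~R.

Definition sigma (R : realType) (r a : nat) (Gam : set 'rV[int]_3) :
    set 'rV[R]_3 :=
  [set w | forall m m', min_gens Gam m -> Gam m' ->
    wt r a m' = wt r a m -> dot w m' <= dot w m].
Arguments sigma R r a Gam : clear implicits.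

Definition plane (R : realType) (c : 'rV[R]_3) : set 'rV[R]_3 :=
  [set w | w *m c^T = 0].

Definition face (R : realType) (tau sig : set 'rV[R]_3) : Prop :=
  exists2 c : 'rV[R]_3, (forall w, sig w -> 0 <= (w *m c^T) 0 0) &
    tau = sig `&` plane c.

Definition Fan (R : realType) (r a : nat) : set (set 'rV[R]_3) :=
  [set tau | exists2 Gam, Ggraph r a Gam & face tau (sigma R r a Gam)].
Arguments Fan R r a : clear implicits.

(* [d] is the dimension of the linear span of [tau]. *)
Definition cone_dim (R : realType) (tau : set 'rV[R]_3) (d : nat) : Prop :=
  exists B : 'M[R]_(d, 3), [/\ row_free B, forall i, tau (row i B) &
    forall w, tau w -> (w <= B)%MS].

Definition axis (R : realType) (i : 'I_3) : set 'rV[R]_3 :=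
  [set t *: delta_mx 0 i | t in [set t : R | 0 <= t]].
Arguments axis R i : clear implicits.

(* A vertex is identified with its ray, a one-dimensional cone. *)
Definition vertex (R : realType) (r a : nat) (v : set 'rV[R]_3) : Prop :=
  [/\ Fan R r a v, cone_dim v 1 & forall i, v <> axis R i].

Definition edges (R : realType) (r a : nat) (v : set 'rV[R]_3) :
    set (set 'rV[R]_3) :=
  [set tau | [/\ Fan R r a tau, cone_dim tau 2 & v `<=` tau]].

Definition valency (R : realType) (r a : nat) (v : set 'rV[R]_3) (n : nat) :
    Prop :=
  edges r a v #= `I_n.

(* The monomial ratio is only determined up to the order of its terms. *)
Definition monomial_ratio (R : realType) (r a : nat) (tau : set 'rV[R]_3)
    (m1 m2 : 'rV[int]_3) : Prop :=
  [/\ ismon m1, ismon m2, forall i, m1 0 i = 0 \/ m2 0 i = 0,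
      primitive r a (m1 - m2) & forall w, tau w -> dot w (m1 - m2) = 0].

Definition marked (R : realType) (r a : nat) (tau : set 'rV[R]_3)
    (chi : 'Z_r) : Prop :=
  exists m1 m2, monomial_ratio r a tau m1 m2 /\ wt r a m1 = chi.

Definition two_lines (R : realType) (r a : nat) (v : set 'rV[R]_3) : Prop :=
  exists t1 t2 t3 t4 : set 'rV[R]_3, edges r a v = [set t1; t2; t3; t4] /\
  exists c c' : 'rV[R]_3, [/\ c <> 0, c' <> 0,
    t1 `|` t2 `<=` plane c & t3 `|` t4 `<=` plane c'].

Definition SC_valency3 (r a : nat) (chi : 'Z_r) : Prop :=
  chi = wt r a (mon 1 0 0) + wt r a (mon 1 0 0).

Definition SC_valency4 (R : realType) (r a : nat) (v : set 'rV[R]_3)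
    (chi : 'Z_r) : Prop :=
  exists (tau : set 'rV[R]_3) (i j : nat),
  [/\ edges r a v tau, axis R 0 `<=` tau,
      monomial_ratio r a tau (mon 0 j 0) (mon 0 0 i) &
      chi = wt r a (mon 1 0 0) + wt r a (mon 0 j 0)].

Definition SC_two_lines (R : realType) (r a : nat) (v : set 'rV[R]_3)
    (chi : 'Z_r) : Prop :=
  exists (Gam : set 'rV[int]_3) (kx ky jx jz ix jy kz : nat)
    (t1 t2 : set 'rV[R]_3),
  [/\ Ggraph r a Gam, cone_dim (sigma R r a Gam) 3 & v `<=` sigma R r a Gam] /\
  [/\ yvalley Gam kx ky, zvalley Gam jx jz,
      least_notin Gam (fun n => mon n 0 0) ix,
      least_notin Gam (fun n => mon 0 n 0) jy &
      least_notin Gam (fun n => mon 0 0 n) kz] /\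
  [/\ face t1 (sigma R r a Gam), cone_dim t1 2, v `<=` t1 &
      monomial_ratio r a t1 (mon 0 jy.-1 0) (mon jx.+1 0 jz.+1)] /\
  [/\ face t2 (sigma R r a Gam), cone_dim t2 2, v `<=` t2 &
      monomial_ratio r a t2 (mon 0 0 kz.-1) (mon kx.+1 ky.+1 0)] /\
  (chi = wt r a (mon ix ky.+1 0) \/ chi = wt r a (mon ix 0 jz.+1)).

Definition SC_valency5 (R : realType) (r a : nat) (v : set 'rV[R]_3)
    (chi : 'Z_r) : Prop :=
  exists (t1 t2 t3 t4 t5 : set 'rV[R]_3) (l m n : 'Z_r),
  [/\ edges r a v = [set t1; t2; t3; t4; t5],
      marked a t1 l /\ marked a t2 l, marked a t3 m /\ marked a t4 m &
      marked a t5 n] /\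
  [/\ l <> m, n <> l, n <> m & chi = l + m].

Inductive SC (R : realType) (r a : nat) (v : set 'rV[R]_3) (chi : 'Z_r) :
    Prop :=
| SC1 of valency r a v 3 & SC_valency3 a chi
| SC2 of valency r a v 4 & ~ two_lines r a v & SC_valency4 a v chi
| SC3 of valency r a v 4 & two_lines r a v & SC_two_lines a v chi
| SC4 of valency r a v 5 & SC_valency5 a v chi.

(** X is the toric variety of [Fan R r a], covered by the affine charts
    [U_tau], [tau] a cone of the fan; the cover is closed under intersection
    and [U_tau] is contained in [U_sig] when [tau] is contained in [sig].
    A quasi-coherent sheaf on X is thus the same as a compatible family of
    [O(U_tau)]-modules, and a morphism of such sheaves is a family of linear
    maps commuting with the restriction maps.  All the sheaves below are
    subquotients of the field [C(x, y, z)] of rational functions on [C^3],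
    which contains the function field [C(x, y, z)^G] of X. *)

Definition ratfun (R : realType) : fieldType := {fraction {mpoly R[i][3]}}.

Definition rconst (R : realType) : set (ratfun R) :=
  range (fun c : R[i] => FracField.tofrac (c%:MP_[3]) : ratfun R).
Arguments rconst R : clear implicits.

Definition lmon (R : realType) (u : 'rV[int]_3) : ratfun R :=
  \prod_(i < 3) (FracField.tofrac ('X_i : {mpoly R[i][3]}) : ratfun R) ^ u 0 i.
Arguments lmon R u : clear implicits.

(* As for the product of two ideals, finite sums of products. *)
Definition sumprod (K : fieldType) (A B : set K) : set K :=
  [set f | exists2 s : seq (K * K),
    (forall p, p \in s -> A p.1 /\ B p.2) & f = \sum_(p <- s) p.1 * p.2].

Definition lspan (R : realType) (S : set 'rV[int]_3) : set (ratfun R) :=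
  sumprod (rconst R) (lmon R @` S).
Arguments lspan R S : clear implicits.

Definition dual (R : realType) (r a : nat) (tau : set 'rV[R]_3) :
    set 'rV[int]_3 :=
  [set u | invariant r a u /\ forall w, tau w -> 0 <= dot w u].

Definition regular (R : realType) (r a : nat) (tau : set 'rV[R]_3) :
    set (ratfun R) :=
  lspan R (dual r a tau).

(* The sections of [p_* O_Z] over [U_tau].  As Z is a closed subscheme of
   [X * C^3] flat over X, they form the image of [O(U_tau)[x, y, z]] in the
   generic fibre of [p_* O_Z]; over the generic point of X the family Z is the
   quotient map [C^3 -> C^3/G], whose generic fibre is [C(x, y, z)]. *)
Definition univ_family (R : realType) (r a : nat) (tau : set 'rV[R]_3) :
    set (ratfun R) :=
  sumprod (regular r a tau) (lmon R @` ismon).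

(* The Laurent monomials being eigenvectors of G, [Hom_G(chi, p_* O_Z)] is the
   subspace of the sections of [p_* O_Z] spanned by those of weight [chi]. *)
Definition taut (R : realType) (r a : nat) (chi : 'Z_r)
    (tau : set 'rV[R]_3) : set (ratfun R) :=
  univ_family r a tau `&` lspan R [set u | wt r a u = chi].

(* The ideal of [D_v], the closure of the orbit of the ray [v]: it is spanned
   by the [u] in the dual of [tau] that do not vanish on [v] if [v] is a ray
   of [tau], and it is the unit ideal otherwise. *)
Definition ideal_vertex (R : realType) (r a : nat) (v tau : set 'rV[R]_3) :
    set (ratfun R) :=
  lspan R [set u | dual r a tau u /\
    (v `<=` tau -> exists2 w, v w & dot w u <> 0)].

(* The ideal of the union [D_chi], with its reduced structure.  If no [D_v]
   occurs then it is the unit ideal and [D_chi] is empty. *)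
Definition ideal_chi (R : realType) (r a : nat) (chi : 'Z_r)
    (tau : set 'rV[R]_3) : set (ratfun R) :=
  [set f | regular r a tau f /\
    forall v, vertex r a v -> SC a v chi -> ideal_vertex r a v tau f].

(* The sheaf with sections [qnum tau / qden tau] over [U_tau]; the restriction
   maps are induced by the identity of [ratfun R]. *)
Record qsheaf (R : realType) := QSheaf {
  qnum : set 'rV[R]_3 -> set (ratfun R);
  qden : set 'rV[R]_3 -> set (ratfun R) }.

(* For [D] with ideal [I], the direct image of [F|_D] on X is [F / I F]. *)
Definition restriction (R : realType)
    (F I : set 'rV[R]_3 -> set (ratfun R)) : qsheaf R :=
  QSheaf F (fun tau => sumprod (I tau) (F tau)).

Definition structure_sheaf (R : realType) (r a : nat)
    (I : set 'rV[R]_3 -> set (ratfun R)) : qsheaf R :=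
  QSheaf (@regular R r a) I.

Definition taut_on_D (R : realType) (r a : nat) (chi : 'Z_r) : qsheaf R :=
  restriction (@taut R r a chi) (ideal_chi a chi).
Arguments taut_on_D R {r} a chi.

Definition O_D (R : realType) (r a : nat) (chi : 'Z_r) : qsheaf R :=
  structure_sheaf r a (ideal_chi a chi).
Arguments O_D R {r} a chi.

(* [phi tau] is a lift to representatives of a map
   [qnum F tau / qden F tau -> qnum H tau / qden H tau]. *)
Definition qsheaf_iso (R : realType) (r a : nat) (F H : qsheaf R) : Prop :=
  exists phi : set 'rV[R]_3 -> ratfun R -> ratfun R,
  (forall tau, Fan R r a tau ->
    [/\ forall f, qnum F tau f -> qnum H tau (phi tau f),
        forall c f g, regular r a tau c -> qnum F tau f -> qnum F tau g ->
          qden H tau (phi tau (c * f + g) - (c * phi tau f + phi tau g)),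
        forall f, qnum F tau f -> (qden H tau (phi tau f) <-> qden F tau f) &
        forall h, qnum H tau h ->
          exists2 f, qnum F tau f & qden H tau (h - phi tau f)]) /\
  (forall sig tau, Fan R r a sig -> Fan R r a tau -> tau `<=` sig ->
    forall f, qnum F sig f -> qden H tau (phi sig f - phi tau f)).

(* Main.v *)
From HB Require Import structures.
From mathcomp Require Import all_boot all_order all_algebra fraction.
From mathcomp Require Import complex mpoly.
From mathcomp Require Import zify ring lra.
From mathcomp Require Import classical_sets functions cardinality reals boolp.
Require Import Defs.

(** Over the charts that meet [D_chi], the sheaf [R_chi] always has the same
    generator; this is why its restriction is trivial.

    On [U_tau] the sheaf [R_chi] is generated by the monomial of weight [chi]
    in a G-graph whose cone contains [tau] ([taut_eq]), and dividing by that
    monomial identifies it with the structure sheaf.  Two charts disagree by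
    the ratio of their monomials, which has to be 1 modulo the ideal of
    [D_chi].  If no vertex [v] with [chi] in [SC(D_v)] lies in [tau], then
    this ideal is the unit ideal.  So it is enough that all charts at such a
    [v] contain the same monomial of weight [chi] ([rigid], [taut_iso]).  A
    point [w] of [sigma(Gamma)] makes every element of [Gamma] the cheapest
    monomial of its weight, the cost of [m] being [w . m] ([sigma_min]).
    Hence [chi] is rigid at [v] as soon as one monomial of weight [chi] is
    strictly cheaper than all others at a generator of [v] ([rigid_strict]).

    As [yz] is invariant, the elements of a G-graph are of the form [x^i y^n]
    or [x^i z^(-n)], that is, points [(i, n)] with [i >= 0] and weight
    [i + a n] modulo [r].  As in the three-gap theorem, the rows of a G-graph
    have at most three widths, [A], [A + B] and [B] ([classify]); the graph is
    determined by two relations [(A, - al)] and [(B, be)], which form a basis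
    of the lattice [i + a n = 0], and by two integers [p] and [q].  In terms
    of [S = y + z], [U = al y - A x] and [V = be z - B x] its cone is given by
    [p S <= U <= (p + 1) S], [q S <= V <= (q + 1) S] and
    [U + V <= min(al, be) S] ([sigmaE]): for fixed relations, the cones are
    the squares and half-squares of a grid.  (If [B = 0] the bounds on [U]
    disappear, if [A = 0] those on [V]; then [e_1] is a ray of the cone.)
    Every vertex is a grid point [U = p S], [V = q S] with [p, q >= 1] and
    [p + q <= min(al, be)] for suitable relations, or the triple point
    [U = V = 0], where [A = B = 1] ([vertex_normal_pt]).  Expanding the other
    monomials of the same weight in the basis of relations shows that at such a
    grid point the monomial [(0, n)] is strictly the cheapest of its weight for
    [q - be < n < al - p], with one stronger bound if [p + q = min(al, be)]
    ([strict_min]).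

    It remains to see that each special character is [a n] for such an [n].
    The walls [U = p S], [V = q S] and [U + V = min(al, be) S] are marked by
    [a (al - p)], [a (q - be)] and [A + B = a (al - be)], and at every vertex
    but the triple point there are four edges with two marks, each occurring
    twice ([four_edges_inner], [edges_outer_a], [edges_outer_b]).  This
    excludes valency 3 and gives the special character at valency 5.  At
    valency 4, two valleys determine the basis of relations and the grid point
    ([SC3_rigid]), and an edge to [e_1] forces [A = 0] or [B = 0]
    ([SC2_rigid]).  The triple point has at most four edges
    ([triple_valency]), and its special character is [chi_2]. *)

Set Implicit Arguments.
Unset Strict Implicit.
Unset Printing Implicit Defensive.

Import Order.TTheory GRing.Theory Num.Theory.
Local Open Scope ring_scope.

(** * Frames and staircases *)

(** Arithmetic on [int] is not helped, but slowed down, by hypotheses over the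
    ambient real field. *)
Ltac ilia R := repeat match goal with H : context [R] |- _ => clear H end; lia.
Ltac inia R := repeat match goal with H : context [R] |- _ => clear H end; nia.

(** Two relations [(fA, - al)] and [(fB, be)] of the lattice of the pairs
    [(i, n)] with [i + b n] divisible by [r], where [b] is the weight of [y]. *)
Record frame := Frame { al : int; be : int; fA : int; fB : int }.

(** The equation with [r] says that the two relations form a basis of the
    lattice of relations.  For invertible [b] and [fA = 0] the first relation is
    [y^r] and leaves [be] free modulo [r]; the last clauses normalise this
    choice. *)
Definition is_frame (r b : int) (F : frame) : Prop :=
  [/\ 0 < al F, 0 < be F, 0 <= fA F & 0 <= fB F] /\
  [/\ al F * fB F + be F * fA F = r,
      exists k, b * al F = fA F + k * r, exists k, b * be F = - fB F + k * r,
      fA F = 0 -> be F < al F & fB F = 0 -> al F < be F].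

Definition fswap (F : frame) := Frame (be F) (al F) (fB F) (fA F).

(** Exchanging [y] and [z] replaces the weight [b] by [- b].  Below, a fact is
    often proved for one sign of [n] and transported by this symmetry. *)
Lemma is_frame_swap r b F : is_frame r b F -> is_frame r (- b) (fswap F).
Proof.
move=> [[h1 h2 h3 h4] [h5 [k1 h6] [k2 h7] h8 h9]]; split; split=> //=.
- lia.
- by exists (- k2); lia.
- by exists (- k1); lia.
Qed.

(** Rows of width 0 are empty; the last two clauses choose the parameters so
    that there are none. *)
Definition is_cell (F : frame) (p q : int) : Prop :=
  [/\ 0 <= p, 0 <= q, p + q < al F & p + q < be F] /\
  (fA F = 0 -> p + q + 1 = be F) /\ (fB F = 0 -> p + q + 1 = al F).

Lemma is_cell_swap F p q : is_cell F p q -> is_cell (fswap F) q p.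
Proof. by move=> [[? ? ? ?] [? ?]]; split; [split|split] => /=; lia. Qed.

(** The staircase with rows of widths [fA], [fA + fB] and [fB].  The point
    [(i, n)] stands for [x^i y^n] if [n] is non-negative, and for
    [x^i z^(-n)] otherwise. *)
Definition in_graph (F : frame) (p q i n : int) : Prop :=
  [/\ 0 <= i, q + 1 - be F <= n, n <= al F - 1 - p &
   [/\ n < - p -> i < fA F, - p <= n -> n <= q -> i < fA F + fB F &
       q < n -> i < fB F]].

Lemma in_graph_swap F p q i n : in_graph F p q i n -> in_graph (fswap F) q p i (- n).
Proof. by move=> [? ? ? [? ? ?]]; split=> /=; [lia..|split; lia]. Qed.

(** The two relations have determinant [r], which is the index of the lattice
    of all relations; Cramer's rule gives the integral coordinates. *)
Lemma frame_lattice r b F di dn k : 0 < r -> is_frame r b F ->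
  di + b * dn = k * r ->
  exists s t, di = s * fA F + t * fB F /\ dn = - s * al F + t * be F.
Proof.
move=> r0 [[h1 h2 h3 h4] [h5 [k1 h6] [k2 h7] h8 h9]] e.
exists (be F * k - k2 * dn), (al F * k - k1 * dn).
have ? : di = k * r - b * dn by lia.
have r0' : r != 0 by lia.
have e1 : k1 * r = b * al F - fA F by lia.
have e2 : k2 * r = b * be F + fB F by lia.
split; apply: (mulfI r0').
  have -> : r * ((be F * k - k2 * dn) * fA F + (al F * k - k1 * dn) * fB F) =
    r * k * (al F * fB F + be F * fA F) - dn * ((k2 * r) * fA F + (k1 * r) * fB F).
    by ring.
  rewrite e1 e2.
  have -> : (b * be F + fB F) * fA F + (b * al F - fA F) * fB F =
    b * (al F * fB F + be F * fA F) by ring.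
  by rewrite h5; subst di; ring.
have -> : r * (- (be F * k - k2 * dn) * al F + (al F * k - k1 * dn) * be F) =
  dn * ((k2 * r) * al F - (k1 * r) * be F) by ring.
rewrite e1 e2 -h5; ring.
Qed.

Lemma frame_mod r b F s t : is_frame r b F ->
  exists k, (s * fA F + t * fB F) + b * (- s * al F + t * be F) = k * r.
Proof.
move=> [_ [_ [k1 h6] [k2 h7] _ _]]; exists (t * k2 - s * k1).
have -> : b * (- s * al F + t * be F) = - s * (b * al F) + t * (b * be F) by ring.
rewrite h6 h7; ring.
Qed.

Section Cost.
Variable R : realFieldType.
Implicit Types x y z : R.

(** The values at [(x, y, z)] of the invariant monomials [yz],
    [y^al / x^fA] and [z^be / x^fB], seen as linear forms. *)
Definition fS y z : R := y + z.
Definition fU (F : frame) x y : R := (al F)%:~R * y - (fA F)%:~R * x.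
Definition fV (F : frame) x z : R := (be F)%:~R * z - (fB F)%:~R * x.

(** The bounds on [fU] compare [y^(al - p)] with [x^fA z^p] and
    [x^fA z^(p + 1)] with [y^(al - 1 - p)].  If [fB = 0] these are no longer a
    minimal generator of the ideal and an element of the graph. *)
Definition in_cell F (p q : int) x y z : Prop :=
  [/\ fB F != 0 -> p%:~R * fS y z <= fU F x y <= (p + 1)%:~R * fS y z,
      fA F != 0 -> q%:~R * fS y z <= fV F x z <= (q + 1)%:~R * fS y z,
      fU F x y + fV F x z <= (al F)%:~R * fS y z &
      fU F x y + fV F x z <= (be F)%:~R * fS y z].

Lemma fS_swap y z : fS z y = fS y z. Proof. by rewrite /fS addrC. Qed.
Lemma fU_swap F x z : fU (fswap F) x z = fV F x z. Proof. by []. Qed.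
Lemma fV_swap F x y : fV (fswap F) x y = fU F x y. Proof. by []. Qed.

Lemma in_cell_swap F p q x y z : in_cell F p q x y z -> in_cell (fswap F) q p x z y.
Proof.
by move=> [h1 h2 h3 h4]; split=> /=; rewrite fS_swap ?fU_swap ?fV_swap // addrC.
Qed.

(** The linear form [(x, y, z)] on the exponents of the monomial of
    [(i, n)]. *)
Definition cost x y z (i n : int) : R :=
  x * i%:~R + (if 0 <= n then y * n%:~R else - (z * n%:~R)).

Lemma cost_swap x y z i n : cost x z y i (- n) = cost x y z i n.
Proof.
rewrite /cost; case: ifP; case: ifP => h1 h2; congr (_ + _); rewrite rmorphN /=.
- have -> : n = 0 by ilia R.
  by rewrite oppr0 !mulr0.
- ring.
- ring.
- ilia R.
Qed.

(** The monomial [yz] has non-negative cost, so that the formula for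
    non-negative rows is a lower bound on all rows. *)
Lemma cost_ge_y x y z i n : 0 <= y -> 0 <= z ->
  x * i%:~R + y * n%:~R <= cost x y z i n.
Proof.
move=> y0 z0; rewrite /cost; case: ifP => n0 //.
have : n%:~R <= (0 : R) by rewrite lerz0; ilia R.
nra.
Qed.

Lemma cost_ge_z x y z i n : 0 <= y -> 0 <= z ->
  x * i%:~R - z * n%:~R <= cost x y z i n.
Proof.
by move=> y0 z0; rewrite -cost_swap -mulrN -rmorphN; apply: cost_ge_y.
Qed.

(** Let [(s, t)] be the coordinates of the difference of the two points in the
    basis of relations.  Both lower bounds of the cost of [(i, n)] are the cost
    of [(i', n')] plus a combination, with coefficients depending on [s] and
    [t], of the slacks in the inequalities of the cell; according to the signs
    of [s] and [t], the width of row [n'] makes one of them non-negative. *)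
Lemma cost_min_half r b F p q x y z i n i' n' s t : 0 < r ->
  is_frame r b F -> is_cell F p q -> in_cell F p q x y z ->
  0 <= x -> 0 <= y -> 0 <= z ->
  in_graph F p q i' n' -> 0 <= n' -> 0 <= i ->
  i - i' = s * fA F + t * fB F -> n - n' = - s * al F + t * be F ->
  cost x y z i' n' <= cost x y z i n.
Proof.
move=> r0 [[a0 b0 A0 B0] [hr _ _ _ _]] [[p0 q0 pq1 pq2] _] [cU cV cm1 cm2]
  x0 y0 z0 [i'0 _ n'2 [_ i'2 i'3]] n'0 i0 ei en.
have AB : 0 < fA F + fB F by inia R.
have zi (k : int) : 0 <= k -> 0 <= k%:~R :> R by move=> ?; rewrite ler0z.
have zl (k l : int) : k <= l -> k%:~R <= l%:~R :> R by move=> ?; rewrite ler_int.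
set S := fS y z in cU cV cm1 cm2.
set U := fU F x y in cU cm1 cm2.
set V := fV F x z in cV cm1 cm2.
have S0 : 0 <= S by rewrite addr_ge0.
have eU : (al F)%:~R * y - (fA F)%:~R * x = U by [].
have eV : (be F)%:~R * z - (fB F)%:~R * x = V by [].
have eS : S = y + z by [].
have aU : 0 <= (al F)%:~R * S - U.
  have -> : (al F)%:~R * S - U = (al F)%:~R * z + (fA F)%:~R * x by rewrite -eU eS; ring.
  by apply: addr_ge0; apply: mulr_ge0 => //; apply: zi => //; ilia R.
have bV : 0 <= (be F)%:~R * S - V.
  have -> : (be F)%:~R * S - V = (be F)%:~R * y + (fB F)%:~R * x by rewrite -eV eS; ring.
  by apply: addr_ge0; apply: mulr_ge0 => //; apply: zi => //; ilia R.
have c' : cost x y z i' n' = x * i'%:~R + y * n'%:~R by rewrite /cost n'0.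
have dy : x * i%:~R + y * n%:~R = cost x y z i' n' - s%:~R * U
    + t%:~R * ((be F)%:~R * S - V).
  have -> : i = i' + (s * fA F + t * fB F) by ilia R.
  have -> : n = n' + (- s * al F + t * be F) by ilia R.
  rewrite c' -eU -eV eS; ring.
have dz : x * i%:~R - z * n%:~R = cost x y z i' n' - n'%:~R * S
    + s%:~R * ((al F)%:~R * S - U) - t%:~R * V.
  have -> : i = i' + (s * fA F + t * fB F) by ilia R.
  have -> : n = n' + (- s * al F + t * be F) by ilia R.
  rewrite c' -eU -eV eS; ring.
have cy := cost_ge_y x i n y0 z0.
have cz := cost_ge_z x i n y0 z0.
have nq : fB F = 0 -> n' <= q by move=> ?; ilia R.
have V0 : fA F != 0 -> 0 <= V.
  move=> An; have /andP[h _] := cV An; apply: le_trans h.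
  by rewrite mulr_ge0 // zi.
have nU : n'%:~R * S <= (al F)%:~R * S - U.
  have [B00|Bn] := eqVneq (fB F) 0.
    have An : fA F != 0 by ilia R.
    have /andP[h _] := cV An.
    have : n'%:~R * S <= q%:~R * S by rewrite ler_wpM2r // zl // nq.
    by lra.
  have /andP[_ h] := cU Bn.
  have : n'%:~R * S <= (al F - 1 - p)%:~R * S by rewrite ler_wpM2r // zl.
  by lra.
case: (leP s 0) => hs; case: (leP 0 t) => ht.
- apply: le_trans cy; rewrite dy -addrA lerDl addr_ge0 ?mulr_ge0 ?zi //.
  case: (eqVneq s 0) => [->|sn]; first by rewrite mul0r oppr0.
  have [B00|Bn] := eqVneq (fB F) 0.
    have := nq B00; inia R.
  have /andP[h _] := cU Bn.
  rewrite -mulNr -rmorphN mulr_ge0 ?zi //; first by ilia R.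
  by apply: le_trans h; rewrite mulr_ge0 // zi.
- have [s0|sn] := eqVneq s 0; last first.
    have : fA F + fB F <= i' by inia R.
    case: (leP n' q) => ?; ilia R.
  subst s.
  have iB : fB F <= i' by inia R.
  have n'q : n' <= q by case: (leP n' q) => // ?; ilia R.
  have An : fA F != 0 by ilia R.
  apply: le_trans cz; rewrite dz mul0r addr0 {cy dy dz c'}; move: (cost x y z i' n') => c.
  have /andP[h _] := cV An.
  have h2 : n'%:~R * S <= q%:~R * S by rewrite ler_wpM2r // zl.
  have h3 : V <= - t%:~R * V by rewrite ler_peMl ?V0 // -rmorphN ler1z; ilia R.
  by lra.
- case: (leP t (s - 1)) => ts.
    apply: le_trans cz; rewrite dz {cy dy dz c'}; move: (cost x y z i' n') => c.
    have h1 : (s - 1)%:~R * ((al F)%:~R * S - U) >= t%:~R * ((al F)%:~R * S - U).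
      by rewrite ler_wpM2r // zl.
    have h2 : t%:~R * V <= t%:~R * ((al F)%:~R * S - U).
      by rewrite ler_wpM2l ?zi //; lra.
    by lra.
  apply: le_trans cy; rewrite dy {cz dy dz c'}; move: (cost x y z i' n') => c.
  have h1 : s%:~R * ((be F)%:~R * S - V) <= t%:~R * ((be F)%:~R * S - V).
    by rewrite ler_wpM2r // zl //; ilia R.
  have h2 : s%:~R * U <= s%:~R * ((be F)%:~R * S - V).
    by rewrite ler_wpM2l ?zi //; [ilia R|lra].
  by lra.
- have An : fA F != 0.
    apply/eqP => A00; have n'q : n' <= q by case: (leP n' q) => // ?; inia R.
    inia R.
  apply: le_trans cz; rewrite dz {cy dy dz c'}; move: (cost x y z i' n') => c.
  have h1 : (al F)%:~R * S - U <= s%:~R * ((al F)%:~R * S - U).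
    by rewrite ler_peMl // ler1z; ilia R.
  have h2 : 0 <= - t%:~R * V by rewrite mulr_ge0 ?V0 // -rmorphN zi //; ilia R.
  by lra.
Qed.

Lemma cost_min r b F p q x y z i n i' n' k : 0 < r ->
  is_frame r b F -> is_cell F p q -> in_cell F p q x y z ->
  0 <= x -> 0 <= y -> 0 <= z ->
  in_graph F p q i' n' -> 0 <= i -> (i - i') + b * (n - n') = k * r ->
  cost x y z i' n' <= cost x y z i n.
Proof.
move=> r0 fF cF iF x0 y0 z0 gm i0 e.
have [s [t [ei en]]] := frame_lattice r0 fF e.
have [n0|n0] := leP 0 n'; first exact: (cost_min_half r0 fF cF iF x0 y0 z0 gm n0 i0 ei en).
rewrite -(cost_swap _ _ _ i n) -(cost_swap _ _ _ i' n').
apply: (cost_min_half (s := t) (t := s) r0 (is_frame_swap fF) (is_cell_swap cF) (in_cell_swap iF)) => //.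
- exact: in_graph_swap.
- ilia R.
- by rewrite /=; ilia R.
- by rewrite /=; ilia R.
Qed.

End Cost.

(** * Strictly cheapest monomials *)

Definition is_vtx (F : frame) (p q : int) : Prop :=
  [/\ 1 <= p, 1 <= q, p + q <= al F & p + q <= be F] /\
  (fA F = 0 -> p + q = be F) /\ (fB F = 0 -> p + q = al F).

(** The rows [n] such that [(0, n)] is strictly the cheapest of its weight at
    the grid point [(p, q)].  On the line [p + q = be] the relation
    [(fA + fB, be - al)] has cost 0, which gives one more condition, and
    similarly on the line [p + q = al]. *)
Definition good_row (F : frame) (p q n : int) : Prop :=
  [/\ q - be F < n, n < al F - p, p + q = be F -> n < al F - be F &
      p + q = al F -> al F - be F < n].

Lemma is_vtx_swap F p q : is_vtx F p q -> is_vtx (fswap F) q p.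
Proof. by move=> [[? ? ? ?] [? ?]]; split; [split|split] => /=; lia. Qed.

Lemma good_row_swap F p q n : good_row F p q n -> good_row (fswap F) q p (- n).
Proof. by move=> [? ? ? ?]; split => /=; lia. Qed.

(** At a grid point, the two lower bounds of the cost of a monomial of the same
    weight exceed the cost of [(0, n0)] by these integers times [fS]; one of
    them is positive. *)
Lemma strict_int r b F p q n0 s t : 0 < r -> is_frame r b F -> is_vtx F p q ->
  good_row F p q n0 -> 0 <= n0 -> 0 <= s * fA F + t * fB F -> ~ (s = 0 /\ t = 0) ->
  0 < - s * p + t * (be F - q) \/ 0 < - n0 + s * (al F - p) - t * q.
Proof.
move=> r0 [[a0 b0 A0 B0] [hr _ _ _ _]] [[p1 q1 pa pb] [dA dB]] [g1 g2 g3 g4]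
  n00 i0 st0.
have AB : 0 < fA F + fB F by nia.
have bq : 1 <= be F - q by lia.
have [hs|hs] := leP s 0; have [ht|ht] := leP 0 t.
- left; have : 0 < - s \/ 0 < t by lia.
  by nia.
- have s0 : s = 0 by clear -i0 hs ht A0 B0 AB; nia.
  have B00 : fB F = 0 by clear -i0 s0 ht A0 B0 AB; nia.
  by right; have := dB B00; clear -s0 ht g1 g2 q1; nia.
- have [ts|ts] := leP s t.
    have [e|ne] := leP (be F) (p + q).
      have e' : p + q = be F by lia.
      have g := g3 e'.
      have [->|tn] := eqVneq t s; last by left; nia.
      by right; nia.
    by left; nia.
  right; have [e|ne] := leP (al F) (p + q).
    have e' : p + q = al F by lia.
    by nia.
  by nia.
- by right; nia.
Qed.

Section Strict.
Variable R : realFieldType.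
Implicit Types x y z : R.

Lemma strict_half r b F p q x y z n0 i n s t : 0 < r -> is_frame r b F ->
  is_vtx F p q -> good_row F p q n0 -> 0 <= x -> 0 <= y -> 0 <= z -> 0 < fS y z ->
  fU F x y = p%:~R * fS y z -> fV F x z = q%:~R * fS y z ->
  0 <= n0 -> 0 <= i -> i = s * fA F + t * fB F ->
  n - n0 = - s * al F + t * be F -> ~ (s = 0 /\ t = 0) ->
  cost x y z 0 n0 < cost x y z i n.
Proof.
move=> r0 fF vF gn x0 y0 z0 S0 eU eV n00 i0 ei en st0.
have := strict_int r0 fF vF gn n00 _ st0; rewrite -ei => /(_ i0) D.
have c' : cost x y z 0 n0 = y * n0%:~R by rewrite /cost n00 mulr0 add0r.
have en' : n = n0 + (- s * al F + t * be F) by ilia R.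
have dy : x * i%:~R + y * n%:~R = y * n0%:~R
   + (- s * p + t * (be F - q))%:~R * fS y z.
  rewrite ei en'.
  have -> : (- s * p + t * (be F - q))%:~R * fS y z = - s%:~R * fU F x y +
     t%:~R * ((be F)%:~R * fS y z - fV F x z) by rewrite eU eV; ring.
  by rewrite /fU /fV /fS; ring.
have dz : x * i%:~R - z * n%:~R = y * n0%:~R
   + (- n0 + s * (al F - p) - t * q)%:~R * fS y z.
  rewrite ei en'.
  have -> : (- n0 + s * (al F - p) - t * q)%:~R * fS y z = - n0%:~R * fS y z +
     s%:~R * ((al F)%:~R * fS y z - fU F x y) - t%:~R * fV F x z.
    by rewrite eU eV; ring.
  by rewrite /fU /fV /fS; ring.
rewrite c'; case: D => D.
  apply: lt_le_trans (cost_ge_y _ _ _ y0 z0).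
  by rewrite dy ltrDl mulr_gt0 // ltr0z.
apply: lt_le_trans (cost_ge_z _ _ _ y0 z0).
by rewrite dz ltrDl mulr_gt0 // ltr0z.
Qed.

Lemma strict_min r b F p q x y z n0 i n k : 0 < r -> is_frame r b F ->
  is_vtx F p q -> good_row F p q n0 -> 0 <= x -> 0 <= y -> 0 <= z -> 0 < fS y z ->
  fU F x y = p%:~R * fS y z -> fV F x z = q%:~R * fS y z ->
  0 <= i -> i + b * (n - n0) = k * r -> ~ (i = 0 /\ n = n0) ->
  cost x y z 0 n0 < cost x y z i n.
Proof.
move=> r0 fF vF gn x0 y0 z0 S0 eU eV i0 e ne.
have [s [t [ei en]]] := frame_lattice r0 fF e.
have st0 : ~ (s = 0 /\ t = 0) by move=> [s0 t0]; apply: ne; subst s t; ilia R.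
have [n00|n00] := leP 0 n0.
  exact: (strict_half r0 fF vF gn x0 y0 z0 S0 eU eV n00 i0 ei en st0).
rewrite -(cost_swap _ _ _ i n) -(cost_swap _ _ _ 0 n0).
have S0' : 0 < fS z y by rewrite fS_swap.
have eV' : fU (fswap F) x z = q%:~R * fS z y by rewrite fS_swap.
have eU' : fV (fswap F) x y = p%:~R * fS z y by rewrite fS_swap.
apply: (strict_half (s := t) (t := s) r0 (is_frame_swap fF) (is_vtx_swap vF)
  (good_row_swap gn) x0 z0 y0 S0' eV' eU' _ i0); rewrite /=.
- by ilia R.
- by ilia R.
- by ilia R.
- by move=> [? ?]; apply: st0.
Qed.

(** At the triple point [fU = fV = 0], where [fA = fB = 1].  There [x], [y^al]
    and [z^be] have the same cost, and the cheapest monomial with the weight of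
    [x^2] is [y^(al - be)] if [be <= al]. *)
Lemma strict_triple_half (al be : int) x y z i n s t : 0 < al -> 0 < be ->
  be <= al -> 0 <= x -> 0 <= y -> 0 <= z -> 0 < y + z ->
  al%:~R * y = x -> be%:~R * z = x ->
  0 <= i -> i = s + t -> n - (al - be) = - s * al + t * be ->
  ~ (s = 0 /\ t = 0) ->
  cost x y z 0 (al - be) < cost x y z i n.
Proof.
move=> a0 b0 ab x0 y0 z0 S0 eU eV i0 ei en st0.
have n00 : 0 <= al - be by ilia R.
have c' : cost x y z 0 (al - be) = y * (al - be)%:~R by rewrite /cost n00 mulr0 add0r.
rewrite c'.
have en' : n = al - be - s * al + t * be by ilia R.
have [t0|t0] := leP t 0.
  apply: lt_le_trans (cost_ge_z _ _ _ y0 z0).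
  have -> : x * i%:~R - z * n%:~R = y * (al - be)%:~R
   + (- (al - be) + s * al)%:~R * (y + z).
    rewrite ei en'.
    have -> : x * (s + t)%:~R = s%:~R * x + t%:~R * x by ring.
    rewrite -{1}eU -eV; ring.
  rewrite ltrDl mulr_gt0 // ltr0z; inia R.
apply: lt_le_trans (cost_ge_y _ _ _ y0 z0).
have -> : x * i%:~R + y * n%:~R = y * (al - be)%:~R + (t * be)%:~R * (y + z).
  rewrite ei en'.
  have -> : x * (s + t)%:~R = s%:~R * x + t%:~R * x by ring.
  rewrite -{1}eU -eV; ring.
by rewrite ltrDl mulr_gt0 // ltr0z; inia R.
Qed.

End Strict.

(** * Row widths of a graph *)

(** A G-graph in the coordinates [(i, n)]: it is closed under divisors, and
    each residue [i + b n] modulo [r] is taken exactly once. *)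
Definition is_graph (r b : int) (G : int -> int -> Prop) : Prop :=
  [/\ forall i n, G i n -> 0 <= i,
      forall i i' n, G i n -> 0 <= i' -> i' <= i -> G i' n,
      forall i n n', G i n -> 0 <= n' -> n' <= n -> G i n' &
      forall i n n', G i n -> n <= n' -> n' <= 0 -> G i n'] /\
  [/\ forall i n i' n' k, G i n -> G i' n' -> (i - i') + b * (n - n') = k * r ->
        i = i' /\ n = n' &
      forall c, exists i n k, G i n /\ i + b * n = c + k * r].

Lemma is_graph_swap r b G : is_graph r b G -> is_graph r (- b) (fun i n => G i (- n)).
Proof.
move=> [[h1 h2 h3 h4] [h5 h6]]; split; split=> //.
- by move=> i n; apply: h1.
- by move=> i i' n; apply: h2.
- by move=> i n n' h *; apply: (h4 _ _ _ h); lia.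
- by move=> i n n' h *; apply: (h3 _ _ _ h); lia.
- by move=> i n i' n' k g g' e; have := h5 _ _ _ _ k g g'; lia.
- move=> c; have [i [n [k [g e]]]] := h6 c.
  by exists i, (- n), k; rewrite opprK; split=> //; lia.
Qed.

Lemma down_bound (P : int -> Prop) (r : int) : 0 <= r ->
  (forall i i', P i -> 0 <= i' -> i' <= i -> P i') -> ~ P r ->
  exists2 m, 0 <= m & m <= r /\ forall i, 0 <= i -> (P i <-> i < m).
Proof.
move=> r0 dP nP.
have [m [mr h]] : exists m : nat, (m%:Z <= r) /\ ~ P m%:Z /\ forall k : nat, (k < m)%N -> P k%:Z.
  have [N eN] : exists N : nat, r = N%:Z by exists `|r|%N; lia.
  subst r; elim: N nP {r0} => [|N IH] nP; first by exists 0%N.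
  have [PN|nPN] := pselect (P N%:Z).
    exists N.+1; split=> //; split=> // k kN; apply: (dP _ _ PN) => //; lia.
  by have [m [? ?]] := IH nPN; exists m; split=> //; lia.
exists m%:Z => //; split=> // i i0; have [h1 h2] := h; split=> hi.
  rewrite ltNge; apply/negP => mi; apply: h1; exact: dP hi _ mi.
have [k ek] : exists k : nat, i = k%:Z by exists `|i|%N; lia.
by subst i; apply: h2.
Qed.

Section Classify.
Variables r b : int.
Hypothesis r2 : 1 < r.
Hypothesis binv : exists b' k, b * b' = 1 + k * r.

Lemma dvd_unit d k : b * d = k * r -> exists k', d = k' * r.
Proof.
have [b' [l e]] := binv; move=> h.
exists (b' * k - l * d).
have : (b * b') * d = b' * (b * d) by ring.
by rewrite e h mulrDl mul1r => h1; rewrite mulrBl -(mulrA b') -h1; ring.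
Qed.

Lemma multiple_ge (d : int) k : d = k * r -> 0 < d -> r <= d.
Proof. move=> -> h; have k0 : 0 < k by nia.
by nia. Qed.

Definition ends (G : int -> int -> Prop) (J K : int) : Prop :=
  [/\ 0 < J, 0 < K & forall n, G 0 n <-> - K < n /\ n < J].

Lemma graph0 G : is_graph r b G -> G 0 0.
Proof.
move=> [[h1 h2 h3 h4] [h5 h6]].
have [i [n [k [g e]]]] := h6 0.
have g' : G 0 n by apply: (h2 _ _ _ g) => //; apply: h1 g.
by have [?|?] := leP 0 n; [apply: (h3 _ _ _ g')|apply: (h4 _ _ _ g'); lia].
Qed.

Lemma graph_end G : is_graph r b G -> exists J, 0 < J /\ forall n, 0 <= n -> (G 0 n <-> n < J).
Proof.
move=> gG; have g0 := graph0 gG; move: gG => [[h1 h2 h3 h4] [h5 h6]].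
have [|i i' g ? ?||J J0 [Jr HJ]] := @down_bound (G 0) r; first by lia.
- exact: h3 g _ _.
- by move=> g; have := h5 0 r 0 0 b g g0; lia.
- by exists J; split=> //; apply/HJ.
Qed.

Lemma graph_width G n : is_graph r b G -> G 0 n ->
  exists h, 0 < h /\ h <= r /\ forall i, 0 <= i -> (G i n <-> i < h).
Proof.
move=> gG g0; move: gG => [[h1 h2 h3 h4] [h5 h6]].
have [|i i' g ? ?||h h0 [hr H]] := @down_bound (fun i => G i n) r; first by lia.
- exact: h2 g _ _.
- by move=> g; have := h5 r n 0 n 1 g g0; lia.
- by exists h; split=> //; apply/H.
Qed.

End Classify.

Lemma graph_ends r b G : 1 < r -> is_graph r b G -> exists J K, ends G J K.
Proof.
move=> r2 gG; have [J [J0 HJ]] := graph_end r2 gG.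
have [K [K0 HK]] := graph_end r2 (is_graph_swap gG).
exists J, K; split=> // n; have [n0|n0] := leP 0 n.
  by rewrite HJ //; split; lia.
by have := HK (- n); rewrite opprK => ->; [split|]; lia.
Qed.

(** [y^J] and [z^K] are the least powers outside the graph; [(A, - p)] and
    [(B, q)] are the elements of the graph of the same weights. *)
Definition partners (r b : int) (G : int -> int -> Prop) (J K A p B q : int) : Prop :=
  [/\ is_graph r b G, ends G J K,
      [/\ 0 < A, 0 <= p, G A (- p) & exists k, A + b * - p = b * J + k * r] &
      [/\ 0 < B, 0 <= q, G B q & exists k, B + b * q = - b * K + k * r]].

Lemma partners_swap r b G J K A p B q : partners r b G J K A p B q ->
  partners r (- b) (fun i n => G i (- n)) K J B q A p.
Proof.
move=> [gG [J0 K0 HJ] [h1 h2 h3 [k1 h4]] [h5 h6 h7 [k2 h8]]]; split.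
- exact: is_graph_swap.
- by split=> // n; rewrite HJ; split; lia.
- by split=> //; [rewrite opprK|exists k2; lia].
- by split=> //; exists k1; lia.
Qed.

(** Leaving a row on the right leads to the weight of an element of the first
    column: otherwise the left neighbours would be two elements of the graph
    of the same weight. *)
Lemma graph_next r b G n h : is_graph r b G -> 0 < h -> G (h - 1) n -> ~ G h n ->
  exists n' k, G 0 n' /\ h + b * n = b * n' + k * r.
Proof.
move=> [[h1 h2 h3 h4] [h5 h6]] h0 g ng.
have [i [n' [k [g' e]]]] := h6 (h + b * n).
have [i0|i0] := eqVneq i 0.
  by subst i; exists n', (- k); split=> //; lia.
have i1 := h1 _ _ g'.
have g'' : G (i - 1) n' by apply: (h2 _ _ _ g'); lia.
have [e1 e2] : i - 1 = h - 1 /\ n' = n by apply: (h5 _ _ _ _ k g'' g); lia.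
have ih : i = h by lia.
by case: ng; rewrite -ih -e2.
Qed.

Section Rows.
Variables (r b : int) (G : int -> int -> Prop) (J K A p B q : int).
Hypothesis r2 : 1 < r.
Hypothesis D : partners r b G J K A p B q.

Let gG : is_graph r b G. Proof. by case: D. Qed.

Let inj i n i' n' k :
  G i n -> G i' n' -> (i - i') + b * (n - n') = k * r -> i = i' /\ n = n'.
Proof. by case: gG => _ [h _]; apply: h. Qed.

Let g0 n : G 0 n <-> - K < n /\ n < J. Proof. by case: D => _ []. Qed.

Let decr i i' n : G i n -> 0 <= i' -> i' <= i -> G i' n.
Proof. by case: gG => [[_ h _ _] _]; apply: h. Qed.

(** If the row were wider, the relation between [(A, - p)] and [y^J],
    translated, would relate [(A, n)] to an element of the first column.  If it
    were narrower, the element found on leaving the row would produce a second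
    relation between elements of the graph. *)
Lemma row_left n : - K < n -> n < - p -> forall i, 0 <= i -> (G i n <-> i < A).
Proof.
move: D => [_ [J0 K0 _] [A0 p0 gA [kA eA]] [B0 q0 gB [kB eB]]] nK np.
have gn : G 0 n by apply/g0; lia.
have [h [h0 [hr hw]]] := graph_width r2 gG gn.
suff -> : A = h by [].
have hA : h <= A.
  rewrite leNgt; apply/negP => Ah.
  have g1 : G A n by apply/hw; lia.
  have g2 : G 0 (n + J + p) by apply/g0; lia.
  by have [] := inj (k := kA) g1 g2; lia.
have g1 : G (h - 1) n by apply/hw; lia.
have g2 : ~ G h n by rewrite hw; lia.
have [n' [k [gn' e]]] := graph_next gG h0 g1 g2.
move/g0: gn' => [n'1 n'2].
have [gt|lt|eq] := ltgtP n n'.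
- apply/eqP; rewrite eq_le hA andbT leNgt; apply/negP => hA'.
  have g3 : G (A - h) (- p) by apply: (decr gA); lia.
  have g4 : G 0 (J - (n' - n)) by apply/g0; lia.
  by have [] := inj (k := kA - k) g3 g4; lia.
- have gh : G h 0.
    case: gG => [[_ _ _ hz] _].
    by apply: (hz _ (- p)); [apply: (decr gA); lia|lia..].
  have g4 : G 0 (n' - n) by apply/g0; lia.
  by have [] := inj (k := k) gh g4; lia.
- have gh : G h 0.
    case: gG => [[_ _ _ hz] _].
    by apply: (hz _ (- p)); [apply: (decr gA); lia|lia..].
  have g4 : G 0 0 by apply/g0; lia.
  by have [] := inj (k := k) gh g4; lia.
Qed.

End Rows.

Lemma row_right r b G J K A p B q n : 1 < r -> partners r b G J K A p B q ->
  q < n -> n < J -> forall i, 0 <= i -> (G i n <-> i < B).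
Proof.
move=> r2 D qn nJ i i0.
have := @row_left _ _ _ _ _ _ _ _ _ r2 (partners_swap D) (- n) _ _ i i0.
by rewrite opprK; apply; lia.
Qed.

Section Mid.
Variables (r b : int) (G : int -> int -> Prop) (J K A p B q : int).
Hypothesis r2 : 1 < r.
Hypothesis D : partners r b G J K A p B q.

Let gG : is_graph r b G. Proof. by case: D. Qed.

Let inj i n i' n' k :
  G i n -> G i' n' -> (i - i') + b * (n - n') = k * r -> i = i' /\ n = n'.
Proof. by case: gG => _ [h _]; apply: h. Qed.

Let g0 n : G 0 n <-> - K < n /\ n < J. Proof. by case: D => _ []. Qed.

Let decr i i' n : G i n -> 0 <= i' -> i' <= i -> G i' n.
Proof. by case: gG => [[_ h _ _] _]; apply: h. Qed.

(** Leaving a middle row narrower than [A + B] does not lead to a higher row: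
    comparison with the partner of [y^J] would relate two elements of the
    graph. *)
Lemma row_mid_step n h n' k : - p <= n -> n <= q -> 0 < h ->
  - K < n' -> n' < J -> h + b * n = b * n' + k * r -> n < n' -> h < A + B ->
  G h 0 \/ n' - n < J -> False.
Proof.
move: D => [_ [J0 K0 _] [A0 p0 gA [kA eA]] [B0 q0 gB [kB eB]]].
move=> np nq h0 n'K n'J e nn hAB hd.
have pK : - p > - K.
  by have /g0 : G 0 (- p) by [apply: (decr gA); lia]; lia.
have gp : G 0 (- p) by apply/g0; lia.
have [hA|hA|hA] := ltgtP h A.
- have g3 : G (A - h) (- p) by apply: (decr gA); lia.
  have g4 : G 0 (J - (n' - n)) by apply/g0; lia.
  by have [] := inj (k := kA - k) g3 g4; lia.
- have [dJ|dJ] := ltP (n' - n) J.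
    have g3 : G (h - A) (J - (n' - n)).
      have [qJ|qJ] := ltP q (J - (n' - n)).
        by apply/(row_right r2 D) => //; lia.
      case: gG => [[_ _ hy _] _].
      by apply: (hy _ q); [apply: (decr gB); lia|lia..].
    by have [] := inj (k := k - kA) g3 gp; lia.
  have gh : G h 0 by case: hd => //; lia.
  have g3 : G A (- (p + J - (n' - n))).
    case: gG => [[_ _ _ hz] _].
    by apply: (hz _ (- p)) => //; lia.
  by have [] := inj (k := k - kA) gh g3; lia.
- have g4 : G 0 (J - (n' - n)) by apply/g0; lia.
  by have [] := inj (k := k - kA) g4 gp; lia.
Qed.

End Mid.

Section Mid2.
Variables (r b : int) (G : int -> int -> Prop) (J K A p B q : int).
Hypothesis r2 : 1 < r.
Hypothesis D : partners r b G J K A p B q.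

Let gG : is_graph r b G. Proof. by case: D. Qed.

Let inj i n i' n' k :
  G i n -> G i' n' -> (i - i') + b * (n - n') = k * r -> i = i' /\ n = n'.
Proof. by case: gG => _ [h _]; apply: h. Qed.

Let g0 n : G 0 n <-> - K < n /\ n < J. Proof. by case: D => _ []. Qed.

Let decr i i' n : G i n -> 0 <= i' -> i' <= i -> G i' n.
Proof. by case: gG => [[_ h _ _] _]; apply: h. Qed.

(** The relations of the two partners add up to one between [(A + B, m)] and
    the first column, so that no row is wider than [A + B].  A narrower row can
    only be followed by itself, so that its width is a multiple of [r]; then the
    graph would be [1, x, ..., x^(r - 1)], where [A + B = r] too. *)
Lemma row_mid n : - p <= n -> n <= q -> forall i, 0 <= i -> (G i n <-> i < A + B).
Proof.
have [_ [J0 K0 _] [A0 p0 gA [kA eA]] [B0 q0 gB [kB eB]]] := D.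
have pK : - K < - p by have /g0 : G 0 (- p) by [apply: (decr gA); lia]; lia.
have qJ : q < J by have /g0 : G 0 q by [apply: (decr gB); lia]; lia.
have upper (m h : int) : - p <= m -> m <= q -> (forall i, 0 <= i -> (G i m <-> i < h)) ->
    h <= A + B.
  move=> mp mq hw; rewrite leNgt; apply/negP => Ah.
  have g1 : G (A + B) m by apply/hw; lia.
  have g2 : G 0 (m + J + p - K - q) by apply/g0; lia.
  by have [] := inj (k := kA + kB) g1 g2; lia.
(* Leaving a row narrower than [A + B] does not lead to a higher or lower row,
   hence to the row itself. *)
have low (m h : int) : - p <= m -> m <= q -> 0 < h -> (forall i, 0 <= i -> (G i m <-> i < h)) ->
    h < A + B -> G h 0 \/ m = 0 -> m = 0 /\ exists k, h = k * r.
  move=> mp mq h0 hw hAB hd.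
  have g1 : G (h - 1) m by apply/hw; lia.
  have g2 : ~ G h m by rewrite hw; lia.
  have [n' [k [gn' e]]] := graph_next gG h0 g1 g2.
  move/g0: (gn') => [n'1 n'2].
  have [gt|lt|eq] := ltgtP m n'.
  - by case: (@row_mid_step _ _ _ _ _ _ _ _ _ r2 D m h n' k) => //; case: hd; [left|right; lia].
  - case: (@row_mid_step _ _ _ _ _ _ _ _ _ r2 (partners_swap D) (- m) h (- n') k); try lia.
    by case: hd; [left; rewrite oppr0|right; lia].
  - subst n'; split; last by exists k; lia.
    case: hd => // gh; have g3 : G 0 0 by apply/g0; lia.
    by have [] := inj (k := k) gh g3; lia.
have gz : G 0 0 by apply/g0; lia.
have [h [h0 [hr hw]]] := graph_width r2 gG gz.
have hA : h = A + B.
  apply/eqP; rewrite eq_le (upper 0) ?andTb //; try lia; rewrite leNgt; apply/negP => hAB.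
  have [_ [k ek]] : 0 = 0 :> int /\ exists k, h = k * r.
    by apply: low hw _ _ => //; try lia; right.
  have k1 : 0 < k by nia.
  have k2 : k <= 1 by nia.
  have eh : h = r by rewrite ek (_ : k = 1) ?mul1r //; lia.
  rewrite {h h0 hr ek}eh in hAB hw.
  have AB : A < r /\ B < r.
    have gA' : G A 0.
      by case: gG => [[_ _ _ hz] _]; apply: (hz _ (- p)) => //; lia.
    have gB' : G B 0.
      by case: gG => [[_ _ hy _] _]; apply: (hy _ q) => //; lia.
    by split; [apply: (proj1 (hw A _))|apply: (proj1 (hw B _))] => //; lia.
  have only m : G 0 m -> m = 0.
    move=> gm; have gi : G ((b * m) %% r)%Z 0 by apply/hw; lia.
    by have [] := inj (k := - ((b * m) %/ r)%Z) gi gm; lia.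
  have J1 : J = 1.
    by apply/eqP; rewrite eq_le; apply/andP; split; [rewrite leNgt; apply/negP => ?|lia];
       have : G 0 1 -> 1 = 0 := only 1; rewrite g0; lia.
  have K1 : K = 1.
    by apply/eqP; rewrite eq_le; apply/andP; split; [rewrite leNgt; apply/negP => ?|lia];
       have : G 0 (-1) -> -1 = 0 := only (-1); rewrite g0; lia.
  have p00 : p = 0 by lia.
  have q00 : q = 0 by lia.
  subst p q J K.
  have e : A + B = (kA + kB) * r by lia.
  have [? ?] := AB.
  have k1' : kA + kB < 2 by clear -e AB r2; nia.
  have k2' : 1 < kA + kB by clear -e hAB r2; nia.
  by lia.
move=> np nq.
have gn : G 0 n by apply/g0; lia.
have [hn [hn0 [hnr hnw]]] := graph_width r2 gG gn.
suff -> : A + B = hn by [].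
apply/eqP; rewrite eq_le (upper n) // andbT leNgt; apply/negP => hAB.
have gh : G hn 0 by apply/hw; lia.
have [n00 _] : n = 0 /\ exists k, hn = k * r.
  by apply: low hnw _ _ => //; left.
by subst n; move/hnw: gh; lia.
Qed.

End Mid2.

(** * Counting and classification of the graphs *)

Definition block (lo : int) (len w : nat) : seq (int * int) :=
  [seq (i%:Z, lo + n%:Z) | i <- iota 0 w, n <- iota 0 len].

Lemma mem_block lo (len w : nat) (i n : int) :
  ((i, n) \in block lo len w) = [&& 0 <= i, i < w%:Z, lo <= n & n < lo + len%:Z].
Proof.
apply/allpairsP/idP => [[[x y] /= [hx hy [-> ->]]]|/and4P[h1 h2 h3 h4]].
  by move: hx hy; rewrite !mem_iota; lia.
by exists (`|i|%N, `|n - lo|%N) => /=; rewrite !mem_iota; split; [lia|lia|congr pair; lia].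
Qed.

Lemma uniq_block lo len w : uniq (block lo len w).
Proof.
apply: allpairs_uniq; rewrite ?iota_uniq //.
by move=> [x y] [x' y'] _ _ /= [h1 h2]; congr pair; lia.
Qed.

Lemma size_block lo len w : size (block lo len w) = (w * len)%N.
Proof. by rewrite size_allpairs !size_iota. Qed.

Definition graph_seq (F : frame) (p q : int) : seq (int * int) :=
  block (q + 1 - be F) `|(be F - 1 - q - p)%R|%N `|fA F|%N ++
  block (- p) `|(p + q + 1)%R|%N `|(fA F + fB F)%R|%N ++
  block (q + 1) `|(al F - 1 - p - q)%R|%N `|fB F|%N.

Definition weak_cell (F : frame) (p q : int) : Prop :=
  [/\ 0 <= p, 0 <= q, p + q < al F & p + q < be F].

Lemma mem_graph_seq F p q i n : 0 <= fA F -> 0 <= fB F -> weak_cell F p q ->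
  (i, n) \in graph_seq F p q <-> in_graph F p q i n.
Proof.
move=> A0 B0 [p0 q0 pa pb]; rewrite !mem_cat !mem_block; split.
  by case/or3P => /and4P[? ? ? ?]; (split; [lia..|split; lia]).
move=> [? ? ? [h1 h2 h3]].
have [n1|n1] := ltP n (- p); first by have := h1 n1; lia.
have [n2|n2] := leP n q; first by have := h2 n1 n2; lia.
by have := h3 n2; lia.
Qed.

Lemma uniq_graph_seq F p q : weak_cell F p q -> uniq (graph_seq F p q).
Proof.
move=> [p0 q0 pa pb]; rewrite !cat_uniq !uniq_block /= andbT.
apply/andP; split; apply/hasPn => [[i n]]; rewrite ?mem_cat !mem_block; lia.
Qed.

Lemma size_graph_seq F p q : 0 <= fA F -> 0 <= fB F -> weak_cell F p q ->
  (size (graph_seq F p q))%:Z = al F * fB F + be F * fA F.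
Proof.
move=> A0 B0 [p0 q0 pa pb]; rewrite !size_cat !size_block.
have e (x : int) : 0 <= x -> (`|x|%N)%:Z = x by lia.
rewrite !PoszD !PoszM !e; [ring|lia..].
Qed.

Definition wtn (r b : int) (m : int * int) : nat := `|((m.1 + b * m.2) %% r)%Z|%N.

Lemma wtn_eq r b m m' : 0 < r -> wtn r b m = wtn r b m' ->
  exists k, (m.1 - m'.1) + b * (m.2 - m'.2) = k * r.
Proof.
rewrite /wtn => r0 e.
exists (((m.1 + b * m.2) %/ r)%Z - ((m'.1 + b * m'.2) %/ r)%Z).
have h1 := divz_eq (m.1 + b * m.2) r.
have h2 := divz_eq (m'.1 + b * m'.2) r.
have h3 := modz_ge0 (m.1 + b * m.2) (lt0r_neq0 r0).
have h4 := modz_ge0 (m'.1 + b * m'.2) (lt0r_neq0 r0).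
lia.
Qed.

Lemma wtn_ltn r b m : 0 < r -> (wtn r b m < `|r|)%N.
Proof.
move=> r0; have h3 := modz_ge0 (m.1 + b * m.2) (lt0r_neq0 r0).
have h4 := ltz_mod (m.1 + b * m.2) (lt0r_neq0 r0).
by rewrite /wtn; lia.
Qed.

Section Count.
Variables (r b : int) (s : seq (int * int)).
Hypothesis r0 : 0 < r.
Hypothesis us : uniq s.
Hypothesis injs : forall m m' k, m \in s -> m' \in s ->
  (m.1 - m'.1) + b * (m.2 - m'.2) = k * r -> m = m'.

Lemma uniq_wtn : uniq (map (wtn r b) s).
Proof.
rewrite map_inj_in_uniq // => m m' hm hm' /(wtn_eq r0)[k e]; exact: injs e.
Qed.

Lemma sub_wtn : {subset map (wtn r b) s <= iota 0 `|r|}.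
Proof. by move=> _ /mapP[m _ ->]; rewrite mem_iota /= add0n wtn_ltn. Qed.

(** Pigeonhole principle on the residues modulo [r]. *)
Lemma count_sur : (size s)%:Z = r ->
  forall c, exists m k, m \in s /\ m.1 + b * m.2 = c + k * r.
Proof.
move=> es c.
have le : (size (iota 0 `|r|) <= size (map (wtn r b) s))%N.
  by rewrite size_iota size_map -es.
have [_ h] := uniq_min_size uniq_wtn sub_wtn le.
have : wtn r b (c, 0) \in iota 0 `|r| by rewrite mem_iota /= add0n wtn_ltn.
rewrite -h => /mapP[m hm /esym/(wtn_eq r0)[k /= e]].
by exists m, k; split=> //; lia.
Qed.

Lemma count_size :
  (forall c, exists m k, m \in s /\ m.1 + b * m.2 = c + k * r) -> (size s)%:Z = r.
Proof.
move=> sur.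
suff /perm_size : perm_eq (map (wtn r b) s) (iota 0 `|r|).
  by rewrite size_iota size_map; lia.
apply: uniq_perm; rewrite ?uniq_wtn ?iota_uniq // => x.
apply/idP/idP => [hx|hx]; first exact: (sub_wtn hx).
have [m [k [ms e]]] := sur x%:Z; apply/mapP; exists m => //.
rewrite /wtn /= e addrC modzMDl modz_small; first by lia.
by move: hx; rewrite mem_iota; lia.
Qed.

End Count.

(** The coordinates of a relation between two elements of the staircase must
    vanish: no row is wider than [fA + fB], and there are less than [al + be]
    rows. *)
Lemma in_graph_inj r b F p q i n i' n' k : 0 < r -> is_frame r b F -> weak_cell F p q ->
  in_graph F p q i n -> in_graph F p q i' n' -> (i - i') + b * (n - n') = k * r ->
  i = i' /\ n = n'.
Proof.
move=> r0 fF [p0 q0 pa pb] g g' e.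
have [s [t [ei en]]] := frame_lattice r0 fF e.
have [[a0 b0 A0 B0] [hr _ _ _ _]] := fF.
move: g g' => [i0 n1 n2 [g1 g2 g3]] [i'0 n'1 n'2 [g1' g2' g3']].
have AB : 0 < fA F + fB F by nia.
have iAB : i < fA F + fB F by case: (ltP n (- p)); case: (leP n q); lia.
have iAB' : i' < fA F + fB F by case: (ltP n' (- p)); case: (leP n' q); lia.
suff : s = 0 /\ t = 0 by move=> [s0 t0]; subst s t; lia.
clear e hr fF.
have mn (x c : int) : 0 <= c -> x < 0 -> x * c <= - c by clear; nia.
have mp (x c : int) : 0 <= c -> 0 < x -> c <= x * c by clear; nia.
have [a0' b0'] := (ltW a0, ltW b0).
have [hs|hs|hs] := ltgtP s 0; have [ht|ht|ht] := ltgtP t 0 => //.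
- by have := mn s _ A0 hs; have := mn t _ B0 ht; lia.
- by have := mn s _ a0' hs; have := mp t _ b0' ht; lia.
- by have := mn s _ a0' hs; have := mn s _ A0 hs; subst t; lia.
- by have := mp s _ a0' hs; have := mn t _ b0' ht; lia.
- by have := mp s _ A0 hs; have := mp t _ B0 ht; lia.
- by have := mp s _ a0' hs; have := mp s _ A0 hs; subst t; lia.
- by have := mn t _ b0' ht; have := mn t _ B0 ht; subst s; lia.
- by have := mp t _ b0' ht; have := mp t _ B0 ht; subst s; lia.
Qed.

Lemma in_graph_is_graph r b F p q : 0 < r -> is_frame r b F -> weak_cell F p q ->
  is_graph r b (in_graph F p q).
Proof.
move=> r0 fF cF.
have [[a0 b0 A0 B0] [hr _ _ _ _]] := fF.
have [p0 q0 pa pb] := cF.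
split; split.
- by move=> i n [].
- by move=> i i' n [? ? ? [? ? ?]] *; split; [lia..|split; lia].
- by move=> i n n' [? ? ? [? ? ?]] *; split; [lia..|split; lia].
- by move=> i n n' [? ? ? [? ? ?]] *; split; [lia..|split; lia].
- by move=> i n i' n' k; apply: (in_graph_inj r0 fF cF).
move=> c.
have [|||m [k [hm e]]] := @count_sur r b (graph_seq F p q) r0 _ _ _ c.
- exact: uniq_graph_seq.
- move=> [i n] [i' n'] k /(mem_graph_seq _ _ A0 B0 cF) g /(mem_graph_seq _ _ A0 B0 cF) g' /= e.
  by have [-> ->] := in_graph_inj r0 fF cF g g' e.
- by rewrite size_graph_seq.
case: m hm e => i n /(mem_graph_seq _ _ A0 B0 cF) g /= e.
by exists i, n, k.
Qed.

(** A staircase has as many elements as there are weights, and its area is the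
    determinant of the two relations. *)
Lemma graph_count r b G F p q : 0 < r -> is_graph r b G -> 0 <= fA F -> 0 <= fB F ->
  weak_cell F p q -> (forall i n, G i n <-> in_graph F p q i n) ->
  al F * fB F + be F * fA F = r.
Proof.
move=> r0 [_ [inj sur]] A0 B0 cF GE.
rewrite -(size_graph_seq A0 B0 cF); apply: (count_size (b := b) r0).
- exact: uniq_graph_seq.
- move=> [i n] [i' n'] k /(mem_graph_seq _ _ A0 B0 cF)/GE g /(mem_graph_seq _ _ A0 B0 cF)/GE g' /= e.
  by have [-> ->] := inj _ _ _ _ _ g g' e.
- move=> c; have [i [n [k [/GE/(mem_graph_seq _ _ A0 B0 cF) g e]]]] := sur c.
  by exists (i, n), k.
Qed.

Section Classify2.
Variables r b : int.
Hypothesis r2 : 1 < r.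
Hypothesis binv : exists b' k, b * b' = 1 + k * r.

Lemma solve_row c lo : exists n k, b * n = c + k * r /\ lo <= n /\ n < lo + r.
Proof.
have [b' [k e]] := binv.
pose x := b' * c - lo.
exists (lo + (x %% r)%Z), (k * c - b * (x %/ r)%Z).
have h1 := divz_eq x r.
have r0 : r != 0 by lia.
have h3 := modz_ge0 x r0.
have h4 : (x %% r)%Z < r by apply: ltz_pmod; lia.
split; last by lia.
have -> : (x %% r)%Z = x - (x %/ r)%Z * r by lia.
have -> : b * (lo + (x - (x %/ r)%Z * r)) = (b * b') * c - b * (x %/ r)%Z * r.
  rewrite /x; ring.
rewrite e; ring.
Qed.

(** The partner of [y^J] has [n <= 0]: otherwise its quotient by [y] would have
    the weight of [y^(J - 1)]. *)
Lemma partner_y G J K : is_graph r b G -> ends G J K -> G 1 0 ->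
  exists A p k, [/\ 0 < A, 0 <= p, G A (- p) & A + b * - p = b * J + k * r].
Proof.
move=> gG [J0 K0 HJ] g10.
have [[h1 h2 h3 h4] [h5 h6]] := gG.
have [A [n1 [k [g e]]]] := h6 (b * J).
have A0 := h1 _ _ g.
have gn : G 0 n1 by apply: (h2 _ _ _ g).
have gn' := gn; move/HJ: gn => [nK nJ].
have An0 : A != 0.
  (* Otherwise the first column has at least [r] elements, so that one of them
     has the weight of [x]. *)
  apply/eqP => A00; subst A.
  have e1 : b * (J - n1) = (- k) * r by lia.
  have [k' e2] := dvd_unit binv e1.
  have rJ : r <= J - n1 by apply: (multiple_ge r2 e2); lia.
  have [n [l [en [nl nh]]]] := solve_row 1 (J - r).
  have gx : G 0 n by apply/HJ; lia.
  by have [] := h5 _ _ _ _ (- l) g10 gx; lia.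
have n10 : n1 <= 0.
  rewrite leNgt; apply/negP => n1p.
  have ga : G A (n1 - 1) by apply: (h3 _ _ _ g); lia.
  have gb : G 0 (J - 1) by apply/HJ; lia.
  by have [] := h5 _ _ _ _ k ga gb; lia.
by exists A, (- n1), k; rewrite opprK; split=> //; lia.
Qed.

End Classify2.

Definition classified (r b : int) (G : int -> int -> Prop) :=
  exists F p q, [/\ is_frame r b F, is_cell F p q & forall i n, G i n <-> in_graph F p q i n].

Lemma is_cell_weak F p q : is_cell F p q -> weak_cell F p q.
Proof. by case. Qed.

(** If [x] is not in the graph, then the graph is a column of [r] powers of [y]
    and [z].  One relation of the frame is [y^r] or [z^r], the other expresses
    [x] as a power of [y] or [z]. *)
Lemma classify_deg r b G J K : 1 < r -> (exists b' k, b * b' = 1 + k * r) ->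
  is_graph r b G -> ends G J K -> ~ G 1 0 -> classified r b G.
Proof.
move=> r2 binv gG [J0 K0 HJ] g10.
have [[h1 h2 h3 h4] [h5 h6]] := gG.
have GE i n : G i n <-> [/\ i = 0, - K < n & n < J].
  split=> [g|[-> ? ?]]; last exact/HJ.
  have i0 := h1 _ _ g.
  have gn : G 0 n by apply: (h2 _ _ _ g).
  have /HJ [? ?] := gn; split=> //.
  apply/eqP; rewrite eq_le i0 andbT leNgt; apply/negP => ip.
  have g1 : G 1 n by apply: (h2 _ _ _ g); lia.
  by apply: g10; case: (leP 0 n) => n0; [apply: (h3 _ _ _ g1)|apply: (h4 _ _ _ g1)]; lia.
have JK : J + K - 1 = r.
  apply/eqP; rewrite eq_le; apply/andP; split; rewrite leNgt; apply/negP => h.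
    have ga : G 0 (1 - K) by apply/HJ; lia.
    have gb : G 0 (1 - K + r) by apply/HJ; lia.
    by have [] := h5 _ _ _ _ (- b) ga gb; lia.
  have [i [n [k [g e]]]] := h6 (b * J).
  have /GE [i0 n1 n2] := g.
  have e1 : b * (J - n) = (- k) * r by lia.
  have [k' e2] := dvd_unit binv e1.
  have rJ : r <= J - n by apply: (multiple_ge r2 e2); lia.
  lia.
(* [(1, b0)] is a relation; it is replaced by [(1, b0 - r)] if the graph
   contains [z^b0]. *)
have [b0 [k [eb [bl bh]]]] := solve_row r2 binv (-1) 0.
have b00 : b0 != 0.
  apply/eqP => e; subst b0; have e1 : 1 = k * r by lia.
  by have := multiple_ge r2 e1; lia.
have [Kb|Kb] := ltP (K - 1) b0.
  exists (Frame r b0 0 1), (K - 1), (b0 - K); split.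
  - split; split=> /=; try lia; first by exists b; lia.
    by exists k; lia.
  - by split; [split|split] => /=; lia.
  - move=> i n; rewrite GE; split=> [[? ? ?]|[/= ? ? ? [? ? ?]]]; last by split; lia.
    by split=> /=; [lia..|split; lia].
exists (Frame (r - b0) r 1 0), (r - b0 - J), (J - 1); split.
- split; split=> /=; try lia; first by exists (b - k); lia.
  by exists b; lia.
- by split; [split|split] => /=; lia.
- move=> i n; rewrite GE; split=> [[? ? ?]|[/= ? ? ? [? ? ?]]]; last by split; lia.
  by split=> /=; [lia..|split; lia].
Qed.

(** The three-gap phenomenon: the partners of the ends of the first column give
    the widths, and the rows where they lie give the heights. *)
Lemma classify r b G : 1 < r -> (exists b' k, b * b' = 1 + k * r) ->
  is_graph r b G -> classified r b G.
Proof.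
move=> r2 binv gG.
have [J [K eJK]] := graph_ends r2 gG.
have [g10|ng] := pselect (G 1 0); last exact: (classify_deg r2 binv gG eJK).
have [A [p [kA [A0 p0 gA eA]]]] := partner_y r2 binv gG eJK g10.
have binv' : exists b' k, - b * b' = 1 + k * r.
  by have [b' [k e]] := binv; exists (- b'), k; lia.
have eKJ : ends (fun i n => G i (- n)) K J.
  by case: eJK => [? ? h]; split=> // n; rewrite h; split; lia.
have [|B [q [kB [B0 q0 gB eB]]]] := partner_y r2 binv' (is_graph_swap gG) eKJ.
  by rewrite oppr0.
rewrite opprK in gB.
have D : partners r b G J K A p B q.
  by split=> //; split=> //; [exists kA|exists kB; lia].
have [J0 K0 HJ] := eJK.
have [[h1 h2 h3 h4] [h5 h6]] := gG.
have pK : - K < - p by have /HJ : G 0 (- p) by [apply: (h2 _ _ _ gA); lia]; lia.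
have qJ : q < J by have /HJ : G 0 q by [apply: (h2 _ _ _ gB); lia]; lia.
pose F := Frame (J + p) (K + q) A B.
have cF : is_cell F p q by split; [split|split] => /=; lia.
have GE i n : G i n <-> in_graph F p q i n.
  split=> [g|[/= i0 n1 n2 [g1 g2 g3]]].
    have i0 := h1 _ _ g.
    have /HJ [? ?] : G 0 n by apply: (h2 _ _ _ g).
    split=> /=; try lia; split=> [hn|hn1 hn2|hn].
    - by apply/(row_left r2 D (n := n)) => //; lia.
    - by apply/(row_mid r2 D (n := n)) => //; lia.
    - by apply/(row_right r2 D (n := n)) => //; lia.
  have [n3|n3] := ltP n (- p); first by apply/(row_left r2 D) => //; [lia|exact: g1].
  have [n4|n4] := leP n q; first by apply/(row_mid r2 D) => //; exact: g2.
  by apply/(row_right r2 D) => //; [lia|exact: g3].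
have r0 : 0 < r by lia.
exists F, p, q; split=> //.
have hr := graph_count r0 gG (ltW A0 : 0 <= fA F) (ltW B0 : 0 <= fB F) (is_cell_weak cF) GE.
split; split=> //=; try lia.
- by exists (- kA); lia.
- by exists kB; lia.
Qed.

(** * Cells lie in the positive octant *)

Section IncellGe0.
Variable R : realFieldType.
Implicit Types x y z : R.

Lemma in_cell_S0 b r F p q x y z : 0 < r -> is_frame r b F -> in_cell F p q x y z -> 0 <= fS y z.
Proof.
move=> r0 [[a0 b0 A0 B0] [hr _ _ _ _]] [cU cV _ _].
have [B00|Bn] := eqVneq (fB F) 0.
  have An : fA F != 0 by apply/eqP => A00; move: hr; rewrite A00 B00 !mulr0; ilia R.
  by have /andP[h1 h2] := cV An; lra.
by have /andP[h1 h2] := cU Bn; lra.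
Qed.

(** The three forms determine the point, since they have determinant [r] up to
    sign. *)
Lemma frame_x r b F x y z : is_frame r b F ->
  r%:~R * x = (al F)%:~R * (be F)%:~R * fS y z - (be F)%:~R * fU F x y
     - (al F)%:~R * fV F x z.
Proof. by move=> [_ [<- _ _ _ _]]; rewrite /fS /fU /fV; ring. Qed.

Lemma frame_y r b F x y z : is_frame r b F ->
  r%:~R * y = (fA F)%:~R * (be F)%:~R * fS y z + (fB F)%:~R * fU F x y
     - (fA F)%:~R * fV F x z.
Proof. by move=> [_ [<- _ _ _ _]]; rewrite /fS /fU /fV; ring. Qed.

Lemma frame_z r b F x y z : is_frame r b F ->
  r%:~R * z = (fB F)%:~R * (al F)%:~R * fS y z + (fA F)%:~R * fV F x z
     - (fB F)%:~R * fU F x y.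
Proof. by move=> [_ [<- _ _ _ _]]; rewrite /fS /fU /fV; ring. Qed.

Lemma in_cell_x0 r b F p q x y z : 0 < r -> is_frame r b F -> is_cell F p q ->
  in_cell F p q x y z -> 0 <= x.
Proof.
move=> r0 fF [[p0 q0 _ _] _] iF; have S0 := in_cell_S0 r0 fF iF.
move: iF => [cU cV cm1 cm2]; have ex := frame_x x y z fF.
have [[a0 b0 A0 B0] [hr _ _ dA dB]] := fF.
have zi (k : int) : 0 <= k -> 0 <= k%:~R :> R by move=> ?; rewrite ler0z.
have rR : 0 < r%:~R :> R by rewrite ltr0z.
rewrite -(pmulr_rge0 _ rR) ex.
have [ab|ab] := ltP (al F) (be F).
  have An : fA F != 0 by apply/eqP => /dA; ilia R.
  have /andP[h1 h2] := cV An.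
  have V0 : 0 <= fV F x z by apply: le_trans h1; rewrite mulr_ge0 // zi.
  have -> : (al F)%:~R * (be F)%:~R * fS y z - (be F)%:~R * fU F x y - (al F)%:~R * fV F x z
    = (be F)%:~R * ((al F)%:~R * fS y z - (fU F x y + fV F x z)) + (be F - al F)%:~R * fV F x z.
    by ring.
  by apply: addr_ge0;
    [apply: mulr_ge0; [apply: zi|by rewrite subr_ge0]
    |apply: mulr_ge0 => //; apply: zi]; ilia R.
have Bn : fB F != 0 by apply/eqP => /dB; ilia R.
have /andP[h1 h2] := cU Bn.
have U0 : 0 <= fU F x y by apply: le_trans h1; rewrite mulr_ge0 // zi.
have -> : (al F)%:~R * (be F)%:~R * fS y z - (be F)%:~R * fU F x y - (al F)%:~R * fV F x z
  = (al F)%:~R * ((be F)%:~R * fS y z - (fU F x y + fV F x z)) + (al F - be F)%:~R * fU F x y.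
  by ring.
by apply: addr_ge0;
    [apply: mulr_ge0; [apply: zi|by rewrite subr_ge0]
    |apply: mulr_ge0 => //; apply: zi]; ilia R.
Qed.

Lemma in_cell_y0 r b F p q x y z : 0 < r -> is_frame r b F -> is_cell F p q ->
  in_cell F p q x y z -> 0 <= y.
Proof.
move=> r0 fF cF iF; have S0 := in_cell_S0 r0 fF iF; have x0 := in_cell_x0 r0 fF cF iF.
move: iF => [cU cV cm1 cm2].
move: cF => [[p0 q0 pa pb] _].
have [[a0 b0 A0 B0] [hr _ _ dA dB]] := fF.
have zi (k : int) : 0 <= k -> 0 <= k%:~R :> R by move=> ?; rewrite ler0z.
have [B00|Bn] := eqVneq (fB F) 0.
  have An : fA F != 0 by apply/eqP => A00; move: hr; rewrite A00 B00 !mulr0; ilia R.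
  have /andP[h1 h2] := cV An.
  have bR : 0 < (be F)%:~R :> R by rewrite ltr0z.
  have h3 : (q + 1)%:~R * fS y z <= (be F)%:~R * fS y z.
    by rewrite ler_wpM2r // ler_int; ilia R.
  have h4 : (be F)%:~R * z <= (be F)%:~R * fS y z.
    by move: (le_trans h2 h3); rewrite /fV B00 mul0r subr0.
  by move: h4; rewrite ler_pM2l // /fS; lra.
have /andP[h1 h2] := cU Bn.
have aR : 0 < (al F)%:~R :> R by rewrite ltr0z.
rewrite -(pmulr_rge0 _ aR).
have -> : (al F)%:~R * y = fU F x y + (fA F)%:~R * x by rewrite /fU; ring.
apply: addr_ge0; last by rewrite mulr_ge0 // zi.
by apply: le_trans h1; rewrite mulr_ge0 // zi.
Qed.

Lemma in_cell_z0 r b F p q x y z : 0 < r -> is_frame r b F -> is_cell F p q ->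
  in_cell F p q x y z -> 0 <= z.
Proof.
move=> r0 fF cF iF.
exact: (in_cell_y0 r0 (is_frame_swap fF) (is_cell_swap cF) (in_cell_swap iF)).
Qed.

End IncellGe0.

(** * Monomials and weights *)

Definition o0 : 'I_3 := @Ordinal 3 0 isT.
Definition o1 : 'I_3 := @Ordinal 3 1 isT.
Definition o2 : 'I_3 := @Ordinal 3 2 isT.

Lemma sum3 (V : nmodType) (f : 'I_3 -> V) : \sum_(i < 3) f i = f o0 + f o1 + f o2.
Proof.
rewrite !big_ord_recr big_ord0 /= add0r.
by congr (_ + _ + _); congr f; apply: val_inj.
Qed.

Lemma forall3 (P : 'I_3 -> Prop) : (forall i, P i) <-> [/\ P o0, P o1 & P o2].
Proof.
split=> [h|[h0 h1 h2] [[|[|[|//]]] hi]]; first by split.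
- by rewrite (_ : Ordinal hi = o0) //; apply: val_inj.
- by rewrite (_ : Ordinal hi = o1) //; apply: val_inj.
- by rewrite (_ : Ordinal hi = o2) //; apply: val_inj.
Qed.

Definition vec (T : Type) (x y z : T) : 'rV[T]_3 := \row_(l < 3) nth x [:: x; y; z] l.

Lemma vecE (T : Type) (x y z : T) :
  ((vec x y z 0 o0 = x) * (vec x y z 0 o1 = y) * (vec x y z 0 o2 = z))%type.
Proof. by rewrite !mxE. Qed.

Lemma rv3P (T : Type) (u v : 'rV[T]_3) :
  u 0 o0 = v 0 o0 -> u 0 o1 = v 0 o1 -> u 0 o2 = v 0 o2 -> u = v.
Proof. by move=> h0 h1 h2; apply/rowP/forall3. Qed.

Lemma monE (i j k : nat) :
  ((mon i j k 0 o0 = i%:Z) * (mon i j k 0 o1 = j%:Z) * (mon i j k 0 o2 = k%:Z))%type.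
Proof. by rewrite !mxE. Qed.

Lemma ismonE (u : 'rV[int]_3) : ismon u <-> [/\ 0 <= u 0 o0, 0 <= u 0 o1 & 0 <= u 0 o2].
Proof. exact: (forall3 (fun i => 0 <= u 0 i)). Qed.

Lemma dotE (R : realType) (w : 'rV[R]_3) u :
  dot w u = w 0 o0 * (u 0 o0)%:~R + w 0 o1 * (u 0 o1)%:~R + w 0 o2 * (u 0 o2)%:~R.
Proof. by rewrite /dot sum3. Qed.

(** The position of a Laurent monomial modulo powers of [yz]. *)
Definition px (u : 'rV[int]_3) : int := u 0 o0.
Definition pn (u : 'rV[int]_3) : int := u 0 o1 - u 0 o2.

(** The monomial of a point [(i, n)]. *)
Definition mono (i n : int) : 'rV[int]_3 := vec i (Num.max n 0) (Num.max (- n) 0).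

Lemma px_mono i n : px (mono i n) = i. Proof. by rewrite /px vecE. Qed.
Lemma pn_mono i n : pn (mono i n) = n. Proof. by rewrite /pn !vecE; lia. Qed.

Lemma ismon_mono i n : ismon (mono i n) <-> 0 <= i.
Proof. by rewrite ismonE !vecE; split=> [[]//|?]; split; lia. Qed.

Lemma monoK u : ismon u -> (u 0 o1 = 0 \/ u 0 o2 = 0) -> u = mono (px u) (pn u).
Proof. by move/ismonE => [? ? ?] ?; apply: rv3P; rewrite !vecE /px /pn; lia. Qed.

Lemma dot_mono (R : realType) (w : 'rV[R]_3) i n :
  dot w (mono i n) = cost (w 0 o0) (w 0 o1) (w 0 o2) i n.
Proof.
rewrite dotE !vecE /cost; case: ifP => n0.
  have -> : Num.max n 0 = n by lia.
  have -> : Num.max (- n) 0 = 0 by lia.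
  ring.
have -> : Num.max n 0 = 0 by lia.
have -> : Num.max (- n) 0 = - n by lia.
ring.
Qed.

Lemma dot_ismon (R : realType) (w : 'rV[R]_3) u :
  dot w u = dot w (mono (px u) (pn u)) +
     fS (w 0 o1) (w 0 o2) * (Num.min (u 0 o1) (u 0 o2))%:~R.
Proof.
rewrite !dotE !vecE /px /pn /fS.
have [h|h] := leP (u 0 o1) (u 0 o2).
  have -> : Num.max (u 0 o1 - u 0 o2) 0 = 0 by lia.
  have -> : Num.max (- (u 0 o1 - u 0 o2)) 0 = u 0 o2 - u 0 o1 by lia.
  ring.
have -> : Num.max (u 0 o1 - u 0 o2) 0 = u 0 o1 - u 0 o2 by lia.
have -> : Num.max (- (u 0 o1 - u 0 o2)) 0 = 0 by lia.
ring.
Qed.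

Section Weights.
Variables r a : nat.
Hypothesis r2 : (1 < r)%N.
Hypothesis ar : (a < r)%N.

Lemma Zr_int (x : int) : (x%:~R : 'Z_r) = 0 <-> exists k : int, x = k * r%:Z.
Proof.
clear a ar.
have rr : (r%:R : 'Z_r) = 0 by apply: val_inj; rewrite /= val_Zp_nat // modnn.
split=> [h|[k ->]]; last by rewrite intrM -pmulrn rr mulr0.
have h1 := divz_eq x r%:Z.
have r0 : r%:Z != 0 by lia.
have h3 := modz_ge0 x r0.
have h4 : (x %% r%:Z)%Z < r%:Z by apply: ltz_pmod; lia.
exists (x %/ r%:Z)%Z.
move: (x %/ r%:Z)%Z (x %% r%:Z)%Z h1 h3 h4 => q m e m0 mr; subst x.
have [n en] : exists n : nat, m = n by exists `|m|%N; lia.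
subst m; move: h; rewrite intrD intrM -[r%:Z%:~R]pmulrn rr mulr0 add0r -pmulrn => h.
have := congr1 val h; rewrite /= val_Zp_nat // modn_small => [|//] /= n0.
by rewrite n0 addr0.
Qed.

Lemma wtE u : wt r a u = (px u)%:~R + a%:R * (pn u)%:~R.
Proof.
rewrite /wt sum3 /= mul1r -addrA; congr (_ + _).
have rr : (r%:R : 'Z_r) = 0 by apply: val_inj; rewrite /= val_Zp_nat // modnn.
by rewrite natrB ?(ltnW ar) // rr sub0r rmorphB /=; ring.
Qed.

Lemma wtD u v : wt r a (u + v) = wt r a u + wt r a v.
Proof. by rewrite !wtE /px /pn !mxE !rmorphB !rmorphD /=; ring. Qed.

Lemma wtN u : wt r a (- u) = - wt r a u.
Proof. by rewrite !wtE /px /pn !mxE !rmorphB !rmorphN /=; ring. Qed.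

Lemma wt_eq u v : wt r a u = wt r a v <->
  exists k : int, (px u - px v) + a%:Z * (pn u - pn v) = k * r%:Z.
Proof.
rewrite !wtE; move: (px u) (pn u) (px v) (pn v) => x y x' y'.
rewrite -Zr_int rmorphD rmorphM !rmorphB /= -pmulrn; split=> h.
  by move/eqP: h; rewrite -subr_eq0 => /eqP <-; ring.
by apply/eqP; rewrite -subr_eq0; apply/eqP; rewrite -[RHS]h; ring.
Qed.

Lemma inv_eq u : invariant r a u <-> exists k : int, px u + a%:Z * pn u = k * r%:Z.
Proof.
rewrite /invariant; have -> : 0 = wt r a 0 by rewrite wtE /px /pn !mxE; ring.
by rewrite wt_eq /px /pn !mxE; split=> [[k e]|[k e]]; exists k; lia.
Qed.

End Weights.

(** * The inequalities of a cone *)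

(** The minimal generators, other than [yz], of the monomials outside the
    graph; the generator [yz] only contributes [0 <= fS], which follows from
    the other inequalities. *)
Definition min_out (G : int -> int -> Prop) (i n : int) : Prop :=
  [/\ 0 <= i, ~ G i n & forall i' n', 0 <= i' -> i' <= i ->
    (0 <= n' /\ n' <= n) \/ (n <= n' /\ n' <= 0) -> ~ G i' n' -> i' = i /\ n' = n].

Section AbsSig.
Variable R : realFieldType.
Implicit Types x y z : R.

Definition sig_cone (r b : int) (G : int -> int -> Prop) x y z : Prop :=
  forall i n i' n' k, min_out G i n -> G i' n' -> (i' - i) + b * (n' - n) = k * r ->
    cost x y z i' n' <= cost x y z i n.

Lemma sig_cone_swap r b G x y z : sig_cone r b G x y z ->
  sig_cone r (- b) (fun i n => G i (- n)) x z y.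
Proof.
move=> h i n i' n' k [i0 ng mn] g e.
rewrite -(cost_swap x z y i) -(cost_swap x z y i').
apply: (h _ _ _ _ k) => //; last by ilia R.
split=> // j m j0 ji hm ngm.
have [-> nm] : j = i /\ - m = n by apply: mn => //; rewrite ?opprK //; ilia R.
by split=> //; ilia R.
Qed.

Lemma sig_cone_ext r b G G' x y z : (forall i n, G i n <-> G' i n) ->
  sig_cone r b G x y z -> sig_cone r b G' x y z.
Proof.
move=> e h i n i' n' k [i0 ng mn] g; apply: h; last exact/e.
split=> //; first by move/e.
by move=> j m j0 ji hm ngm; apply: mn => // /e.
Qed.

Lemma sig_cone_in_graph_swap r b F p q x y z : sig_cone r b (in_graph F p q) x y z ->
  sig_cone r (- b) (in_graph (fswap F) q p) x z y.
Proof.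
move=> /sig_cone_swap; apply: sig_cone_ext => i n; split=> /in_graph_swap; rewrite ?opprK.
  by case: F.
by [].
Qed.

Lemma costp x y z i n : 0 <= n -> cost x y z i n = x * i%:~R + y * n%:~R.
Proof. by rewrite /cost => ->. Qed.

Lemma costn x y z i n : n <= 0 -> cost x y z i n = x * i%:~R - z * n%:~R.
Proof.
by move=> n0; rewrite -cost_swap costp ?rmorphN ?mulrN //; ilia R.
Qed.

Section Half.
Variables (r b : int) (F : frame) (p q : int).
Hypothesis r0 : 0 < r.
Hypothesis fF : is_frame r b F.
Hypothesis cF : is_cell F p q.

Let AB : 0 < fA F + fB F.
Proof. by case: fF => [[? ? ? ?] [? _ _ _ _]]; nia. Qed.

(** The generator [x^(fA + fB)] has the weight of [y^(al - be)]. *)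
Lemma sig_cone_diag x y z : sig_cone r b (in_graph F p q) x y z -> be F <= al F ->
  fU F x y + fV F x z <= (be F)%:~R * fS y z.
Proof.
move=> h ab.
have [[a0 b0 A0 B0] [hr [k1 e1] [k2 e2] dA dB]] := fF.
have [[p0 q0 pa pb] [cA cB]] := cF.
have g : in_graph F p q 0 (al F - be F) by split; [ilia R..|split; ilia R].
have mn : min_out (in_graph F p q) (fA F + fB F) 0.
  split; first by ilia R.
    by move=> [? ? ? [_ h2 _]]; ilia R.
  move=> i n i0 iAB n0; have -> : n = 0 by ilia R.
  move=> ng; split=> //; apply/eqP; rewrite eq_le iAB leNgt; apply/negP => ?.
  by apply: ng; split; [ilia R..|split; ilia R].
have e : 0 - (fA F + fB F) + b * (al F - be F - 0) = (k1 - k2) * r by ilia R.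
have := h _ _ _ _ _ mn g e; rewrite !costp; [|ilia R..].
by rewrite /fU /fV /fS rmorphB rmorphD /=; lra.
Qed.

(** The generator [y^(al - p)] has the weight of [x^fA z^p]. *)
Lemma sig_cone_Ul x y z : sig_cone r b (in_graph F p q) x y z -> fB F != 0 ->
  p%:~R * fS y z <= fU F x y.
Proof.
move=> h Bn.
have [[a0 b0 A0 B0] [hr [k1 e1] [k2 e2] dA dB]] := fF.
have [[p0 q0 pa pb] [cA cB]] := cF.
have g : in_graph F p q (fA F) (- p) by split; [ilia R..|split; ilia R].
have mn : min_out (in_graph F p q) 0 (al F - p).
  split; first by ilia R.
    by move=> [? ? ? [_ h2 _]]; ilia R.
  move=> i n i0 i00 n0; have -> : i = 0 by ilia R.
  move=> ng; split=> //; apply/eqP; rewrite eq_le; apply/andP; split; first by ilia R.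
  rewrite leNgt; apply/negP => ?.
  by apply: ng; split; [ilia R..|split; ilia R].
have e : fA F - 0 + b * (- p - (al F - p)) = - k1 * r by ilia R.
have := h _ _ _ _ _ mn g e; rewrite (costp _ _ _ 0) ?costn; [|ilia R..].
by rewrite /fU /fS rmorphB rmorphN /=; lra.
Qed.

(** The generator [x^fA z^(p + 1)] has the weight of [y^(al - 1 - p)]. *)
Lemma sig_cone_Ur1 x y z : sig_cone r b (in_graph F p q) x y z -> fB F != 0 ->
  p + 1 < be F - q \/ fA F = 0 ->
  fU F x y <= (p + 1)%:~R * fS y z.
Proof.
move=> h Bn hp.
have [[a0 b0 A0 B0] [hr [k1 e1] [k2 e2] dA dB]] := fF.
have [[p0 q0 pa pb] [cA cB]] := cF.
have g : in_graph F p q 0 (al F - 1 - p) by split; [ilia R..|split; ilia R].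
have mn : min_out (in_graph F p q) (fA F) (- (p + 1)).
  split; first by ilia R.
    by move=> [? ? ? [h1 _ _]]; ilia R.
  move=> i n i0 iA n0.
  have [iA'|iA'] := ltP i (fA F).
    by case; split; [ilia R..|split; ilia R].
  have -> : i = fA F by ilia R.
  move=> ng; split=> //; apply/eqP; rewrite eq_le; apply/andP; split; last by ilia R.
  rewrite leNgt; apply/negP => ?.
  by apply: ng; split; [ilia R..|split; ilia R].
have e : 0 - fA F + b * (al F - 1 - p - (- (p + 1))) = k1 * r by ilia R.
have := h _ _ _ _ _ mn g e; rewrite (costp _ _ _ 0) ?costn; [|ilia R..].
by rewrite /fU /fS !rmorphB rmorphN rmorphD /=; lra.
Qed.

End Half.

Section Incell.
Variables (r b : int) (F : frame) (p q : int).
Hypothesis r0 : 0 < r.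
Hypothesis fF : is_frame r b F.
Hypothesis cF : is_cell F p q.

(** If there is no row of width [fA], then [x^fA z^(p + 1)] is not a minimal
    generator; in this case the bound follows from the lower bound on [fV] and
    the bound on [fU + fV]. *)
Lemma sig_cone_Ur x y z : sig_cone r b (in_graph F p q) x y z -> fB F != 0 ->
  fU F x y <= (p + 1)%:~R * fS y z.
Proof.
move=> h Bn.
have [hp|hp] := ltP (p + 1) (be F - q); first by apply: (sig_cone_Ur1 r0 fF cF h Bn); left.
have [A00|An] := eqVneq (fA F) 0; first by apply: (sig_cone_Ur1 r0 fF cF h Bn); right.
have h1 := sig_cone_Ul (r := r) (b := - b) r0 (is_frame_swap fF) (is_cell_swap cF)
  (sig_cone_in_graph_swap h) An.
have [[p0 q0 pa pb] [cA cB]] := cF.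
have ab : be F <= al F by ilia R.
have h2 := sig_cone_diag r0 fF cF h ab.
have eb : be F = p + 1 + q by ilia R.
move: h1; rewrite fU_swap fS_swap => h1.
by move: h2; rewrite eb; lra.
Qed.
End Incell.

Lemma sig_cone_in_cell r b F p q x y z : 0 < r -> is_frame r b F -> is_cell F p q ->
  sig_cone r b (in_graph F p q) x y z -> in_cell F p q x y z.
Proof.
move=> r0 fF cF h.
have h' := sig_cone_in_graph_swap h.
have fF' := is_frame_swap fF; have cF' := is_cell_swap cF.
have UB : fB F != 0 -> p%:~R * fS y z <= fU F x y <= (p + 1)%:~R * fS y z.
  by move=> Bn; rewrite (sig_cone_Ul r0 fF cF h Bn) (sig_cone_Ur r0 fF cF h Bn).
have VA : fA F != 0 -> q%:~R * fS y z <= fV F x z <= (q + 1)%:~R * fS y z.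
  move=> An; rewrite -fU_swap -(fS_swap y).
  by rewrite (sig_cone_Ul r0 fF' cF' h' An) (sig_cone_Ur r0 fF' cF' h' An).
have [[a0 b0 A0 B0] [hr [k1 e1] [k2 e2] dA dB]] := fF.
have S0 : 0 <= fS y z.
  have [B00|Bn] := eqVneq (fB F) 0.
    have An : fA F != 0 by apply/eqP => A00; move: hr; rewrite A00 B00 !mulr0; ilia R.
    by have /andP[? ?] := VA An; lra.
  by have /andP[? ?] := UB Bn; lra.
split=> //.
- have [ab|ab] := leP (al F) (be F).
    have := sig_cone_diag r0 fF' cF' h' ab.
    by rewrite fU_swap fV_swap fS_swap addrC.
  apply: (le_trans (sig_cone_diag r0 fF cF h (ltW ab))).
  by rewrite ler_wpM2r // ler_int ltW.
- have [ab|ab] := leP (be F) (al F); first exact: (sig_cone_diag r0 fF cF h ab).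
  have := sig_cone_diag r0 fF' cF' h' (ltW ab).
  rewrite fU_swap fV_swap fS_swap addrC => h1; apply: (le_trans h1).
  by rewrite ler_wpM2r // ler_int ltW.
Qed.
End AbsSig.

(** * G-graphs and their cones *)

Lemma rvD (u v : 'rV[int]_3) i : (u + v) 0 i = (u 0 i : int) + v 0 i.
Proof. by rewrite mxE. Qed.

Lemma rvB (u v : 'rV[int]_3) i : (u - v) 0 i = (u 0 i : int) - v 0 i.
Proof. by rewrite !mxE. Qed.

Definition graph_of (F : frame) (p q : int) : set 'rV[int]_3 :=
  [set m | [/\ ismon m, m 0 o1 = 0 \/ m 0 o2 = 0 & in_graph F p q (px m) (pn m)]]%classic.

Lemma graph_of_mono F p q i n : graph_of F p q (mono i n) <-> in_graph F p q i n.
Proof.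
rewrite /graph_of /= px_mono pn_mono; split=> [[]//|g]; split=> //.
  by apply/ismon_mono; case: g.
by rewrite !vecE; lia.
Qed.

Section Graphs.
Variables r a : nat.
Hypothesis r2 : (1 < r)%N.
Hypothesis ar : (a < r)%N.

Lemma Ggraph_down Gam u v : Ggraph r a Gam -> Gam u -> ismon v -> mdvd v u -> Gam v.
Proof.
move=> [[I [I1 I2] ->] _] [mu nu] mv d; split=> // iv; apply: nu.
by have -> : u = v + (u - v) by [rewrite addrC subrK]; apply: I2.
Qed.

Lemma Ggraph_ismon Gam u : Ggraph r a Gam -> Gam u -> ismon u.
Proof. by move=> [[I _ ->] _] []. Qed.

Lemma Ggraph_inj Gam u v : Ggraph r a Gam -> Gam u -> Gam v ->
  wt r a u = wt r a v -> u = v.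
Proof. by move=> [_ [_ h _]] gu gv; apply: h; rewrite inE. Qed.

Lemma Ggraph_sur Gam chi : Ggraph r a Gam -> exists2 u, Gam u & wt r a u = chi.
Proof. by move=> [_ [_ _ h]]; have [u] := h chi I; exists u. Qed.

Lemma mdvdE u v : mdvd u v <->
  [/\ u 0 o0 <= v 0 o0, u 0 o1 <= v 0 o1 & u 0 o2 <= v 0 o2].
Proof. by rewrite /mdvd ismonE !mxE !subr_ge0. Qed.

(** The monomial [yz] has the weight of 1. *)
Lemma Ggraph_noyz Gam u : Ggraph r a Gam -> Gam u -> u 0 o1 = 0 \/ u 0 o2 = 0.
Proof.
move=> gG gu; have /ismonE [u0 u1 u2] := Ggraph_ismon gG gu.
have [->|n1] := eqVneq (u 0 o1) 0; first by left.
have [->|n2] := eqVneq (u 0 o2) 0; first by right.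
have gyz : Gam (vec 0 1 1).
  by apply: (Ggraph_down gG gu); [apply/ismonE|apply/mdvdE]; rewrite !vecE; split; lia.
have g1 : Gam 0.
  by apply: (Ggraph_down gG gu); [apply/ismonE|apply/mdvdE]; rewrite !mxE; split; lia.
have e : vec 0 1 1 = 0 :> 'rV[int]_3.
  by apply: (Ggraph_inj gG gyz g1); apply/(wt_eq r2 ar); exists 0; rewrite /px /pn !vecE !mxE; lia.
by have := congr1 (fun m : 'rV[int]_3 => m 0 o1) e; rewrite /= vecE mxE.
Qed.

Lemma Ggraph_is_graph Gam : Ggraph r a Gam ->
  is_graph r a (fun i n => 0 <= i /\ Gam (mono i n)).
Proof.
move=> gG.
have dn i n i' n' : 0 <= i /\ Gam (mono i n) -> 0 <= i' -> i' <= i ->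
   (0 <= n' /\ n' <= n) \/ (n <= n' /\ n' <= 0) -> 0 <= i' /\ Gam (mono i' n').
  move=> [i0 g] i'0 i'i h; split=> //; apply: (Ggraph_down gG g).
    exact/ismon_mono.
  by apply/mdvdE; rewrite !vecE; split; lia.
split; split.
- by move=> i n [].
- move=> i i' n g *; apply: (dn _ _ _ _ g) => //.
  by have [?|?] := leP 0 n; [left|right]; split=> //; lia.
- by move=> i n n' g *; apply: (dn _ _ _ _ g) => //; [case: g|left].
- by move=> i n n' g *; apply: (dn _ _ _ _ g) => //; [case: g|right].
- move=> i n i' n' k [_ g] [_ g'] e.
  have h : mono i n = mono i' n'.
    by apply: (Ggraph_inj gG g g'); apply/(wt_eq r2 ar); exists k; rewrite !px_mono !pn_mono.
  by split; [rewrite -(px_mono i n) h px_mono|rewrite -(pn_mono i n) h pn_mono].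
- move=> c; have [u gu] := Ggraph_sur (wt r a (mono c 0)) gG.
  move/(wt_eq r2 ar) => [k]; rewrite px_mono pn_mono => e.
  have eu := monoK (Ggraph_ismon gG gu) (Ggraph_noyz gG gu).
  exists (px u), (pn u), k; rewrite -eu; split; last by lia.
  by split=> //; have /ismonE [] := Ggraph_ismon gG gu.
Qed.

Lemma graph_of_Ggraph F p q : is_frame r a F -> is_cell F p q -> Ggraph r a (graph_of F p q).
Proof.
move=> fF cF; have r0 : 0 < r%:Z by clear -r2; lia.
have [[h1 h2 h3 h4] [h5 h6]] := in_graph_is_graph r0 fF (is_cell_weak cF).
split.
  exists (ismon `\` graph_of F p q)%classic.
    split=> [u []//|u v [mu nu] mv]; split.
      by move/ismonE: mu mv => [? ? ?] /ismonE[? ? ?]; apply/ismonE; rewrite !rvD; split; lia.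
    move=> [muv yz g]; apply: nu; split=> //.
      by move/ismonE: mu mv yz => [? ? ?] /ismonE[? ? ?]; rewrite !rvD; lia.
    move/ismonE: mu mv g => [u0 u1 u2] /ismonE[v0 v1 v2].
    move: yz; rewrite /px /pn !rvD => yz g.
    have g1 : in_graph F p q (u 0 o0) (u 0 o1 + v 0 o1 - (u 0 o2 + v 0 o2)).
      by apply: (h2 _ _ _ g) => //; lia.
    have [n0|n0] := leP 0 (u 0 o1 + v 0 o1 - (u 0 o2 + v 0 o2)).
      by apply: (h3 _ _ _ g1); lia.
    by apply: (h4 _ _ _ g1); lia.
  apply/seteqP; split=> [u g|u [mu nn]].
    by split; [case: g|move=> [_]].
  by apply: contrapT => ng; apply: nn.
split=> //.
- move=> u v; rewrite !inE => [[mu yu gu] [mv yv gv]] /(wt_eq r2 ar)[k e].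
  have [e1 e2] := h5 _ _ _ _ k gu gv e.
  by rewrite (monoK mu yu) (monoK mv yv) e1 e2.
- move=> c _ /=; have [i [n [k [g e]]]] := h6 (val c)%:Z.
  exists (mono i n); first exact/graph_of_mono.
  rewrite (wtE r2 ar) px_mono pn_mono.
  have -> : a%:R * n%:~R = (a%:Z * n)%:~R :> 'Z_r by rewrite intrM -pmulrn.
  have z : (k * r%:Z)%:~R = 0 :> 'Z_r by apply/(Zr_int r2); exists k.
  rewrite -intrD e intrD z addr0.
  by rewrite -pmulrn natr_Zp.
Qed.

Section Sigma.
Variable R : realType.
Implicit Types w : 'rV[R]_3.

Definition in_cellv F p q w := in_cell F p q (w 0 o0) (w 0 o1) (w 0 o2).
Definition wS w := fS (w 0 o1) (w 0 o2).
Definition wU F w := fU F (w 0 o0) (w 0 o1).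
Definition wV F w := fV F (w 0 o0) (w 0 o2).

Lemma in_cellv_ge0 F p q w : is_frame r a F -> is_cell F p q -> in_cellv F p q w ->
  [/\ 0 <= w 0 o0, 0 <= w 0 o1 & 0 <= w 0 o2].
Proof.
move=> fF cF iC; have r0 : 0 < r%:Z by clear -r2; lia.
by split; [apply: (in_cell_x0 r0 fF cF iC)|apply: (in_cell_y0 r0 fF cF iC)
  |apply: (in_cell_z0 r0 fF cF iC)].
Qed.

Lemma dot_ge_mono w u : 0 <= wS w -> ismon u ->
  dot w (mono (px u) (pn u)) <= dot w u.
Proof.
move=> S0 /ismonE[_ u1 u2]; rewrite [leRHS]dot_ismon lerDl mulr_ge0 // ler0z; lia.
Qed.

Lemma in_cellv_min F p q w m m' : is_frame r a F -> is_cell F p q -> in_cellv F p q w ->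
  graph_of F p q m' -> ismon m -> wt r a m' = wt r a m -> dot w m' <= dot w m.
Proof.
move=> fF cF iC [mm' ym' gm'] mm /(wt_eq r2 ar)[k e]; have r0 : 0 < r%:Z by clear -r2; lia.
have [x0 y0 z0] := in_cellv_ge0 fF cF iC.
apply: le_trans (dot_ge_mono (addr_ge0 y0 z0) mm).
rewrite (monoK mm' ym') !dot_mono.
apply: (cost_min (k := - k) r0 fF cF iC x0 y0 z0 gm'); last by ilia R.
by case/ismonE: mm.
Qed.

(** The minimal generators of the staircase give the inequalities of the cell,
    and conversely these make the graph the set of cheapest monomials. *)
Lemma sigmaE F p q : is_frame r a F -> is_cell F p q ->
  sigma R r a (graph_of F p q) = [set w | in_cellv F p q w]%classic.
Proof.
move=> fF cF; have r0 : 0 < r%:Z by clear -r2; lia.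
apply/seteqP; split=> w /=; last first.
  move=> iC m m' [mm _ _] gm' e; exact: (in_cellv_min fF cF iC gm' mm e).
move=> h; apply: (sig_cone_in_cell r0 fF cF) => i n i' n' k [i0 ng mn] g e.
rewrite -!dot_mono; apply: h.
- split; [exact/ismon_mono|by move/graph_of_mono|].
  move=> m' mm' ngm' /mdvdE; rewrite !vecE => -[d0 d1 d2].
  have /ismonE [m0 m1 m2] := mm'.
  have ym' : m' 0 o1 = 0 \/ m' 0 o2 = 0 by ilia R.
  have em := monoK mm' ym'.
  have [e1 e2] : px m' = i /\ pn m' = n.
    apply: mn; rewrite /px /pn; [ilia R..|] => g'.
    by apply: ngm'; split.
  by rewrite em e1 e2.
- exact/graph_of_mono.
- by apply/(wt_eq r2 ar); exists k; rewrite !px_mono !pn_mono.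
Qed.

End Sigma.

Hypothesis cra : coprime r a.

Lemma inv_a : exists b' k : int, a%:Z * b' = 1 + k * r%:Z.
Proof.
have [|c _] := @Bezoutl r a; first by lia.
move: cra; rewrite /coprime => /eqP -> /dvdnP[k e].
by exists (- c%:Z), (- k%:Z); lia.
Qed.

Lemma Ggraph_classify Gam : Ggraph r a Gam ->
  exists F p q, [/\ is_frame r a F, is_cell F p q & Gam = graph_of F p q].
Proof.
move=> gG; have r2' : 1 < r%:Z by lia.
have [F [p [q [fF cF GE]]]] := classify r2' inv_a (Ggraph_is_graph gG).
exists F, p, q; split=> //; apply/seteqP; split=> u gu.
  split; [exact: Ggraph_ismon gG gu|exact: Ggraph_noyz gG gu|].
  apply/GE; rewrite -monoK //; [|exact: Ggraph_ismon gG gu|exact: Ggraph_noyz gG gu].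
  by split=> //; have /ismonE [] := Ggraph_ismon gG gu.
by case: gu => mu yu /GE [_]; rewrite -monoK.
Qed.

Section Sigma2.
Variable R : realType.
Implicit Types w : 'rV[R]_3.

(** The cone is defined by the minimal generators only, but at its points the
    elements of the graph are cheapest among all monomials of their weight. *)
Lemma sigma_min Gam w m m' : Ggraph r a Gam -> sigma R r a Gam w ->
  Gam m' -> ismon m -> wt r a m' = wt r a m -> dot w m' <= dot w m.
Proof.
move=> /Ggraph_classify[F [p [q [fF cF ->]]]]; rewrite sigmaE //= => iC.
exact: in_cellv_min.
Qed.

Lemma sigma_ge0 Gam w : Ggraph r a Gam -> sigma R r a Gam w ->
  [/\ 0 <= w 0 o0, 0 <= w 0 o1 & 0 <= w 0 o2].
Proof.
move=> /Ggraph_classify[F [p [q [fF cF ->]]]]; rewrite sigmaE //= => iC.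
exact: in_cellv_ge0 iC.
Qed.

End Sigma2.
End Graphs.

(** * Spans of Laurent monomials *)

Section LaurentSpans.
Variable R : realType.
Local Notation K := (ratfun R).
Local Notation cst c := (FracField.tofrac (c%:MP_[3] : {mpoly R[i][3]}) : K).
Local Notation lm := (lmon R).
Implicit Types S T : set 'rV[int]_3.

Lemma frX_neq0 i : (FracField.tofrac ('X_i : {mpoly R[i][3]}) : K) != 0.
Proof.
rewrite tofrac_eq0; apply/eqP => /(congr1 (mcoeff U_(i))).
by rewrite mcoeffX eqxx mcoeff0 => /eqP; rewrite oner_eq0.
Qed.

Lemma lmon_neq0 u : lm u != 0.
Proof. by apply/prodf_neq0 => i _; rewrite expfz_neq0 // frX_neq0. Qed.

Lemma lmonD u v : lm (u + v) = lm u * lm v.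
Proof.
rewrite /lmon -big_split /=; apply: eq_bigr => i _.
by rewrite mxE expfzDr // frX_neq0.
Qed.

Lemma lmon0 : lm 0 = 1.
Proof. by rewrite /lmon big1 // => i _; rewrite mxE expr0z. Qed.

Lemma lmonB u v : lm (u - v) = lm u / lm v.
Proof.
apply: (mulIf (lmon_neq0 v)).
by rewrite -lmonD subrK divfK // lmon_neq0.
Qed.

Lemma lspan0 S : lspan R S 0.
Proof. by exists [::]; rewrite ?big_nil. Qed.

Lemma lspan_cons S c u f : S u -> lspan R S f -> lspan R S (cst c * lm u + f).
Proof.
move=> Su [s hs ->]; exists ((cst c, lm u) :: s); last by rewrite big_cons.
move=> p; rewrite inE => /orP[/eqP ->|]; last exact: hs.
by split=> /=; [exists c|exists u].
Qed.

Lemma lspan_ind S (P : K -> Prop) : P 0 ->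
  (forall c u f, S u -> P f -> P (cst c * lm u + f)) -> forall f, lspan R S f -> P f.
Proof.
move=> P0 PS f [s hs ->]; elim: s hs => [|p s IH] hs; first by rewrite big_nil.
rewrite big_cons; have [] := hs p (mem_head _ _); case=> c _ <- [u Su <-].
by apply: PS => //; apply: IH => q qs; apply: hs; rewrite inE qs orbT.
Qed.

Lemma lspan_mon S u : S u -> lspan R S (lm u).
Proof.
move=> Su; have := lspan_cons 1 Su (lspan0 S).
by rewrite addr0 mpolyC1 tofrac1 mul1r.
Qed.

Lemma lspan_sub S T f : (forall u, S u -> T u) -> lspan R S f -> lspan R T f.
Proof.
move=> ST; move: f; apply: lspan_ind; first exact: lspan0.
by move=> c u f Su Tf; apply: lspan_cons => //; exact: ST.
Qed.

Lemma lspanD S f g : lspan R S f -> lspan R S g -> lspan R S (f + g).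
Proof.
move=> Sf Sg; move: f Sf; apply: lspan_ind; first by rewrite add0r.
by move=> c u f Su Sf; rewrite -addrA; apply: lspan_cons.
Qed.

Lemma lspan_sum S (I : eqType) (s : seq I) (F : I -> K) :
  (forall i, i \in s -> lspan R S (F i)) -> lspan R S (\sum_(i <- s) F i).
Proof.
elim: s => [|i s IH] h; first by rewrite big_nil; apply: lspan0.
rewrite big_cons; apply: lspanD; first exact: h (mem_head _ _).
by apply: IH => j js; apply: h; rewrite inE js orbT.
Qed.

Lemma lspanM S T W f g : (forall u v, S u -> T v -> W (u + v)) ->
  lspan R S f -> lspan R T g -> lspan R W (f * g).
Proof.
move=> STW Sf Tg; move: f Sf; apply: lspan_ind.
  by rewrite mul0r; apply: lspan0.
move=> c u f Su Wf; rewrite mulrDl; apply: lspanD => // {f Wf}.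
move: g Tg; apply: lspan_ind; first by rewrite mulr0; apply: lspan0.
move=> d v g Tv Wg; rewrite mulrDr; apply: lspanD => //.
have := lspan_cons (c * d) (STW _ _ Su Tv) (lspan0 W).
rewrite addr0 mpolyCM tofracM lmonD.
by have -> : forall x y z t : K, x * y * (z * t) = x * z * (y * t) by move=> *; ring.
Qed.

Lemma lspanN S f : lspan R S f -> lspan R S (- f).
Proof.
move: f; apply: lspan_ind; first by rewrite oppr0; apply: lspan0.
move=> c u f Su Sf; rewrite opprD -mulNr -tofracN -mpolyCN.
exact: lspan_cons.
Qed.

Lemma sumprod_lspan (A B : set K) W f :
  (forall g h, A g -> B h -> lspan R W (g * h)) -> sumprod A B f -> lspan R W f.
Proof.
move=> h [s hs ->]; apply: lspan_sum => p ps; have [] := hs p ps; exact: h.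
Qed.

(** Multiplication by [(xyz)^N] for large [N] turns a Laurent polynomial into a
    polynomial, whose support can be read off. *)
Definition shiftv (N : nat) : 'rV[int]_3 := \row_i N%:Z.
Definition mnmv (m : 'X_{1.. 3}) : 'rV[int]_3 := \row_i (m i)%:Z.

Lemma lmon_mnmv m : lm (mnmv m) = FracField.tofrac ('X_[m] : {mpoly R[i][3]}).
Proof.
rewrite mpolyXE_id rmorph_prod /=; apply: eq_bigr => i _.
by rewrite mxE tofracXn.
Qed.

Lemma lspan_poly S f : lspan R S f -> exists N0 : nat, forall N : nat, (N0 <= N)%N ->
  exists2 g : {mpoly R[i][3]}, f * lm (shiftv N) = FracField.tofrac g &
    forall m, m \in msupp g -> S (mnmv m - shiftv N).
Proof.
move: f; apply: lspan_ind.
  by exists 0%N => N _; exists 0; [rewrite mul0r tofrac0|move=> m; rewrite msupp0].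
move=> c u f Su [N1 h1].
exists (maxn N1 (\max_(i < 3) `|u 0%R i|)%N) => N; rewrite geq_max => /andP[N1N uN].
have [g eg hg] := h1 N N1N.
pose m0 : 'X_{1.. 3} := [multinom `|(u + shiftv N)%R 0%R i|%N | i < 3].
have em : mnmv m0 = u + shiftv N.
  apply/rowP => i; rewrite [LHS]mxE mnmE rvD [shiftv N 0 i]mxE.
  have : (`|u 0%R i| <= N)%N by apply: leq_trans uN; apply: (@leq_bigmax _ (fun i => `|u 0%R i|%N)).
  by lia.
exists (c%:MP * 'X_[m0] + g).
  by rewrite mulrDl eg tofracD tofracM -mulrA -lmonD -em lmon_mnmv.
move=> m; rewrite mcoeff_msupp mcoeffD mcoeffCM mcoeffX.
have [<- _|nm] := eqVneq m0 m; first by rewrite em addrK.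
by rewrite mulr0 add0r -mcoeff_msupp; apply: hg.
Qed.

(** The Laurent monomials are linearly independent. *)
Lemma lspanI S T f : lspan R S f -> lspan R T f -> lspan R (S `&` T)%classic f.
Proof.
move=> /lspan_poly[N1 h1] /lspan_poly[N2 h2].
have [g eg hg] := h1 (maxn N1 N2) (leq_maxl _ _).
have [g' eg' hg'] := h2 (maxn N1 N2) (leq_maxr _ _).
have gg : g = g' by apply/eqP; rewrite -tofrac_eq -eg -eg'.
subst g'; set N := maxn N1 N2 in eg hg hg'.
have -> : f = FracField.tofrac g * lm (- shiftv N).
  by rewrite -eg -mulrA -lmonD subrr lmon0 mulr1.
rewrite (mpolyE g) rmorph_sum /= mulr_suml; apply: lspan_sum => m mg.
rewrite -mul_mpolyC tofracM -lmon_mnmv -mulrA -lmonD -[X in lspan R _ X]addr0.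
apply: lspan_cons (lspan0 _); split; [exact: hg|exact: hg'].
Qed.

End LaurentSpans.

(** * The tautological sheaf *)

Lemma dotD (R : realType) (w : 'rV[R]_3) u v : dot w (u + v) = dot w u + dot w v.
Proof. by rewrite !dotE !rvD !intrD; ring. Qed.

Lemma dotB (R : realType) (w : 'rV[R]_3) u v : dot w (u - v) = dot w u - dot w v.
Proof. by have := dotD w (u - v) v; rewrite subrK => ->; rewrite addrK. Qed.

Section Sheaf.
Variables (R : realType) (r a : nat).
Hypothesis r2 : (1 < r)%N.
Hypothesis ar : (a < r)%N.
Hypothesis cra : coprime r a.
Variable chi : 'Z_r.
Local Notation K := (ratfun R).
Local Notation lm := (lmon R).
Implicit Types (tau sig v : set 'rV[R]_3) (f g h : K).

Lemma regularM tau f g : regular r a tau f -> regular r a tau g -> regular r a tau (f * g).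
Proof.
apply: lspanM => u w [iu du] [iw dw]; split.
  by rewrite /invariant (wtD r2 ar) iu iw addr0.
by move=> x tx; rewrite dotD addr_ge0 ?du ?dw.
Qed.

Lemma regular_sub tau sig f : (tau `<=` sig)%classic -> regular r a sig f -> regular r a tau f.
Proof.
by move=> ts; apply: lspan_sub => u [iu du]; split=> // w /ts; apply: du.
Qed.

Lemma ideal_vertexM v tau f g : ideal_vertex r a v tau f -> regular r a tau g ->
  ideal_vertex r a v tau (f * g).
Proof.
apply: lspanM => u w [[iu du] hu] [iw dw]; split.
  split; first by rewrite /invariant (wtD r2 ar) iu iw addr0.
  by move=> x tx; rewrite dotD addr_ge0 ?du ?dw.
move=> vt; have [x vx nx] := hu vt; exists x => //; rewrite dotD.
have x0 : 0 < dot x u by rewrite lt0r; apply/andP; split; [apply/eqP|apply: du; apply: vt].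
have xw : 0 <= dot x w by apply: dw; apply: vt.
by move=> e; lra.
Qed.

Lemma ideal_chiM tau f g : ideal_chi a chi tau f -> regular r a tau g ->
  ideal_chi a chi tau (f * g).
Proof.
move=> [rf hf] rg; split; first exact: regularM.
by move=> v vv sv; apply: ideal_vertexM => //; apply: hf.
Qed.

Lemma ideal_chi0 tau : ideal_chi a chi tau 0.
Proof. by split=> [|v _ _]; apply: lspan0. Qed.

Lemma ideal_chiD tau f g : ideal_chi a chi tau f -> ideal_chi a chi tau g ->
  ideal_chi a chi tau (f + g).
Proof.
move=> [rf hf] [rg hg]; split; first exact: lspanD.
by move=> v vv sv; apply: lspanD; [apply: hf|apply: hg].
Qed.

(** For an invariant [u] in the dual cone and a monomial [m] such that [u + m]
    has weight [chi], the element [u + m - m0] is in the dual cone again,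
    because [m0] is the cheapest monomial of weight [chi] on [tau]. *)
Lemma taut_eq Gam tau m0 f : Ggraph r a Gam -> (tau `<=` sigma R r a Gam)%classic ->
  Gam m0 -> wt r a m0 = chi ->
  taut a chi tau f <-> regular r a tau (f / lm m0).
Proof.
move=> gG tG gm0 wm0; split=> [[uf cf]|rf].
  have Pf : lspan R [set x | exists u m, [/\ dual r a tau u, ismon m & x = u + m]]%classic f.
    apply: sumprod_lspan uf => g _ rg [m mm <-].
    apply: lspanM rg (lspan_mon R (S := [set m]%classic) _) => // u _ du ->.
    by exists u, m.
  have e : f / lm m0 = f * lm (- m0).
    by rewrite -[- m0]add0r lmonB lmon0 mul1r.
  have := lspanI Pf cf; rewrite e.
  move=> h; apply: lspanM h (lspan_mon R (S := [set - m0]%classic) _) => //.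
  move=> _ _ [[u [m [[iu du] mm ->]]] /= wum] ->; split.
    by rewrite /invariant (wtD r2 ar) wum (wtN r2 ar) wm0 subrr.
  move=> w tw; rewrite -addrA dotD addr_ge0 ?du // dotB subr_ge0.
  apply: (sigma_min r2 ar cra gG (tG _ tw) gm0 mm).
  by rewrite wm0 -wum (wtD r2 ar) iu add0r.
have ef : f = f / lm m0 * lm m0 by rewrite divfK // lmon_neq0.
split.
  exists [:: (f / lm m0, lm m0)]; last by rewrite big_seq1.
  move=> p; rewrite inE => /eqP -> /=; split=> //.
  by exists m0 => //; apply: (Ggraph_ismon gG).
rewrite ef; apply: lspanM rf (lspan_mon R (S := [set m0]%classic) _) => //.
by move=> u _ [iu du] ->; rewrite /= (wtD r2 ar) iu add0r.
Qed.

Lemma taut_sub tau sig f : (tau `<=` sig)%classic -> taut a chi sig f -> taut a chi tau f.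
Proof.
move=> ts [[s hs ->] cf]; split=> //; exists s => // p ps.
by have [h1 h2] := hs p ps; split=> //; apply: regular_sub h1.
Qed.

(** A cone may be a face of the cones of several G-graphs; any of them provides
    a generator. *)
Definition chart_gen tau : 'rV[int]_3 :=
  xget 0 [set m | exists Gam, [/\ Ggraph r a Gam, face tau (sigma R r a Gam),
                                Gam m & wt r a m = chi]]%classic.

Lemma chart_genP tau : Fan R r a tau -> exists Gam, [/\ Ggraph r a Gam,
  (tau `<=` sigma R r a Gam)%classic, Gam (chart_gen tau) & wt r a (chart_gen tau) = chi].
Proof.
move=> [Gam gG ft]; have [m gm wm] := Ggraph_sur chi gG.
have : exists Gam, [/\ Ggraph r a Gam, face tau (sigma R r a Gam),
   Gam (chart_gen tau) & wt r a (chart_gen tau) = chi].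
  rewrite /chart_gen; case: xgetP => [x _ //|/(_ m) []].
  by exists Gam; split.
move=> [Gam' [gG' [c _ e] gm' wm']]; exists Gam'; split=> //.
by rewrite e => w [].
Qed.

Hypothesis Core : forall v, vertex r a v -> SC a v chi -> exists m0,
  forall Gam m, Ggraph r a Gam -> (v `<=` sigma R r a Gam)%classic -> Gam m ->
    wt r a m = chi -> m = m0.

(** The isomorphism divides by the generator.  Where [D_chi] meets the chart of
    [tau], the generators of [tau] and of a larger cone coincide; elsewhere the
    ideal of [D_chi] contains every regular function. *)
Lemma taut_iso : qsheaf_iso r a (taut_on_D R a chi) (O_D R a chi).
Proof.
exists (fun tau f => f / lm (chart_gen tau)); split=> /=.
  move=> tau Ft; have [Gam [gG tG gm wm]] := chart_genP Ft.
  have te f := taut_eq f gG tG gm wm.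
  split.
  - by move=> f /te.
  - move=> c f g _ _ _; rewrite mulrDl mulrA subrr; exact: ideal_chi0.
  - move=> f _; split=> [hf|[s hs ->]].
      exists [:: (f / lm (chart_gen tau), lm (chart_gen tau))].
        move=> p; rewrite inE => /eqP -> /=; split=> //.
        apply/te; rewrite divff ?lmon_neq0 // -(lmon0 R); apply: lspan_mon.
        split; first by rewrite /invariant -(subrr 0) (wtD r2 ar) (wtN r2 ar) subrr.
        by move=> w _; rewrite -(subrr (0 : 'rV[int]_3)) dotB subrr.
      by rewrite big_seq1 /= divfK // lmon_neq0.
    rewrite mulr_suml; elim: s hs => [|p s IH] hs.
      by rewrite big_nil; apply: ideal_chi0.
    rewrite big_cons; apply: ideal_chiD.
      have [h1 /te h2] := hs p (mem_head _ _).
      by rewrite -mulrA; apply: ideal_chiM.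
    by apply: IH => q qs; apply: hs; rewrite inE qs orbT.
  - move=> h rh; exists (h * lm (chart_gen tau)).
      by apply/te; rewrite mulfK // lmon_neq0.
    by rewrite mulfK ?lmon_neq0 // subrr; apply: ideal_chi0.
move=> sig tau Fs Ft ts f tf.
have [Gs [gGs sGs gms wms]] := chart_genP Fs.
have [Gt [gGt tGt gmt wmt]] := chart_genP Ft.
have [[v [vv sv vt]]|nv] := pselect (exists v, [/\ vertex r a v, SC a v chi & (v `<=` tau)%classic]).
  have [m0 hm0] := Core vv sv.
  have -> : chart_gen sig = m0.
    by apply: (hm0 _ _ gGs _ gms wms); apply: subset_trans vt (subset_trans ts sGs).
  have -> : chart_gen tau = m0.
    by apply: (hm0 _ _ gGt _ gmt wmt); apply: subset_trans vt tGt.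
  by rewrite subrr; apply: ideal_chi0.
have rg : regular r a tau (f / lm (chart_gen sig) - f / lm (chart_gen tau)).
  apply: lspanD; first by apply: regular_sub ts _; apply/(taut_eq f gGs sGs gms wms).
  apply: lspanN; apply/(taut_eq f gGt tGt gmt wmt); exact: taut_sub ts tf.
split=> // v vv sv; apply: lspan_sub rg => u du; split=> // vt.
by case: nv; exists v.
Qed.

End Sheaf.

(** * Grid points *)

(** The coordinates of the point with [fS = r], [fU = r p] and [fV = r q]. *)
Definition gx (F : frame) (p q : int) : int := al F * be F - be F * p - al F * q.
Definition gy (F : frame) (p q : int) : int := fA F * be F + fB F * p - fA F * q.
Definition gz (F : frame) (p q : int) : int := fB F * al F + fA F * q - fB F * p.

(** The corners of the cells. *)
Definition is_prevtx (F : frame) (p q : int) : Prop :=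
  [/\ 0 <= p, 0 <= q, p + q <= al F & p + q <= be F] /\
  (fA F = 0 -> p + q = be F) /\ (fB F = 0 -> p + q = al F).

(** The corners that can be vertices: a grid point off the lines [fU = 0] and
    [fV = 0], or the triple point. *)
Definition normal_pt (r b x y z : int) : Prop :=
  (exists F p q, [/\ is_frame r b F, is_vtx F p q & [/\ x = gx F p q, y = gy F p q & z = gz F p q]]) \/
  (exists F, [/\ is_frame r b F, fA F = 1, fB F = 1 & [/\ x = al F * be F, y = be F & z = al F]]).

Lemma normal_pt_swap r b x y z : normal_pt r b x y z -> normal_pt r (- b) x z y.
Proof.
case=> [[F [p [q [fF vF [-> -> ->]]]]]|[F [fF A1 B1 [-> -> ->]]]].
  left; exists (fswap F), q, p; split; [exact: is_frame_swap|exact: is_vtx_swap|].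
  by rewrite /gx /gy /gz /=; split; ring.
right; exists (fswap F); split => //=; first exact: is_frame_swap.
by split=> //; ring.
Qed.

Section NormalForm.
Variables r b : int.
Hypothesis r2 : 1 < r.
Hypothesis binv : exists b' k, b * b' = 1 + k * r.

(** Euclidean division of [fB] by [fA] gives another basis of relations, in
    which the point does not lie on a line [fU = 0]. *)
Lemma normal_pt_p0 F q : is_frame r b F -> 0 < fA F -> 0 < fB F -> 0 <= q -> q < be F ->
  1 <= q \/ fA F < fB F -> normal_pt r b (gx F 0 q) (gy F 0 q) (gz F 0 q).
Proof.
move=> [[a0 b0 A0 B0] [hr [k1 e1] [k2 e2] dA dB]] A1 B1 q0 qb h; left.
(* [j] is the largest integer with [j * fA < fB], so that the widths of the new
   frame, [(j + 1) fA - fB] and [fB - j fA], are not negative. *)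
pose j := ((fB F - 1) %/ fA F)%Z.
have An0 : fA F != 0 by lia.
have hj := divz_eq (fB F - 1) (fA F).
have m0 := modz_ge0 (fB F - 1) An0.
have m1 : ((fB F - 1) %% fA F)%Z < fA F by apply: ltz_pmod.
have j0 : 0 <= j by rewrite divz_ge0 //; lia.
have j1 : fA F < fB F -> 1 <= j.
  move=> AB; rewrite -/j in hj; case: (leP 1 j) => // jl.
  have j00 : j = 0 by lia.
  by move: hj; rewrite j00 mul0r; lia.
rewrite -/j in hj.
move: j ((fB F - 1) %% fA F)%Z hj m0 m1 j0 j1 => j m hj m0 m1 j0 j1.
have jal : 0 <= j * al F by nia.
have jal1 : fA F < fB F -> 1 <= j * al F by move/j1; clear -a0; nia.
exists (Frame (al F + (be F + j * al F)) (be F + j * al F) (fA F - (fB F - j * fA F))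
  (fB F - j * fA F)), (be F - q), (q + j * al F); split.
- split; first by split=> /=; lia.
  split=> /=; try lia.
  + exists (k1 + k2 + j * k1).
    have -> : b * (al F + (be F + j * al F)) = b * al F + b * be F + j * (b * al F) by ring.
    by rewrite e1 e2; ring.
  + exists (k2 + j * k1).
    have -> : b * (be F + j * al F) = b * be F + j * (b * al F) by ring.
    by rewrite e1 e2; ring.
- split; first by case: h => [?|/jal1 ?]; split=> /=; lia.
  by split=> /=; lia.
- by rewrite /gx /gy /gz /=; split; ring.
Qed.

(** If [fA = fB] then [(0, al + be)] is a relation, hence [al + be >= r]. *)
Lemma frame_AB F : is_frame r b F -> fA F = fB F -> fA F = 1.
Proof.
move=> [[a0 b0 A0 B0] [hr [k1 e1] [k2 e2] dA dB]] AB.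
have e : b * (al F + be F) = (k1 + k2) * r by rewrite mulrDr e1 e2 AB; ring.
have [k e'] := dvd_unit binv e.
have := multiple_ge r2 e' _; rewrite -AB in hr.
have : (al F + be F) * fA F = r by rewrite -hr; ring.
clear -a0 b0 A0 r2 => h1 h2; have : r <= al F + be F by lia.
move: h1; set s := al F + be F => h1 h3.
have A1 : 1 <= fA F by nia.
have : fA F < 2 by nia.
by lia.
Qed.

Lemma normal_pt_half F q : is_frame r b F -> is_prevtx F 0 q ->
  ~ (gx F 0 q = 0 /\ gy F 0 q = 0) ->
  ~ (q = 0 /\ fB F < fA F) -> normal_pt r b (gx F 0 q) (gy F 0 q) (gz F 0 q).
Proof.
move=> fF [[_ q0 qa qb] [cA cB]] nz h.
have [[a0 b0 A0 B0] [hr [k1 e1] [k2 e2] dA dB]] := fF.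
have qb' : q != be F.
  by apply/eqP => e; apply: nz; rewrite /gx /gy e; split; ring.
have A1 : 0 < fA F by rewrite lt0r A0 andbT; apply/eqP => /cA; lia.
have [B00|Bn] := eqVneq (fB F) 0.
  have q00 : q = al F by have := cB B00; lia.
  have [br A11] : be F = r /\ fA F = 1.
    have AB : al F * fB F = 0 by rewrite B00 mulr0.
    have ebA : be F * fA F = r by lia.
    rewrite B00 oppr0 add0r in e2; have [k e] := dvd_unit binv e2.
    have rb := multiple_ge r2 e b0.
    have A2 : fA F < 2 by clear -ebA rb r2 A1; nia.
    have A3 : fA F = 1 by lia.
    by split=> //; rewrite -ebA A3 mulr1.
  right; exists (Frame (al F) (r - al F) 1 1); split=> //.
    have := dB B00 => ab.
    split; first by split=> /=; lia.
    split=> /=; try lia; first by exists k1; lia.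
    by exists (b - k1); lia.
  by rewrite /gx /gy /gz /= q00 br A11 B00; split; ring.
have B1 : 0 < fB F by lia.
have [qn|qp] := leP 1 q; first by apply: normal_pt_p0 => //; [lia|left].
have q00 : q = 0 by lia.
subst q; have [AB|AB|AB] := ltgtP (fA F) (fB F).
- by apply: normal_pt_p0 => //; right.
- by case: h.
have A11 := frame_AB fF AB.
right; exists F; split=> //; first by rewrite -AB.
by rewrite /gx /gy /gz -AB A11; split; ring.
Qed.

End NormalForm.

Lemma prevtx_normal_pt r b F p q : 1 < r -> (exists b' k, b * b' = 1 + k * r) ->
  is_frame r b F -> is_prevtx F p q ->
  ~ (gx F p q = 0 /\ gy F p q = 0) -> ~ (gx F p q = 0 /\ gz F p q = 0) ->
  normal_pt r b (gx F p q) (gy F p q) (gz F p q).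
Proof.
move=> r2 binv fF vF ny nz.
have [[p0 q0 pa pb] [cA cB]] := vF.
have binv' : exists b' k, - b * b' = 1 + k * r.
  by have [b' [k e]] := binv; exists (- b'), k; lia.
have vF' : is_prevtx (fswap F) q p by split; [split|split] => /=; lia.
have sx : gx F p q = gx (fswap F) q p by rewrite /gx /=; ring.
have sy : gy F p q = gz (fswap F) q p by rewrite /gy /gz /=; ring.
have sz : gz F p q = gy (fswap F) q p by rewrite /gy /gz /=; ring.
have sw : q = 0 -> ~ (p = 0 /\ fA F < fB F) -> normal_pt r b (gx F p q) (gy F p q) (gz F p q).
  move=> q00 h; rewrite -[b]opprK sx sy sz; apply: normal_pt_swap.
  rewrite sx sz in nz; subst q.
  exact: (normal_pt_half r2 binv' (is_frame_swap fF) vF' nz h).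
have [q00|qn] := eqVneq q 0.
  have [p00|pn] := eqVneq p 0; last by apply: sw => // -[]; lia.
  have [AB|AB] := leP (fB F) (fA F); first by apply: sw => // -[]; lia.
  by subst p; apply: normal_pt_half => // -[]; lia.
have [p00|pn] := eqVneq p 0.
  by subst p; apply: normal_pt_half => // -[]; lia.
left; exists F, p, q; split=> //; split=> //; split; lia.
Qed.

(** * Rays and faces *)

Section Geometry.
Variables (R : realType) (r a : nat).
Hypothesis r2 : (1 < r)%N.
Hypothesis ar : (a < r)%N.
Hypothesis cra : coprime r a.
Implicit Types (w : 'rV[R]_3) (F : frame) (tau sig v : set 'rV[R]_3).

Let r0 : 0 < r%:Z. Proof. by clear -r2; lia. Qed.
Let rR : 0 < (r%:Z)%:~R :> R. Proof. by rewrite ltr0z. Qed.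

Lemma rvDR w w' i : (w + w') 0 i = w 0 i + w' 0 i. Proof. by rewrite mxE. Qed.
Lemma rvZR (t : R) w i : (t *: w) 0 i = t * w 0 i. Proof. by rewrite mxE. Qed.

Lemma wSD w w' : wS (w + w') = wS w + wS w'.
Proof. by rewrite /wS /fS !rvDR; ring. Qed.
Lemma wSZ t w : wS (t *: w) = t * wS w.
Proof. by rewrite /wS /fS !rvZR; ring. Qed.
Lemma wUD F w w' : wU F (w + w') = wU F w + wU F w'.
Proof. by rewrite /wU /fU !rvDR; ring. Qed.
Lemma wUZ F t w : wU F (t *: w) = t * wU F w.
Proof. by rewrite /wU /fU !rvZR; ring. Qed.
Lemma wVD F w w' : wV F (w + w') = wV F w + wV F w'.
Proof. by rewrite /wV /fV !rvDR; ring. Qed.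
Lemma wVZ F t w : wV F (t *: w) = t * wV F w.
Proof. by rewrite /wV /fV !rvZR; ring. Qed.
Definition wE := (wSD, wSZ, wUD, wUZ, wVD, wVZ).

Lemma coord_eq b F w w' : is_frame r%:Z b F -> wS w = wS w' -> wU F w = wU F w' ->
  wV F w = wV F w' -> w = w'.
Proof.
move=> fF eS eU eV; have rn : (r%:Z)%:~R != 0 :> R by rewrite gt_eqF.
apply: rv3P; apply: (mulfI rn).
- by rewrite (frame_x _ (w 0 o1) (w 0 o2) fF) (frame_x _ (w' 0 o1) (w' 0 o2) fF);
  congr (_ - _ * _ - _ * _) => //; congr (_ * _).
- by rewrite (frame_y (w 0 o0) _ (w 0 o2) fF) (frame_y (w' 0 o0) _ (w' 0 o2) fF);
  congr (_ + _ * _ - _ * _) => //; congr (_ * _).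
- by rewrite (frame_z (w 0 o0) (w 0 o1) _ fF) (frame_z (w' 0 o0) (w' 0 o1) _ fF);
  congr (_ + _ * _ - _ * _) => //; congr (_ * _).
Qed.

Definition vecz (x y z : int) : 'rV[R]_3 := vec x%:~R y%:~R z%:~R.
Definition gv F (p q : int) : 'rV[R]_3 := vecz (gx F p q) (gy F p q) (gz F p q).

Lemma wS_gv b F p q : is_frame r%:Z b F -> wS (gv F p q) = r%:~R.
Proof.
move=> [_ [h _ _ _ _]]; rewrite /wS /gv /vecz !vecE /fS /gy /gz -intrD; congr (_%:~R).
by rewrite -[RHS]h; ring.
Qed.

Lemma wU_gv b F p q : is_frame r%:Z b F -> wU F (gv F p q) = p%:~R * r%:~R.
Proof.
move=> [_ [h _ _ _ _]]; rewrite /wU /gv /vecz !vecE /fU /gx /gy -!intrM -intrB.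
by congr (_%:~R); rewrite -[r%:Z]h; ring.
Qed.

Lemma wV_gv b F p q : is_frame r%:Z b F -> wV F (gv F p q) = q%:~R * r%:~R.
Proof.
move=> [_ [h _ _ _ _]]; rewrite /wV /gv /vecz !vecE /fV /gx /gz -!intrM -intrB.
by congr (_%:~R); rewrite -[r%:Z]h; ring.
Qed.

Definition e1 : 'rV[R]_3 := vec 1 0 0.
Lemma wS_e1 : wS e1 = 0. Proof. by rewrite /wS /fS !vecE addr0. Qed.
Lemma wU_e1 F : wU F e1 = - (fA F)%:~R.
Proof. by rewrite /wU /fU !vecE; ring. Qed.
Lemma wV_e1 F : wV F e1 = - (fB F)%:~R.
Proof. by rewrite /wV /fV !vecE; ring. Qed.

Lemma dotZ (t : R) w u : dot (t *: w) u = t * dot w u.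
Proof. by rewrite !dotE !rvZR; ring. Qed.

Lemma sigma_scale Gam t w : 0 <= t -> sigma R r a Gam w -> sigma R r a Gam (t *: w).
Proof. by move=> t0 h m m' *; rewrite !dotZ ler_wpM2l // h. Qed.

Lemma face_scale Gam tau t w : face tau (sigma R r a Gam) -> 0 <= t -> tau w -> tau (t *: w).
Proof.
move=> [c _ ->] t0 [sw pw]; split; first exact: sigma_scale.
by rewrite /plane /= -scalemxAl pw scaler0.
Qed.

Lemma cone_dim1P v w w' : cone_dim v 1 -> v w -> w != 0 -> v w' -> exists t, w' = t *: w.
Proof.
move=> [B [_ _ hB]] vw wn vw'.
have [[c ec] [c' ec']] := (submxP (hB _ vw), submxP (hB _ vw')).
have en (D : 'M[R]_1) : D *m B = D 0 0 *: B by rewrite {1}[D]mx11_scalar mul_scalar_mx.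
rewrite !en in ec ec'.
have c0 : c 0 0 != 0 by apply: contra_neq wn => c0; rewrite ec c0 scale0r.
by exists (c' 0 0 / c 0 0); rewrite ec ec' scalerA divfK.
Qed.

Lemma vertex_ray v w w' : vertex r a v -> v w -> w != 0 -> v w' -> exists2 t, 0 <= t & w' = t *: w.
Proof.
move=> [[Gam gG fv] dv _] vw wn vw'; have [t et] := cone_dim1P dv vw wn vw'.
exists t => //; rewrite leNgt; apply/negP => t0; case/eqP: wn.
have [c _ ev] := fv.
have ge0 x : v x -> [/\ 0 <= x 0 o0, 0 <= x 0 o1 & 0 <= x 0 o2].
  by rewrite ev => -[sx _]; exact: (sigma_ge0 r2 ar cra gG sx).
have [x0 x1 x2] := ge0 _ vw; have := ge0 _ vw'; rewrite et !rvZR => -[y0 y1 y2].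
by apply: rv3P; rewrite mxE; nra.
Qed.

Lemma vertex_sub_edge v w tau : vertex r a v -> v w -> w != 0 -> Fan R r a tau -> tau w ->
  (v `<=` tau)%classic.
Proof.
move=> vv vw wn [Gam gG ft] tw w' vw'.
have [t t0 ->] := vertex_ray vv vw wn vw'.
exact: face_scale ft t0 tw.
Qed.

Lemma vertex_not_axis v w (i : 'I_3) : vertex r a v -> v w -> w != 0 ->
  (forall j, j != i -> w 0 j = 0) -> False.
Proof.
move=> vv vw wn hw; have [[Gam gG fv] _ nax] := vv; apply: (nax i).
have [c _ ev] := fv.
have wi0 : 0 <= w 0 i.
  have : v w := vw; rewrite ev => -[sx _].
  have [h0 h1 h2] := sigma_ge0 r2 ar cra gG sx.
  by apply: (proj2 (forall3 (fun i => 0 <= w 0 i))).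
have ew : w = w 0 i *: delta_mx 0 i.
  apply/rowP => j; rewrite !mxE eqxx /=; have [->|ji] := eqVneq j i; first by rewrite mulr1.
  by rewrite hw // mulr0.
have wi : w 0 i != 0 by apply: contra_neq wn => e; rewrite ew e scale0r.
apply/seteqP; split=> [w' /(vertex_ray vv vw wn)[t t0 ->]|_ [t t0 <-]].
  by exists (t * w 0 i); [rewrite /= mulr_ge0|rewrite -scalerA -ew].
have -> : t *: delta_mx 0 i = (t / w 0 i) *: w by rewrite {2}ew scalerA divfK.
by apply: (face_scale fv) => //; rewrite divr_ge0.
Qed.

(** The linear form defining the face is non-negative at the three points and
    vanishes at their combination [w]. *)
Lemma face_gen v Gam w k t1 t2 t3 g1 g2 g3 : face v (sigma R r a Gam) ->
  v w -> w != 0 -> 0 < k -> k *: w = t1 *: g1 + t2 *: g2 + t3 *: g3 ->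
  0 <= t1 -> 0 <= t2 -> 0 <= t3 ->
  sigma R r a Gam g1 -> sigma R r a Gam g2 -> sigma R r a Gam g3 ->
  [\/ v g1, v g2 | v g3].
Proof.
move=> [c c0 ev] vw wn k0 e t10 t20 t30 s1 s2 s3.
pose sp (x : 'rV[R]_3) := (x *m c^T) 0 0.
have spD x y : sp (x + y) = sp x + sp y by rewrite /sp mulmxDl mxE.
have spZ x y : sp (x *: y) = x * sp y by rewrite /sp -scalemxAl mxE.
have cw : sp w = 0.
  by have : v w := vw; rewrite ev => -[_] /= h; rewrite /sp h mxE.
have := congr1 sp e; rewrite !spD !spZ cw mulr0 => ec.
have [h1 h2 h3] := And3 (c0 _ s1) (c0 _ s2) (c0 _ s3).
have inv x g : sigma R r a Gam g -> 0 < x -> x * sp g = 0 -> v g.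
  move=> sg x0 /eqP; rewrite mulf_eq0 gt_eqF //= => /eqP h; rewrite ev; split=> //.
  by apply/matrixP => i j; rewrite !ord1 [RHS]mxE; exact: h.
have m1 : 0 <= t1 * sp g1 by apply: mulr_ge0.
have m2 : 0 <= t2 * sp g2 by apply: mulr_ge0.
have m3 : 0 <= t3 * sp g3 by apply: mulr_ge0.
move: m1 m2 m3 ec (inv t1 g1 s1) (inv t2 g2 s2) (inv t3 g3 s3).
move: (t1 * _) (t2 * _) (t3 * _) => x1 x2 x3 m1 m2 m3 ec i1 i2 i3.
have [p1|n1] := ltP 0 t1; first by apply: Or31; apply: i1 => //; lra.
have [p2|n2] := ltP 0 t2; first by apply: Or32; apply: i2 => //; lra.
have [p3|n3] := ltP 0 t3; first by apply: Or33; apply: i3 => //; lra.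
have z1 : t1 = 0 by apply/eqP; rewrite eq_le t10 n1.
have z2 : t2 = 0 by apply/eqP; rewrite eq_le t20 n2.
have z3 : t3 = 0 by apply/eqP; rewrite eq_le t30 n3.
move/eqP: e; rewrite z1 z2 z3 !scale0r !addr0 scaler_eq0 gt_eqF //=.
by rewrite (negbTE wn).
Qed.

Lemma cone_dim1_neq0 v : cone_dim v 1 -> exists2 w, v w & w != 0.
Proof.
move=> [B [rf hB _]]; exists (row 0 B) => //.
have -> : row 0 B = B by apply/rowP => j; rewrite mxE.
by apply/eqP => e; move: rf; rewrite e -row_leq_rank mxrank0.
Qed.

Lemma gv_neq0 b F p q : is_frame r%:Z b F -> gv F p q != 0.
Proof.
move=> fF; apply/eqP => /(congr1 (@wS R)); rewrite (wS_gv _ _ fF) /wS /fS !mxE addr0.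
by move/eqP; rewrite gt_eqF.
Qed.

Lemma in_cellv_gv b F (p q p' q' : int) : is_frame r%:Z b F ->
  (fB F = 0 \/ (p <= p' /\ p' <= p + 1)) -> (fA F = 0 \/ (q <= q' /\ q' <= q + 1)) ->
  p' + q' <= al F -> p' + q' <= be F -> in_cellv F p q (gv F p' q').
Proof.
move=> fF hB hA ha hb; rewrite /in_cellv /in_cell -!/(wS _) -!/(wU _ _) -!/(wV _ _).
rewrite (wS_gv _ _ fF) (wU_gv _ _ fF) (wV_gv _ _ fF) -mulrDl -intrD !ler_pM2r // !ler_int.
by clear -hA hB ha hb; split=> //; lia.
Qed.

End Geometry.

(** * Vertices of the fan *)

Section Vertices.
Variables (R : realType) (r a : nat).
Hypothesis r2 : (1 < r)%N.
Hypothesis ar : (a < r)%N.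
Hypothesis cra : coprime r a.
Implicit Types (w : 'rV[R]_3) (F : frame) (tau sig v : set 'rV[R]_3).

Let r0 : 0 < r%:Z. Proof. by clear -r2; lia. Qed.
Let r2' : 1 < r%:Z. Proof. by clear -r2; lia. Qed.
Let rR : 0 < (r%:Z)%:~R :> R. Proof. by rewrite ltr0z. Qed.

Lemma in_cellvE F p q w : in_cellv F p q w <->
  [/\ fB F != 0 -> p%:~R * wS w <= wU F w <= (p + 1)%:~R * wS w,
      fA F != 0 -> q%:~R * wS w <= wV F w <= (q + 1)%:~R * wS w,
      wU F w + wV F w <= (al F)%:~R * wS w &
      wU F w + wV F w <= (be F)%:~R * wS w].
Proof. by []. Qed.

Lemma in_cellv_e1 F p q : 0 <= fA F -> 0 <= fB F -> fA F = 0 \/ fB F = 0 ->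
  in_cellv F p q (e1 R).
Proof.
move=> A0 B0 AB; rewrite in_cellvE !(wS_e1, wU_e1, wV_e1) !mulr0.
have h (x : int) : 0 <= x -> - x%:~R <= 0 :> R by rewrite oppr_le0 ler0z.
have := h _ A0; have := h _ B0.
by split; try lra; case: AB => -> //; rewrite ?eqxx // oppr0 lexx.
Qed.

Lemma e1_neq0 : e1 R != 0.
Proof.
apply/eqP => /(congr1 (fun w : 'rV[R]_3 => w 0 o0)) /=.
by rewrite vecE mxE => /eqP; rewrite oner_eq0.
Qed.

Lemma vertex_e1 v : vertex r a v -> ~ v (e1 R).
Proof.
move=> vv ve; apply: (vertex_not_axis r2 ar cra (i := o0) vv ve e1_neq0).
by apply/forall3; rewrite !vecE; split.
Qed.

(** A cell is the cone over a triangle or a square of grid points, or over two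
    grid points and [e_1].  A point on an extremal ray is a non-negative
    combination of these, one of which lies on the ray. *)
Lemma vertex_prevtx v : vertex r a v -> exists F p q,
  [/\ is_frame r%:Z a F, is_prevtx F p q & v (gv R F p q)].
Proof.
move=> vv; have [[Gam gG fv] dv _] := vv.
have [F [p [q [fF cF eG]]]] := Ggraph_classify r2 ar cra gG; subst Gam.
have se := sigmaE r2 ar R fF cF.
have [w vw wn] := cone_dim1_neq0 dv.
have iC : in_cellv F p q w.
  by have [c _ ev] := fv; have : v w := vw; rewrite ev se => -[].
have sg p' q' : (fB F = 0 \/ (p <= p' /\ p' <= p + 1)) ->
   (fA F = 0 \/ (q <= q' /\ q' <= q + 1)) -> p' + q' <= al F -> p' + q' <= be F ->
   sigma R r a (graph_of F p q) (gv R F p' q').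
  by move=> *; rewrite se /=; apply: (in_cellv_gv R r2 fF).
have [[a0 b0 A0 B0] [hr _ _ dA dB]] := fF.
have [[p0 q0 pa pb] [cA cB]] := cF.
have pv p' q' : 0 <= p' -> 0 <= q' -> p' + q' <= al F -> p' + q' <= be F ->
   (fA F = 0 -> p' + q' = be F) -> (fB F = 0 -> p' + q' = al F) -> is_prevtx F p' q'.
  by move=> *; split.
have fin p' q' : 0 <= p' -> 0 <= q' -> p' + q' <= al F -> p' + q' <= be F ->
   (fA F = 0 -> p' + q' = be F) -> (fB F = 0 -> p' + q' = al F) ->
   v (gv R F p' q') -> exists F p q, [/\ is_frame r%:Z a F, is_prevtx F p q & v (gv R F p q)].
  by move=> *; exists F, p', q'; split=> //; apply: pv.
have S0 : 0 <= wS w := in_cell_S0 r0 fF iC.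
have ne1 := vertex_e1 vv.
move/in_cellvE: iC => [cU cV cm1 cm2].
have gS p' q' := wS_gv R p' q' fF.
have gU p' q' := wU_gv R p' q' fF.
have gV p' q' := wV_gv R p' q' fF.
have [A00|An] := eqVneq (fA F) 0.
  have Bn : fB F != 0 by apply/eqP => B00; move: hr; rewrite A00 B00 !mulr0; ilia R.
  have /andP[u1 u2] := cU Bn.
  have eb := cA A00; have ab := dA A00.
  have BR : 0 < (fB F)%:~R :> R by rewrite ltr0z; ilia R.
  have se1 : sigma R r a (graph_of F p q) (e1 R) by rewrite se /=; apply: in_cellv_e1 => //; left.
  have e : (r%:~R * (fB F)%:~R) *: w =
     ((fB F)%:~R * ((p + 1)%:~R * wS w - wU F w)) *: gv R F p (q + 1) +
     ((fB F)%:~R * (wU F w - p%:~R * wS w)) *: gv R F (p + 1) q +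
     (r%:~R * ((be F)%:~R * wS w - (wU F w + wV F w))) *: e1 R.
    apply: (coord_eq r2 fF); rewrite !wE ?wS_e1 ?wU_e1 ?wV_e1 ?gS ?gU ?gV -?eb ?A00; ring.
  have [] := face_gen fv vw wn _ e _ _ _ _ _ se1.
  - by rewrite mulr_gt0.
  - by rewrite mulr_ge0 ?(ltW BR) // subr_ge0.
  - by rewrite mulr_ge0 ?(ltW BR) // subr_ge0.
  - by rewrite mulr_ge0 ?(ltW rR) // subr_ge0.
  - by apply: sg; ilia R.
  - by apply: sg; ilia R.
  - by apply: fin; ilia R.
  - by apply: fin; ilia R.
  - by move/ne1.
have /andP[v1 v2] := cV An.
have [B00|Bn] := eqVneq (fB F) 0.
  have eb := cB B00; have ab := dB B00.
  have AR : 0 < (fA F)%:~R :> R by rewrite ltr0z; ilia R.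
  have se1 : sigma R r a (graph_of F p q) (e1 R) by rewrite se /=; apply: in_cellv_e1 => //; right.
  have e : (r%:~R * (fA F)%:~R) *: w =
     ((fA F)%:~R * ((q + 1)%:~R * wS w - wV F w)) *: gv R F (p + 1) q +
     ((fA F)%:~R * (wV F w - q%:~R * wS w)) *: gv R F p (q + 1) +
     (r%:~R * ((al F)%:~R * wS w - (wU F w + wV F w))) *: e1 R.
    apply: (coord_eq r2 fF); rewrite !wE ?wS_e1 ?wU_e1 ?wV_e1 ?gS ?gU ?gV -?eb ?B00; ring.
  have [] := face_gen fv vw wn _ e _ _ _ _ _ se1.
  - by rewrite mulr_gt0.
  - by rewrite mulr_ge0 ?(ltW AR) // subr_ge0.
  - by rewrite mulr_ge0 ?(ltW AR) // subr_ge0.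
  - by rewrite mulr_ge0 ?(ltW rR) // subr_ge0.
  - by apply: sg; ilia R.
  - by apply: sg; ilia R.
  - by apply: fin; ilia R.
  - by apply: fin; ilia R.
  - by move/ne1.
have /andP[u1 u2] := cU Bn.
(* A diagonal cuts the square cell into two triangles, and [w] lies in one of
   them; the other triangle is missing for [p + q + 1 = min(al, be)]. *)
pose x := wU F w - p%:~R * wS w; pose y := wV F w - q%:~R * wS w.
have [xy|xy] := leP (x + y) (wS w).
  have e : r%:~R *: w = (wS w - (x + y)) *: gv R F p q + x *: gv R F (p + 1) q +
      y *: gv R F p (q + 1).
    by apply: (coord_eq r2 fF); rewrite !wE ?gS ?gU ?gV /x /y; ring.
  have [] := face_gen fv vw wn rR e.
  - by rewrite subr_ge0.
  - by rewrite subr_ge0.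
  - by rewrite subr_ge0.
  - by apply: sg; ilia R.
  - by apply: sg; ilia R.
  - by apply: sg; ilia R.
  - by apply: fin; ilia R.
  - by apply: fin; ilia R.
  - by apply: fin; ilia R.
have S1 : 0 < wS w.
  rewrite lt0r S0 andbT; apply/eqP => S00.
  by move: xy; rewrite /x /y; move: u2 v2; rewrite S00 !mulr0; lra.
have hm (m : int) : wU F w + wV F w <= m%:~R * wS w -> p + q + 1 < m.
  move=> h; rewrite -(ltr_int R) -(ltr_pM2r S1); apply: lt_le_trans h.
  by rewrite /x /y in xy; rewrite !intrD; lra.
have ha := hm _ cm1; have hb := hm _ cm2.
have e : r%:~R *: w = (x + y - wS w) *: gv R F (p + 1) (q + 1) +
    (wS w - y) *: gv R F (p + 1) q + (wS w - x) *: gv R F p (q + 1).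
  by apply: (coord_eq r2 fF); rewrite !wE ?gS ?gU ?gV /x /y; ring.
have [] := face_gen fv vw wn rR e.
- by rewrite subr_ge0 ltW.
- by rewrite /y; move: v2; rewrite intrD; lra.
- by rewrite /x; move: u2; rewrite intrD; lra.
- by apply: sg; ilia R.
- by apply: sg; ilia R.
- by apply: sg; ilia R.
- by apply: fin; ilia R.
- by apply: fin; ilia R.
- by apply: fin; ilia R.
Qed.

Lemma vertex_normal_pt v : vertex r a v -> exists x y z,
  [/\ normal_pt r%:Z a x y z, v (vecz R x y z) & vecz R x y z != 0].
Proof.
move=> vv; have [F [p [q [fF vF vg]]]] := vertex_prevtx vv.
have gn := gv_neq0 R r2 p q fF.
exists (gx F p q), (gy F p q), (gz F p q); split=> //.
apply: (prevtx_normal_pt r2' (inv_a r2 ar cra) fF vF) => -[hx hy].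
  apply: (vertex_not_axis r2 ar cra (i := o2) vv vg gn).
  by apply/forall3; rewrite !vecE hx hy; split.
apply: (vertex_not_axis r2 ar cra (i := o1) vv vg gn).
by apply/forall3; rewrite !vecE hx hy; split.
Qed.

End Vertices.

(** * Rigid characters and walls *)

Section Rigid.
Variables (R : realType) (r a : nat).
Hypothesis r2 : (1 < r)%N.
Hypothesis ar : (a < r)%N.
Hypothesis cra : coprime r a.
Implicit Types (w g : 'rV[R]_3) (F : frame) (tau sig v E : set 'rV[R]_3).

Let r0 : 0 < r%:Z. Proof. by clear -r2; lia. Qed.
Let rR : 0 < (r%:Z)%:~R :> R. Proof. by rewrite ltr0z. Qed.

Definition rigid v (chi : 'Z_r) : Prop := exists m0, forall Gam m,
  Ggraph r a Gam -> (v `<=` sigma R r a Gam)%classic -> Gam m -> wt r a m = chi -> m = m0.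

Lemma wt_mono i n : wt r a (mono i n) = i%:~R + a%:R * n%:~R.
Proof. by rewrite (wtE r2 ar) px_mono pn_mono. Qed.

(** By [sigma_min] the element of weight [chi] of each chart at [v] is cheapest
    at [w], so it must be a strictly cheapest monomial if there is one. *)
Lemma rigid_strict v w n0 chi : v w -> chi = a%:R * n0%:~R ->
  (forall i n k, 0 <= i -> i + a%:Z * (n - n0) = k * r%:Z -> ~ (i = 0 /\ n = n0) ->
    cost (w 0 o0) (w 0 o1) (w 0 o2) 0 n0 < cost (w 0 o0) (w 0 o1) (w 0 o2) i n) ->
  rigid v chi.
Proof.
move=> vw echi h; exists (mono 0 n0) => Gam m gG vG gm wm.
have mm := Ggraph_ismon gG gm.
have em := monoK mm (Ggraph_noyz r2 ar gG gm).
have mm0 : ismon (mono 0 n0) by apply/ismon_mono.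
have we : wt r a m = wt r a (mono 0 n0) by rewrite wm wt_mono add0r.
have := sigma_min r2 ar cra gG (vG _ vw) gm mm0 we.
have /(wt_eq r2 ar) [k e] := we; rewrite px_mono pn_mono in e.
rewrite em !dot_mono => le.
have [[e1 e2]|ne] := pselect (px m = 0 /\ pn m = n0); first by rewrite e1 e2.
have px0 : 0 <= px m by case/ismonE: mm.
have e' : px m + a%:Z * (pn m - n0) = k * r%:Z by rewrite -e; ilia R.
by have := h _ _ k px0 e' ne; rewrite ltNge le.
Qed.

Lemma vertex_ge0 v w : vertex r a v -> v w -> [/\ 0 <= w 0 o0, 0 <= w 0 o1 & 0 <= w 0 o2].
Proof.
move=> [[Gam gG [c _ ev]] _ _] vw; have : v w := vw; rewrite ev => -[sw _].
exact: (sigma_ge0 r2 ar cra gG sw).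
Qed.

Lemma rigid_vtx v F p q n0 chi : vertex r a v -> is_frame r%:Z a F -> is_vtx F p q ->
  v (gv R F p q) -> good_row F p q n0 -> chi = a%:R * n0%:~R -> rigid v chi.
Proof.
move=> vv fF vF vg gn echi; have [x0 y0 z0] := vertex_ge0 vv vg.
have eS := wS_gv R p q fF.
apply: (rigid_strict vg echi) => i n k i0 e ne.
apply: (strict_min r0 fF vF gn x0 y0 z0 _ _ _ i0 e ne).
- by rewrite -/(wS _) eS.
- by rewrite -/(wS _) -/(wU F _) (wU_gv _ _ _ fF) eS.
- by rewrite -/(wS _) -/(wV F _) (wV_gv _ _ _ fF) eS.
Qed.

Lemma rigid_triple v F chi : vertex r a v -> is_frame r%:Z a F -> fA F = 1 -> fB F = 1 ->
  v (gv R F 0 0) -> chi = a%:R * (al F - be F)%:~R -> rigid v chi.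
Proof.
move=> vv fF A1 B1 vg echi; have [x0 y0 z0] := vertex_ge0 vv vg.
have eS := wS_gv R 0 0 fF.
have eU := wU_gv R 0 0 fF; have eV := wV_gv R 0 0 fF.
rewrite mul0r in eU eV.
have [[a0 b0 _ _] _] := fF.
have fs := is_frame_swap fF.
apply: (rigid_strict vg echi) => i n k i0 e ne.
have [s [t [ei en]]] := frame_lattice r0 fF e.
rewrite A1 B1 !mulr1 in ei.
have st0 : ~ (s = 0 /\ t = 0) by move=> [s0 t0]; apply: ne; subst s t; ilia R.
move: eS eU eV; rewrite /wS /wU /wV /fS /fU /fV A1 B1 !mul1r => eS eU eV.
have [ab|ab] := leP (be F) (al F).
  apply: (strict_triple_half (s := s) (t := t) a0 b0 ab) => //.
  - by rewrite eS.
  - by apply/eqP; rewrite -subr_eq0 eU.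
  - by apply/eqP; rewrite -subr_eq0 eV.
rewrite -(cost_swap _ _ _ i) -(cost_swap _ _ _ 0) (_ : - (al F - be F) = be F - al F); last by ilia R.
apply: (strict_triple_half (s := t) (t := s) b0 a0 (ltW ab)) => //.
- by rewrite addrC eS.
- by apply/eqP; rewrite -subr_eq0 eV.
- by apply/eqP; rewrite -subr_eq0 eU.
- by ilia R.
- by ilia R.
- by move=> [? ?]; apply: st0.
Qed.

Definition wall F (p q : int) (u : 'rV[int]_3) : set 'rV[R]_3 :=
  [set w | in_cellv F p q w /\ dot w u = 0]%classic.

Definition spans (u : 'rV[int]_3) g g' : Prop :=
  (forall w, dot w u = 0 -> exists s t, w = s *: g + t *: g') /\
  (forall s t, s *: g + t *: g' = 0 -> s = 0 /\ t = 0).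

Lemma cone_dim2 E g g' : E g -> E g' ->
  (forall w, E w -> exists s t, w = s *: g + t *: g') ->
  (forall s t, s *: g + t *: g' = 0 -> s = 0 /\ t = 0) -> cone_dim E 2.
Proof.
move=> Eg Eg' sp ind; pose B : 'M[R]_(2, 3) := \matrix_(i < 2) (if i == 0 then g else g').
have mB (c : 'rV[R]_2) : c *m B = c 0 0 *: g + c 0 1 *: g'.
  by rewrite mulmx_sum_row !big_ord_recl big_ord0 addr0 !rowK /=;
    congr (_ *: _ + _ *: _); congr (c _ _); apply: val_inj.
exists B; split.
- rewrite -kermx_eq0; apply/rowV0P => c /sub_kermxP; rewrite mB => /ind[c0 c1].
  apply/rowP => i; rewrite [RHS]mxE; case: i => [[|[|//]] hi].
    by rewrite -[RHS]c0; congr (c _ _); apply: val_inj.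
  by rewrite -[RHS]c1; congr (c _ _); apply: val_inj.
- by move=> i; rewrite rowK; case: ifP.
- move=> w /sp[s [t ->]]; apply/submxP; exists (\row_i (if i == 0 then s else t)).
  by rewrite mB !mxE.
Qed.

Lemma wall_fan F p q u g g' : is_frame r%:Z a F -> is_cell F p q ->
  (forall w, in_cellv F p q w -> 0 <= dot w u) -> wall F p q u g -> wall F p q u g' ->
  spans u g g' -> Fan R r a (wall F p q u) /\ cone_dim (wall F p q u) 2.
Proof.
move=> fF cF pos Eg Eg' [sp ind]; split; last first.
  by apply: (cone_dim2 Eg Eg') => // w [_]; exact: sp.
exists (graph_of F p q); first exact: graph_of_Ggraph.
pose c : 'rV[R]_3 := \row_i (u 0 i)%:~R.
have cE w : (w *m c^T) 0 0 = dot w u.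
  by rewrite mxE; apply: eq_bigr => i _; rewrite !mxE.
rewrite (sigmaE r2 ar R fF cF); exists c => [w /pos|]; first by rewrite cE.
apply/seteqP; split=> w [iC h]; split=> //.
  by apply/matrixP => i j; rewrite !ord1 cE h mxE.
by rewrite -cE h mxE.
Qed.

(** By a Bezout identity between two entries, both vectors are integral
    multiples of one invariant vector. *)
Lemma parallel_primitive (u u0 : 'rV[int]_3) :
  (forall i j, u0 0 i * u 0 j = u0 0 j * u 0 i) -> primitive r a u -> invariant r a u0 -> u0 != 0 ->
  (forall k u', invariant r a u' -> u0 = k *: u' -> k = 1 \/ k = -1) ->
  u = u0 \/ u = - u0.
Proof.
move=> par [iu un pu] iu0 u0n pu0.
have [j u0j] : exists j, u0 0 j != 0.
  apply/existsP; rewrite -[[exists _, _]]negbK; apply/negP; rewrite negb_exists => /forallP h.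
  by case/eqP: u0n; apply/rowP => j; rewrite mxE; apply/eqP; rewrite -[_ == _]negbK.
pose d := gcdz (u 0 j) (u0 0 j).
have dn : d != 0 by rewrite gcdz_eq0 negb_and u0j orbT.
have [k0 ek0] : exists k0, u 0 j = k0 * d by apply/dvdzP; exact: dvdz_gcdl.
have [k ek] : exists k, u0 0 j = k * d by apply/dvdzP; exact: dvdz_gcdr.
have [x [y exy]] := Bezoutz (u 0 j) (u0 0 j).
have e1 : x * k0 + y * k = 1.
  by apply: (mulIf dn); rewrite mulrDl -!mulrA -ek0 -ek exy mul1r.
have kk i : k * u 0 i = k0 * u0 0 i.
  apply: (mulIf dn); rewrite mulrAC -ek (mulrAC k0) -ek0.
  by rewrite par mulrC.
pose u' := x *: u + y *: u0.
have eu0 : u0 = k *: u'.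
  apply/rowP => i; rewrite !mxE -[LHS]mul1r -e1 mulrDl mulrDr.
  by congr (_ + _); [rewrite -mulrA -kk; ring|ring].
have eu : u = k0 *: u'.
  apply/rowP => i; rewrite !mxE -[LHS]mul1r -e1 mulrDl mulrDr.
  by congr (_ + _); [ring|rewrite -mulrA kk; ring].
have wZ (t : int) (m : 'rV[int]_3) : wt r a (t *: m) = t%:~R * wt r a m.
  by rewrite !(wtE r2 ar) /px /pn !mxE !rmorphB !rmorphM /=; ring.
have iu' : invariant r a u' by rewrite /invariant (wtD r2 ar) !wZ iu iu0 !mulr0 addr0.
have [h|h] := pu _ _ iu' eu; have [h'|h'] := pu0 _ _ iu' eu0.
- by left; rewrite eu eu0 h h'.
- by right; rewrite eu eu0 h h' scale1r scaleN1r opprK.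
- by right; rewrite eu eu0 h h' scale1r scaleN1r.
- by left; rewrite eu eu0 h h'.
Qed.

(** The invariant vectors orthogonal to a two-dimensional cone are proportional,
    and a vector determines its numerator and denominator up to exchange. *)
Lemma mark_unique E (m1 m2 : 'rV[int]_3) g g' chi : E g -> E g' ->
  spans (m1 - m2) g g' -> ismon m1 -> ismon m2 -> (forall i, m1 0 i = 0 \/ m2 0 i = 0) ->
  invariant r a (m1 - m2) -> m1 - m2 != 0 ->
  (forall k u', invariant r a u' -> m1 - m2 = k *: u' -> k = 1 \/ k = -1) ->
  marked a E chi -> chi = wt r a m1.
Proof.
move=> Eg Eg' [sp _] mm1 mm2 dis iu un pu [m1' [m2' [[mm1' mm2' dis' pu' ort] <-]]].
have par i j : (m1 - m2) 0 i * (m1' - m2') 0 j = (m1 - m2) 0 j * (m1' - m2') 0 i.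
  pose w : 'rV[R]_3 := ((m1 - m2) 0 i)%:~R *: delta_mx 0 j - ((m1 - m2) 0 j)%:~R *: delta_mx 0 i.
  have dw u : dot w u = ((m1 - m2) 0 i)%:~R * (u 0 j)%:~R - ((m1 - m2) 0 j)%:~R * (u 0 i)%:~R.
    have dd (t : R) l x : dot (t *: delta_mx 0 l : 'rV[R]_3) x = t * (x 0 l)%:~R.
      rewrite dotZ; congr (_ * _); rewrite /dot (bigD1 l) //= big1 ?addr0.
        by rewrite mxE !eqxx mul1r.
      by move=> l' nl; rewrite mxE eqxx (negbTE nl) mul0r.
    have dDl x y z : dot (x - y : 'rV[R]_3) z = dot x z - dot y z.
      by rewrite /dot -sumrB; apply: eq_bigr => l _; rewrite !mxE mulrBl.
    by rewrite /w dDl !dd.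
  have [|s [t ew]] := sp w; first by rewrite dw mulrC subrr.
  have : dot w (m1' - m2') = 0.
    have dDl x y z : dot (x + y : 'rV[R]_3) z = dot x z + dot y z.
      by rewrite /dot -big_split; apply: eq_bigr => l _; rewrite !mxE mulrDl.
    by rewrite ew dDl !dotZ !ort // !mulr0 addr0.
  rewrite dw => /eqP; rewrite subr_eq0 -!intrM eqr_int => /eqP //.
have fin (x y : 'rV[int]_3) : invariant r a (x - y) -> wt r a x = wt r a y.
  by rewrite /invariant (wtD r2 ar) (wtN r2 ar) => /eqP; rewrite subr_eq0 => /eqP.
have sep (x y x' y' : 'rV[int]_3) : ismon x -> ismon y -> ismon x' -> ismon y' ->
   (forall i, x 0 i = 0 \/ y 0 i = 0) -> (forall i, x' 0 i = 0 \/ y' 0 i = 0) ->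
   x - y = x' - y' -> x = x'.
  move=> hx hy hx' hy' h h' e; apply/rowP => i.
  have := congr1 (fun m : 'rV[int]_3 => m 0 i) e; rewrite /= !rvB.
  by have := hx i; have := hy i; have := hx' i; have := hy' i; have := h i; have := h' i; ilia R.
have [e|e] := parallel_primitive par pu' iu un pu.
  by rewrite (sep _ _ _ _ mm1' mm2' mm1 mm2 dis' dis e).
rewrite opprB in e.
rewrite (sep _ _ _ _ mm1' mm2' mm2 mm1 dis' _ e); last by move=> i; case: (dis i); [right|left].
by apply/esym/fin.
Qed.

End Rigid.

(** * The marks of the walls *)

Section EdgeForms.
Variable R : realType.
Implicit Types (w : 'rV[R]_3) (F : frame).

Definition wallU F (p q : int) := wall (R := R) F p q (mono 0 (al F - p) - vec (fA F) 0 p).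
Definition wallV F (p q : int) := wall (R := R) F p q (mono 0 (q - be F) - vec (fB F) q 0).
Definition wallD F (p q : int) := wall (R := R) F p q (mono (fA F + fB F) 0 - mono 0 (al F - be F)).

Lemma dotU_wall F p w : p <= al F ->
  dot w (mono 0 (al F - p) - vec (fA F) 0 p) = wU F w - p%:~R * wS w.
Proof.
move=> pa; rewrite dotB dot_mono costp; last by ilia R.
by rewrite dotE !vecE /wU /wS /fU /fS; ring.
Qed.

Lemma dotV_wall F q w : q <= be F ->
  dot w (mono 0 (q - be F) - vec (fB F) q 0) = wV F w - q%:~R * wS w.
Proof.
move=> qb; rewrite dotB dot_mono costn; last by ilia R.
by rewrite dotE !vecE /wV /wS /fV /fS; ring.
Qed.

Lemma dotD_wall F m w : (m = al F /\ al F <= be F) \/ (m = be F /\ be F <= al F) ->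
  dot w (mono (fA F + fB F) 0 - mono 0 (al F - be F)) = m%:~R * wS w - wU F w - wV F w.
Proof.
move=> h; rewrite dotB !dot_mono (costp _ _ _ (fA F + fB F)) //.
by case: h => -[-> h]; [rewrite costn|rewrite costp]; try ilia R;
  rewrite /wV /wU /wS /fV /fU /fS; ring.
Qed.

End EdgeForms.

Section Edges.
Variables (R : realType) (r a : nat).
Hypothesis r2 : (1 < r)%N.
Hypothesis ar : (a < r)%N.
Hypothesis cra : coprime r a.
Implicit Types (w g : 'rV[R]_3) (F : frame) (tau sig v E : set 'rV[R]_3).

Let r0 : 0 < r%:Z. Proof. by clear -r2; lia. Qed.
Let rR : 0 < (r%:Z)%:~R :> R. Proof. by rewrite ltr0z. Qed.

(** Only the uniqueness of the mark is asserted: a special character comes with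
    the marks themselves. *)
Definition edge_spec E (chi : 'Z_r) g g' : Prop :=
  [/\ Fan R r a E, cone_dim E 2, E g, E g' & forall chi', marked a E chi' -> chi' = chi].

Lemma gv_indep b F p q p' q' : is_frame r%:Z b F -> p != p' \/ q != q' ->
  forall s t : R, s *: gv R F p q + t *: gv R F p' q' = 0 -> s = 0 /\ t = 0.
Proof.
move=> fF ne s t e.
have z (f : 'rV[R]_3 -> R) : (forall x y, f (x + y) = f x + f y) ->
   (forall x y, f (x *: y) = x * f y) -> s * f (gv R F p q) + t * f (gv R F p' q') = 0.
  by move=> fD fZ; rewrite -!fZ -fD e -[X in f X](scale0r 0) fZ mul0r.
have eS := z _ (@wSD R) (@wSZ R).
have eU := z _ (@wUD R F) (@wUZ R F).
have eV := z _ (@wVD R F) (@wVZ R F).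
rewrite !(wS_gv _ _ _ fF) -mulrDl in eS.
rewrite !(wU_gv _ _ _ fF) !mulrA -mulrDl in eU.
rewrite !(wV_gv _ _ _ fF) !mulrA -mulrDl in eV.
have rn : (r%:Z)%:~R != 0 :> R by rewrite gt_eqF.
have red x : x * (r%:Z)%:~R = 0 :> R -> x = 0.
  by move/eqP; rewrite mulf_eq0 (negbTE rn) orbF => /eqP.
move/red: eS => eS; move/red: eU => eU; move/red: eV => eV.
have t0 : t = 0.
  have s1 : s = - t by lra.
  case: ne => ne.
    have : t * (p' - p)%:~R = 0 by rewrite intrB; move: eU; rewrite s1; lra.
    by move/eqP; rewrite mulf_eq0 intr_eq0 subr_eq0 [p' == p]eq_sym (negbTE ne) orbF => /eqP.
  have : t * (q' - q)%:~R = 0 by rewrite intrB; move: eV; rewrite s1; lra.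
  by move/eqP; rewrite mulf_eq0 intr_eq0 subr_eq0 [q' == q]eq_sym (negbTE ne) orbF => /eqP.
by split=> //; lra.
Qed.

(** The two forms are, up to sign, [r] times the coordinates of [u] in the
    basis of relations, one of which is 1 or -1. *)
Lemma prim_frame F (u : 'rV[int]_3) : is_frame r%:Z a F ->
  [\/ al F * px u + fA F * pn u = r%:Z, al F * px u + fA F * pn u = - r%:Z |
      be F * px u - fB F * pn u = - r%:Z] ->
  forall k u', invariant r a u' -> u = k *: u' -> k = 1 \/ k = -1.
Proof.
move=> [_ [hr [k1 e1] [k2 e2] _ _]] h k u' /(inv_eq r2 ar)[l el] eu.
have [ex en] : px u = k * px u' /\ pn u = k * pn u' by rewrite eu /px /pn !mxE mulrBr.
have [t et] : exists t, k * t = 1.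
  have ea : al F * px u + fA F * pn u = k * (al F * l - pn u' * k1) * r%:Z.
    rewrite ex en; have -> : fA F = a%:Z * al F - k1 * r%:Z by rewrite e1; ring.
    have -> : px u' = l * r%:Z - a%:Z * pn u' by rewrite -el; ring.
    ring.
  have eb : be F * px u - fB F * pn u = k * (be F * l - pn u' * k2) * r%:Z.
    rewrite ex en; have -> : fB F = - (a%:Z * be F) + k2 * r%:Z by rewrite e2; ring.
    have -> : px u' = l * r%:Z - a%:Z * pn u' by rewrite -el; ring.
    ring.
  have rn : r%:Z != 0 by rewrite gt_eqF.
  case: h => h; rewrite ?ea ?eb in h.
  - by exists (al F * l - pn u' * k1); apply: (mulIf rn); rewrite h mul1r.
  - by exists (- (al F * l - pn u' * k1)); apply: (mulIf rn); rewrite mulrN mulNr h mul1r opprK.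
  - by exists (- (be F * l - pn u' * k2)); apply: (mulIf rn); rewrite mulrN mulNr h mul1r opprK.
have kn : k != 0 by apply: contra_eq_neq et => ->; rewrite mul0r.
have tn : t != 0 by apply: contra_eq_neq et => ->; rewrite mulr0.
have : `|k|%N = 1%N.
  have : (`|k| * `|t|)%N = 1%N by rewrite -abszM et.
  by move/eqP; rewrite muln_eq1 => /andP[/eqP].
by clear; lia.
Qed.

Lemma inv_frame F s t (u : 'rV[int]_3) : is_frame r%:Z a F ->
  px u = s * fA F + t * fB F -> pn u = - s * al F + t * be F -> invariant r a u.
Proof.
move=> fF ex en; apply/(inv_eq r2 ar); have [k e] := frame_mod s t fF.
by exists k; rewrite ex en.
Qed.

Lemma wall_edge F p q m1 m2 s t p1 q1 p2 q2 : is_frame r%:Z a F -> is_cell F p q ->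
  ismon m1 -> ismon m2 -> (forall i, m1 0 i = 0 \/ m2 0 i = 0) ->
  px (m1 - m2) = s * fA F + t * fB F -> pn (m1 - m2) = - s * al F + t * be F ->
  (s = -1 /\ t = 0) \/ (s = 0 /\ t = -1) \/ (s = 1 /\ t = 1) ->
  (forall w, in_cellv F p q w -> 0 <= dot w (m1 - m2)) ->
  wall F p q (m1 - m2) (gv R F p1 q1) -> wall F p q (m1 - m2) (gv R F p2 q2) ->
  (p1 != p2) \/ (q1 != q2) ->
  (forall w, dot w (m1 - m2) = 0 -> exists s t,
     (r%:Z)%:~R *: w = s *: gv R F p1 q1 + t *: gv R F p2 q2) ->
  edge_spec (wall F p q (m1 - m2)) (wt r a m1) (gv R F p1 q1) (gv R F p2 q2).
Proof.
move=> fF cF mm1 mm2 dis ex en st pos Eg Eg' ne sp.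
have rn : (r%:Z)%:~R != 0 :> R by rewrite gt_eqF.
have spn : spans (m1 - m2) (gv R F p1 q1) (gv R F p2 q2).
  split; last exact: (gv_indep fF ne).
  move=> w /sp[x [y e]]; exists ((r%:Z)%:~R^-1 * x), ((r%:Z)%:~R^-1 * y).
  by rewrite -!scalerA -scalerDr -e scalerA mulVf // scale1r.
have [fE dE] := wall_fan r2 ar fF cF pos Eg Eg' spn.
split=> // chi; apply: (mark_unique r2 ar cra Eg Eg' spn mm1 mm2 dis).
- exact: (inv_frame fF ex en).
- apply/eqP => e; have := prim_frame (u := m1 - m2) fF _ (k := 0) (u' := 0).
  rewrite e scaler0 => h; case: h => //; last by apply/(inv_eq r2 ar); exists 0; rewrite /px /pn !mxE; ring.
  move: ex en; rewrite e /px /pn !mxE subr0.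
  have [_ [hr _ _ _ _]] := fF; clear -st hr r0 => ex en.
  by exfalso; case: st => [[s1 t1]|[[s1 t1]|[s1 t1]]]; subst s t; nia.
- apply: (prim_frame fF); rewrite ex en; have [_ [hr _ _ _ _]] := fF.
  case: st => [[-> ->]|[[-> ->]|[-> ->]]].
  + by apply: Or33; rewrite -hr; ring.
  + by apply: Or32; rewrite -hr; ring.
  + by apply: Or31; rewrite -hr; ring.
Qed.

Lemma wallU_edge F p q : is_frame r%:Z a F -> is_cell F p q -> fB F != 0 ->
  edge_spec (wallU F p q) (a%:R * (al F - p)%:~R) (gv R F p q) (gv R F p (q + 1)).
Proof.
move=> fF cF Bn; have [[p0 q0 pa pb] _] := cF.
have [[a0 b0 A0 B0] _] := fF.
have -> : a%:R * (al F - p)%:~R = wt r a (mono 0 (al F - p)).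
  by rewrite (wt_mono r2 ar) add0r.
have pal : p <= al F by ilia R.
apply: (wall_edge (s := -1) (t := 0) fF cF).
- exact/ismon_mono.
- by apply/ismonE; rewrite !vecE; split; ilia R.
- by apply/forall3; rewrite !vecE; split; [left|right|left]; ilia R.
- by rewrite /px rvB !vecE; ring.
- by rewrite /pn !rvB !vecE; ilia R.
- by left.
- by move=> w [/(_ Bn)/andP[h _] _ _ _]; rewrite dotU_wall // subr_ge0.
- split; first by apply: (in_cellv_gv R r2 fF); ilia R.
  by rewrite dotU_wall // (wU_gv _ _ _ fF) (wS_gv _ _ _ fF) subrr.
- split; first by apply: (in_cellv_gv R r2 fF); ilia R.
  by rewrite dotU_wall // (wU_gv _ _ _ fF) (wS_gv _ _ _ fF) subrr.
- by right; ilia R.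
- move=> w; rewrite dotU_wall // => /eqP; rewrite subr_eq0 => /eqP eU.
  exists ((q + 1)%:~R * wS w - wV F w), (wV F w - q%:~R * wS w).
  apply: (coord_eq r2 fF); rewrite !wE ?(wS_gv _ _ _ fF) ?(wU_gv _ _ _ fF) ?(wV_gv _ _ _ fF) ?eU; ring.
Qed.

Lemma wallV_edge F p q : is_frame r%:Z a F -> is_cell F p q -> fA F != 0 ->
  edge_spec (wallV F p q) (a%:R * (q - be F)%:~R) (gv R F p q) (gv R F (p + 1) q).
Proof.
move=> fF cF An; have [[p0 q0 pa pb] _] := cF.
have [[a0 b0 A0 B0] _] := fF.
have -> : a%:R * (q - be F)%:~R = wt r a (mono 0 (q - be F)).
  by rewrite (wt_mono r2 ar) add0r.
have qal : q <= be F by ilia R.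
apply: (wall_edge (s := 0) (t := -1) fF cF).
- exact/ismon_mono.
- by apply/ismonE; rewrite !vecE; split; ilia R.
- by apply/forall3; rewrite !vecE; split; [left|left|right]; ilia R.
- by rewrite /px rvB !vecE; ring.
- by rewrite /pn !rvB !vecE; ilia R.
- by right; left.
- by move=> w [_ /(_ An)/andP[h _] _ _]; rewrite dotV_wall // subr_ge0.
- split; first by apply: (in_cellv_gv R r2 fF); ilia R.
  by rewrite dotV_wall // (wV_gv _ _ _ fF) (wS_gv _ _ _ fF) subrr.
- split; first by apply: (in_cellv_gv R r2 fF); ilia R.
  by rewrite dotV_wall // (wV_gv _ _ _ fF) (wS_gv _ _ _ fF) subrr.
- by left; ilia R.
- move=> w; rewrite dotV_wall // => /eqP; rewrite subr_eq0 => /eqP eV.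
  exists ((p + 1)%:~R * wS w - wU F w), (wU F w - p%:~R * wS w).
  apply: (coord_eq r2 fF); rewrite !wE ?(wS_gv _ _ _ fF) ?(wU_gv _ _ _ fF) ?(wV_gv _ _ _ fF) ?eV; ring.
Qed.

Lemma wallD_edge F p q : is_frame r%:Z a F -> is_cell F p q -> p + q + 1 = al F \/ p + q + 1 = be F ->
  edge_spec (wallD F p q) (fA F + fB F)%:~R (gv R F (p + 1) q) (gv R F p (q + 1)).
Proof.
move=> fF cF hm; have [[p0 q0 pa pb] _] := cF.
have [[a0 b0 A0 B0] _] := fF.
have -> : (fA F + fB F)%:~R = wt r a (mono (fA F + fB F) 0).
  by rewrite (wt_mono r2 ar) mulr0 addr0.
have hm' : (p + q + 1 = al F /\ al F <= be F) \/ (p + q + 1 = be F /\ be F <= al F) by ilia R.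
apply: (wall_edge (s := 1) (t := 1) fF cF).
- by apply/ismon_mono; ilia R.
- by apply/ismon_mono.
- by apply/forall3; rewrite !vecE; split; ilia R.
- by rewrite /px rvB !vecE; ring.
- by rewrite /pn !rvB !vecE; ilia R.
- by right; right.
- move=> w [_ _ h1 h2]; rewrite (dotD_wall _ hm').
  by case: hm' => -[-> _]; rewrite -addrA -opprD subr_ge0.
- split; first by apply: (in_cellv_gv R r2 fF); ilia R.
  by rewrite (dotD_wall _ hm') (wU_gv _ _ _ fF) (wV_gv _ _ _ fF) (wS_gv _ _ _ fF); ring.
- split; first by apply: (in_cellv_gv R r2 fF); ilia R.
  by rewrite (dotD_wall _ hm') (wU_gv _ _ _ fF) (wV_gv _ _ _ fF) (wS_gv _ _ _ fF); ring.
- by left; ilia R.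
- move=> w; rewrite (dotD_wall _ hm') => e.
  have eV : wV F w = (p + q + 1)%:~R * wS w - wU F w by lra.
  exists (wU F w - p%:~R * wS w), ((p + 1)%:~R * wS w - wU F w).
  apply: (coord_eq r2 fF); rewrite !wE ?(wS_gv _ _ _ fF) ?(wU_gv _ _ _ fF) ?(wV_gv _ _ _ fF) ?eV; ring.
Qed.

End Edges.

(** * Edges at a grid point *)

Lemma uniq4 (T : eqType) (x1 x2 x3 x4 : T) : x1 <> x2 -> x1 <> x3 -> x1 <> x4 ->
  x2 <> x3 -> x2 <> x4 -> x3 <> x4 -> uniq [:: x1; x2; x3; x4].
Proof.
move=> /eqP/negPf h1 /eqP/negPf h2 /eqP/negPf h3 /eqP/negPf h4 /eqP/negPf h5 /eqP/negPf h6.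
by rewrite /= !inE h1 h2 h3 h4 h5 h6.
Qed.

Lemma uniq5 (T : eqType) (x1 x2 x3 x4 x5 : T) : uniq [:: x1; x2; x3; x4] ->
  x1 <> x5 -> x2 <> x5 -> x3 <> x5 -> x4 <> x5 -> uniq [:: x1; x2; x3; x4; x5].
Proof.
move=> u /eqP/negPf h1 /eqP/negPf h2 /eqP/negPf h3 /eqP/negPf h4.
rewrite -[[:: x1; _; _; _; _]]/([:: x1; x2; x3; x4] ++ [:: x5]) cat_uniq u /=.
by rewrite !inE ![x5 == _]eq_sym h1 h2 h3 h4.
Qed.

Section Star.
Variables (R : realType) (r a : nat).
Hypothesis r2 : (1 < r)%N.
Hypothesis ar : (a < r)%N.
Hypothesis cra : coprime r a.
Implicit Types (w g : 'rV[R]_3) (F : frame) (tau sig v E : set 'rV[R]_3).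

Let r0 : 0 < r%:Z. Proof. by clear -r2; lia. Qed.
Let rR : 0 < (r%:Z)%:~R :> R. Proof. by rewrite ltr0z. Qed.

Lemma valency_ge v n (s : seq (set 'rV[R]_3)) : valency r a v n -> uniq s ->
  (forall E, E \in s -> edges r a v E) -> (size s <= n)%N.
Proof.
move=> vn us hs; rewrite -(card_fset_set vn); apply: uniq_leq_size => // E /hs Ee.
by rewrite in_fset_set ?inE //; apply/finite_setP; exists n.
Qed.

Lemma valency_le v n (s : seq (set 'rV[R]_3)) : valency r a v n ->
  (forall E, edges r a v E -> E \in s) -> (n <= size s)%N.
Proof.
move=> vn hs; rewrite -(card_fset_set vn); apply: uniq_leq_size => [|E].
  exact: finmap.fset_uniq.
by rewrite in_fset_set ?inE; [exact: hs|apply/finite_setP; exists n].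
Qed.

Definition edge_at v E (chi : 'Z_r) : Prop :=
  edges r a v E /\ forall chi', marked a E chi' -> chi' = chi.

Definition four_edges v (c1 c2 : 'Z_r) : Prop := exists E1 E2 E3 E4,
  [/\ uniq [:: E1; E2; E3; E4], edge_at v E1 c1, edge_at v E2 c1, edge_at v E3 c2 & edge_at v E4 c2].

Definition five_edges v : Prop := exists2 s : seq (set 'rV[R]_3), uniq s & size s = 5 /\
  forall E, E \in s -> edges r a v E.

Lemma edge_at_spec v w E chi g g' : vertex r a v -> v w -> w != 0 ->
  edge_spec a E chi g g' -> E w -> edge_at v E chi.
Proof.
move=> vv vw wn [h1 h2 _ _ h3] Ew; split=> //; split=> //.
exact: (vertex_sub_edge r2 ar cra vv vw wn h1 Ew).
Qed.

Lemma gv_in_cellv_p b F p q p' q' : is_frame r%:Z b F -> fB F != 0 ->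
  in_cellv F p q (gv R F p' q') -> p <= p' /\ p' <= p + 1.
Proof.
move=> fF Bn [/(_ Bn)]; rewrite -/(wS _) -/(wU _ _) (wS_gv _ _ _ fF) (wU_gv _ _ _ fF).
by rewrite !ler_pM2r // !ler_int => /andP[].
Qed.

Lemma gv_in_cellv_q b F p q p' q' : is_frame r%:Z b F -> fA F != 0 ->
  in_cellv F p q (gv R F p' q') -> q <= q' /\ q' <= q + 1.
Proof.
move=> fF An [_ /(_ An)]; rewrite -/(wS _) -/(wV _ _) (wS_gv _ _ _ fF) (wV_gv _ _ _ fF).
by rewrite !ler_pM2r // !ler_int => /andP[].
Qed.

Lemma gv_wallU b F p q p' q' : is_frame r%:Z b F -> p <= al F ->
  wallU F p q (gv R F p' q') -> p' = p.
Proof.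
move=> fF pa [_]; rewrite dotU_wall // (wS_gv _ _ _ fF) (wU_gv _ _ _ fF) -mulrBl.
move/eqP; rewrite mulf_eq0 (gt_eqF rR) orbF -intrB intr_eq0; clear; lia.
Qed.

Lemma gv_wallV b F p q p' q' : is_frame r%:Z b F -> q <= be F ->
  wallV F p q (gv R F p' q') -> q' = q.
Proof.
move=> fF pa [_]; rewrite dotV_wall // (wS_gv _ _ _ fF) (wV_gv _ _ _ fF) -mulrBl.
move/eqP; rewrite mulf_eq0 (gt_eqF rR) orbF -intrB intr_eq0; clear; lia.
Qed.

(** The lines [fU = p fS] and [fV = q fS] pass through the point, and each of
    them continues on both sides with the same mark. *)
Lemma four_edges_inner v F p q : vertex r a v -> is_frame r%:Z a F -> fA F != 0 -> fB F != 0 ->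
  1 <= p -> 1 <= q -> p + q < al F -> p + q < be F -> v (gv R F p q) ->
  four_edges v (a%:R * (al F - p)%:~R) (a%:R * (q - be F)%:~R).
Proof.
move=> vv fF An Bn p1 q1 pa pb vg.
have gn := gv_neq0 R r2 p q fF.
have cl p' q' : p' = p /\ (q' = q \/ q' = q - 1) \/ p' = p - 1 /\ q' = q -> is_cell F p' q'.
  by move=> h; split; [split|split]; ilia R.
have h1 := wallU_edge R r2 ar cra fF (cl p q ltac:(ilia R)) Bn.
have h2 := wallU_edge R r2 ar cra fF (cl p (q - 1) ltac:(ilia R)) Bn.
have h3 := wallV_edge R r2 ar cra fF (cl p q ltac:(ilia R)) An.
have h4 := wallV_edge R r2 ar cra fF (cl (p - 1) q ltac:(ilia R)) An.
rewrite subrK in h2; rewrite subrK in h4.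
have ea := edge_at_spec vv vg gn.
have pal : p <= al F by ilia R.
have qbe : q <= be F by ilia R.
exists (wallU F p q), (wallU F p (q - 1)), (wallV F p q), (wallV F (p - 1) q); split.
- have [[_ _ _ g1 _] [_ _ g2 _ _] [_ _ _ g3 _] [_ _ g4 _ _]] := And4 h1 h2 h3 h4.
  apply: uniq4 => e.
  + by move: g2; rewrite -e => -[/(gv_in_cellv_q fF An) h _]; ilia R.
  + by move: g1; rewrite e => /(gv_wallV fF qbe); ilia R.
  + by move: g1; rewrite e => /(gv_wallV fF qbe); ilia R.
  + by move: g2; rewrite e => /(gv_wallV fF qbe); ilia R.
  + by move: g2; rewrite e => /(gv_wallV fF qbe); ilia R.
  + by move: g3; rewrite e => -[/(gv_in_cellv_p fF Bn) h _]; ilia R.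
- by apply: (ea _ _ _ _ h1); case: h1.
- by apply: (ea _ _ _ _ h2); case: h2.
- by apply: (ea _ _ _ _ h3); case: h3.
- by apply: (ea _ _ _ _ h4); case: h4.
Qed.

End Star.

Section Outer.
Variables (R : realType) (r a : nat).
Hypothesis r2 : (1 < r)%N.
Hypothesis ar : (a < r)%N.
Hypothesis cra : coprime r a.
Implicit Types (w g : 'rV[R]_3) (F : frame) (tau sig v E : set 'rV[R]_3).

Let r0 : 0 < r%:Z. Proof. by clear -r2; lia. Qed.
Let rR : 0 < (r%:Z)%:~R :> R. Proof. by rewrite ltr0z. Qed.

(** Beyond the line [fU + fV = be fS] the cells belong to other frames.
    Dividing [q] by [al - be] gives the one of them that has the given point as
    a corner, on its line [fU = 0]. *)
Lemma neighbour_b b F p q : is_frame r%:Z b F -> fB F != 0 -> 0 <= q -> q < be F ->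
  be F < al F -> p + q = be F -> exists F' c,
  [/\ is_frame r%:Z b F', is_cell F' 0 c, fA F' != 0 & fB F' != 0] /\
  [/\ gv R F' 0 c = gv R F p q, c - be F' = q - be F &
      forall w, wU F' w = wU F w + wV F w - (be F)%:~R * wS w].
Proof.
move=> fF Bn q0 qb ba epq.
have [[a0 b0 A0 B0] [hr [k1 e1] [k2 e2] dA dB]] := fF.
pose D := al F - be F.
have D0 : 0 < D by rewrite /D; ilia R.
pose j := (q %/ D)%Z; pose c := (q %% D)%Z.
have hq : q = j * D + c := divz_eq q D.
have c0 : 0 <= c by apply: modz_ge0; ilia R.
have cD : c < D by apply: ltz_pmod.
have j0 : 0 <= j by rewrite divz_ge0.
have jD : 0 <= j * D by clear -j0 D0; nia.
have jA : 0 <= j * (fA F + fB F) by clear -j0 A0 B0; nia.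
clearbody j c.
have eal : al F = D + be F by rewrite /D; ring.
clearbody D.
exists (Frame D (be F - j * D) (fA F + fB F) (fB F + j * (fA F + fB F))), c; split; split=> /=.
- split; first by split=> /=; ilia R.
  split=> /=.
  + by rewrite -hr eal; ring.
  + by exists (k1 - k2); rewrite (_ : D = al F - be F) ?mulrBr ?e1 ?e2; [ring|rewrite eal; ring].
  + exists (k2 - j * (k1 - k2)); rewrite (_ : b * (be F - j * D) = b * be F - j * (b * al F - b * be F));
      last by rewrite eal; ring.
    by rewrite e1 e2; ring.
  + by ilia R.
  + by ilia R.
- by split; [split|split] => /=; ilia R.
- by ilia R.
- by ilia R.
- have ep : p = be F - q by ilia R.
  by apply: rv3P; rewrite !vecE; congr (_%:~R); rewrite /gx /gy /gz /= ?ep ?eal; subst q; ring.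
- by ilia R.
- by move=> w; rewrite /wU /wV /wS /fU /fV /fS /= eal; ring.
Qed.

(** Two edges run along the line [fU + fV = be fS] and have the mark
    [fA + fB].  In the frame [F] there are an edge on [fU = p fS] and, if [fA]
    is not 0, one on [fV = q fS]; the edge in the neighbouring frame has the
    mark of [fV = q fS].  If [fA = 0], the edge on [fU = p fS] has that mark as
    well. *)
Lemma edges_outer_b v F p q : vertex r a v -> is_frame r%:Z a F -> 1 <= p -> 1 <= q ->
  p + q = be F -> be F < al F -> v (gv R F p q) ->
  four_edges (r:=r) a v (fA F + fB F)%:~R (a%:R * (q - be F)%:~R) /\ (fA F != 0 -> five_edges r a v).
Proof.
move=> vv fF p1 q1 epq ba vg.
have gn := gv_neq0 R r2 p q fF.
have [[a0 b0 A0 B0] [hr [k1 e1] [k2 e2] dA dB]] := fF.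
have Bn : fB F != 0 by apply/eqP => /dB; ilia R.
have ea := edge_at_spec r2 ar cra vv vg gn.
have cl p' q' : p' = p /\ q' = q - 1 \/ p' = p - 1 /\ q' = q -> is_cell F p' q'.
  by move=> h; split; [split|split]; ilia R.
have c1 : is_cell F (p - 1) q by apply: cl; right.
have c2 : is_cell F p (q - 1) by apply: cl; left.
have h1 := wallD_edge R r2 ar cra fF c1 ltac:(right; ilia R).
have h2 := wallD_edge R r2 ar cra fF c2 ltac:(right; ilia R).
have h3 := wallU_edge R r2 ar cra fF c2 Bn.
rewrite subrK in h1; rewrite subrK in h2; rewrite subrK in h3.
have q0 : 0 <= q by ilia R.
have qlt : q < be F by ilia R.
have [F' [c [[fF' cF' An' Bn'] [eg ec eU]]]] := neighbour_b fF Bn q0 qlt ba epq.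
have h5 := wallV_edge R r2 ar cra fF' cF' An'.
have pal : p <= al F by ilia R.
have qbe : q <= be F by ilia R.
pose E1 := @wallD R F (p - 1) q; pose E2 := @wallD R F p (q - 1); pose E3 := @wallU R F p (q - 1).
pose E5 := @wallV R F' 0 c.
have g5 : E5 (gv R F' (0 + 1) c) by case: h5.
have n5 p' q' u : ~ wall F p' q' u (gv R F' (0 + 1) c).
  move=> [/in_cellvE[_ _ _ h] _]; move: h.
  have : wU F' (gv R F' (0 + 1) c) = (r%:Z)%:~R by rewrite (wU_gv _ _ _ fF') add0r mul1r.
  by rewrite eU => e; move: rR; rewrite -e; lra.
have ne5 p' q' u : wall F p' q' u <> E5 by move=> e; apply: (n5 p' q' u); rewrite e.
have a1 : edge_at (r:=r) a v E1 (fA F + fB F)%:~R by apply: (ea _ _ _ _ h1); case: h1.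
have a2 : edge_at (r:=r) a v E2 (fA F + fB F)%:~R by apply: (ea _ _ _ _ h2); case: h2.
have a3 : edge_at (r:=r) a v E3 (a%:R * (al F - p)%:~R) by apply: (ea _ _ _ _ h3); case: h3.
have a5 : edge_at (r:=r) a v E5 (a%:R * (q - be F)%:~R).
  by rewrite -ec; apply: (ea _ _ _ _ h5); rewrite -eg; case: h5.
have [[_ _ _ g1 _] [_ _ g2 _ _] [_ _ g3 _ _]] := And3 h1 h2 h3.
have ne12 : E1 <> E2.
  by move=> e; move: g1; rewrite -/E1 e => -[/(gv_in_cellv_p r2 fF Bn) h _]; ilia R.
have ne13 : E1 <> E3 by move=> e; move: g1; rewrite -/E1 e => /(gv_wallU r2 fF pal); ilia R.
have ne23 : E2 <> E3 by move=> e; move: g2; rewrite -/E2 e => /(gv_wallU r2 fF pal); ilia R.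
have [A00|An] := eqVneq (fA F) 0.
  split=> //; exists E1, E2, E3, E5; split=> //; first by apply: uniq4 => //; exact: ne5.
  case: a3 => e3 m3; split=> // chi' /m3 ->.
  (* If [fA = 0], the first relation is a power of [y]. *)
  have W n : a%:R * n%:~R = wt r a (mono 0 n) by rewrite (wt_mono r2 ar) add0r.
  rewrite !W; apply/(wt_eq r2 ar); exists k1; rewrite !px_mono !pn_mono subrr add0r.
  rewrite (_ : al F - p - (q - be F) = al F); last by ilia R.
  by rewrite e1 A00 add0r.
have h4 := wallV_edge R r2 ar cra fF c1 An.
rewrite subrK in h4.
pose E4 := @wallV R F (p - 1) q.
have a4 : edge_at (r:=r) a v E4 (a%:R * (q - be F)%:~R) by apply: (ea _ _ _ _ h4); case: h4.
have ne14 : E1 <> E4 by move=> e; move: g1; rewrite -/E1 e => /(gv_wallV r2 fF qbe); ilia R.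
have ne24 : E2 <> E4 by move=> e; move: g2; rewrite -/E2 e => /(gv_wallV r2 fF qbe); ilia R.
have ne34 : E3 <> E4 by move=> e; move: g3; rewrite -/E3 e => /(gv_wallV r2 fF qbe); ilia R.
split.
  by exists E1, E2, E4, E5; split=> //; apply: uniq4 => //; exact: ne5.
move=> _; exists [:: E1; E2; E3; E4; E5].
  by apply: uniq5; [apply: uniq4|exact: ne5..].
split=> // E; rewrite !inE => h.
by case/or4P: h => [/eqP->|/eqP->|/eqP->|/orP[]/eqP->]; [case: a1|case: a2|case: a3|case: a4|case: a5].
Qed.

Lemma neighbour_a b F p q : is_frame r%:Z b F -> fA F != 0 -> 0 <= p -> p < al F ->
  al F < be F -> p + q = al F -> exists F' c,
  [/\ is_frame r%:Z b F', is_cell F' c 0, fA F' != 0 & fB F' != 0] /\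
  [/\ gv R F' c 0 = gv R F p q, al F' - c = al F - p &
      forall w, wV F' w = wU F w + wV F w - (al F)%:~R * wS w].
Proof.
move=> fF An p0 pa ab epq.
have [[a0 b0 A0 B0] [hr [k1 e1] [k2 e2] dA dB]] := fF.
pose D := be F - al F.
have D0 : 0 < D by rewrite /D; ilia R.
pose j := (p %/ D)%Z; pose c := (p %% D)%Z.
have hp : p = j * D + c := divz_eq p D.
have c0 : 0 <= c by apply: modz_ge0; ilia R.
have cD : c < D by apply: ltz_pmod.
have j0 : 0 <= j by rewrite divz_ge0.
have jD : 0 <= j * D by clear -j0 D0; nia.
have jA : 0 <= j * (fA F + fB F) by clear -j0 A0 B0; nia.
clearbody j c.
have ebe : be F = D + al F by rewrite /D; ring.
clearbody D.
exists (Frame (al F - j * D) D (fA F + j * (fA F + fB F)) (fA F + fB F)), c; split; split=> /=.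
- split; first by split=> /=; ilia R.
  split=> /=.
  + by rewrite -hr ebe; ring.
  + exists (k1 - j * (k2 - k1)); rewrite (_ : b * (al F - j * D) = b * al F - j * (b * be F - b * al F));
      last by rewrite ebe; ring.
    by rewrite e1 e2; ring.
  + by exists (k2 - k1); rewrite (_ : D = be F - al F) ?mulrBr ?e1 ?e2; [ring|rewrite ebe; ring].
  + by ilia R.
  + by ilia R.
- by split; [split|split] => /=; ilia R.
- by ilia R.
- by ilia R.
- have eq : q = al F - p by ilia R.
  by apply: rv3P; rewrite !vecE; congr (_%:~R); rewrite /gx /gy /gz /= ?eq ?ebe; subst p; ring.
- by ilia R.
- by move=> w; rewrite /wU /wV /wS /fU /fV /fS /= ebe; ring.
Qed.

(** The mirror image of [edges_outer_b]. *)
Lemma edges_outer_a v F p q : vertex r a v -> is_frame r%:Z a F -> 1 <= p -> 1 <= q ->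
  p + q = al F -> al F < be F -> v (gv R F p q) ->
  four_edges (r:=r) a v (fA F + fB F)%:~R (a%:R * (al F - p)%:~R) /\ (fB F != 0 -> five_edges r a v).
Proof.
move=> vv fF p1 q1 epq ab vg.
have gn := gv_neq0 R r2 p q fF.
have [[a0 b0 A0 B0] [hr [k1 e1] [k2 e2] dA dB]] := fF.
have An : fA F != 0 by apply/eqP => /dA; ilia R.
have ea := edge_at_spec r2 ar cra vv vg gn.
have cl p' q' : p' = p /\ q' = q - 1 \/ p' = p - 1 /\ q' = q -> is_cell F p' q'.
  by move=> h; split; [split|split]; ilia R.
have c1 : is_cell F (p - 1) q by apply: cl; right.
have c2 : is_cell F p (q - 1) by apply: cl; left.
have h1 := wallD_edge R r2 ar cra fF c1 ltac:(left; ilia R).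
have h2 := wallD_edge R r2 ar cra fF c2 ltac:(left; ilia R).
have h4 := wallV_edge R r2 ar cra fF c1 An.
rewrite subrK in h1; rewrite subrK in h2; rewrite subrK in h4.
have p0 : 0 <= p by ilia R.
have plt : p < al F by ilia R.
have [F' [c [[fF' cF' An' Bn'] [eg ec eV]]]] := neighbour_a fF An p0 plt ab epq.
have h5 := wallU_edge R r2 ar cra fF' cF' Bn'.
have pal : p <= al F by ilia R.
have qbe : q <= be F by ilia R.
pose E1 := @wallD R F (p - 1) q; pose E2 := @wallD R F p (q - 1); pose E4 := @wallV R F (p - 1) q.
pose E5 := @wallU R F' c 0.
have g5 : E5 (gv R F' c (0 + 1)) by case: h5.
have n5 p' q' u : ~ wall F p' q' u (gv R F' c (0 + 1)).
  move=> [/in_cellvE[_ _ h _] _]; move: h.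
  have : wV F' (gv R F' c (0 + 1)) = (r%:Z)%:~R by rewrite (wV_gv _ _ _ fF') add0r mul1r.
  by rewrite eV => e; move: rR; rewrite -e; lra.
have ne5 p' q' u : wall F p' q' u <> E5 by move=> e; apply: (n5 p' q' u); rewrite e.
have a1 : edge_at (r:=r) a v E1 (fA F + fB F)%:~R by apply: (ea _ _ _ _ h1); case: h1.
have a2 : edge_at (r:=r) a v E2 (fA F + fB F)%:~R by apply: (ea _ _ _ _ h2); case: h2.
have a4 : edge_at (r:=r) a v E4 (a%:R * (q - be F)%:~R) by apply: (ea _ _ _ _ h4); case: h4.
have a5 : edge_at (r:=r) a v E5 (a%:R * (al F - p)%:~R).
  by rewrite -ec; apply: (ea _ _ _ _ h5); rewrite -eg; case: h5.
have [[_ _ _ g1 _] [_ _ g2 _ _] [_ _ g4 _ _]] := And3 h1 h2 h4.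
have ne12 : E1 <> E2.
  by move=> e; move: g1; rewrite -/E1 e => -[/(gv_in_cellv_q r2 fF An) h _]; ilia R.
have ne14 : E1 <> E4 by move=> e; move: g1; rewrite -/E1 e => /(gv_wallV r2 fF qbe); ilia R.
have ne24 : E2 <> E4 by move=> e; move: g2; rewrite -/E2 e => /(gv_wallV r2 fF qbe); ilia R.
have [B00|Bn] := eqVneq (fB F) 0.
  split=> //; exists E1, E2, E4, E5; split=> //; first by apply: uniq4 => //; exact: ne5.
  case: a4 => e4 m4; split=> // chi' /m4 ->.
  have W n : a%:R * n%:~R = wt r a (mono 0 n) by rewrite (wt_mono r2 ar) add0r.
  rewrite !W; apply/(wt_eq r2 ar); exists (- k2); rewrite !px_mono !pn_mono subrr add0r.
  rewrite (_ : q - be F - (al F - p) = - be F); last by ilia R.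
  by rewrite mulrN e2 B00 oppr0 add0r mulNr.
have h3 := wallU_edge R r2 ar cra fF c2 Bn.
rewrite subrK in h3.
pose E3 := @wallU R F p (q - 1).
have [_ _ g3 _ _] := h3.
have a3 : edge_at (r:=r) a v E3 (a%:R * (al F - p)%:~R) by apply: (ea _ _ _ _ h3); case: h3.
have ne13 : E1 <> E3 by move=> e; move: g1; rewrite -/E1 e => /(gv_wallU r2 fF pal); ilia R.
have ne23 : E2 <> E3 by move=> e; move: g2; rewrite -/E2 e => /(gv_wallU r2 fF pal); ilia R.
have ne34 : E3 <> E4 by move=> e; move: g3; rewrite -/E3 e => /(gv_wallV r2 fF qbe); ilia R.
split.
  by exists E1, E2, E3, E5; split=> //; apply: uniq4 => //; exact: ne5.
move=> _; exists [:: E1; E2; E3; E4; E5].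
  by apply: uniq5; [apply: uniq4|exact: ne5..].
split=> // E; rewrite !inE => h.
by case/or4P: h => [/eqP->|/eqP->|/eqP->|/orP[]/eqP->]; [case: a1|case: a2|case: a3|case: a4|case: a5].
Qed.

End Outer.

(** * Marks and valleys at a vertex *)

Lemma uniq4P (T : eqType) (x1 x2 x3 x4 : T) : uniq [:: x1; x2; x3; x4] ->
  x1 <> x2 /\ x1 <> x3 /\ x1 <> x4 /\ x2 <> x3 /\ x2 <> x4 /\ x3 <> x4.
Proof.
rewrite /= !inE !negb_or -!andbA => /and4P[/eqP ? /eqP ? /eqP ? /and4P[/eqP ? /eqP ? /eqP ? _]].
by [].
Qed.

(** A [y]-valley is the step from the rows of width [fA + fB] to those of width
    [fB]. *)
Lemma in_graph_yvalley F p q (m n : nat) : is_cell F p q ->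
  in_graph F p q m%:Z n%:Z -> in_graph F p q m.+1%:Z n%:Z -> in_graph F p q m%:Z n.+1%:Z ->
  ~ in_graph F p q m.+1%:Z n.+1%:Z -> [/\ m.+1%:Z = fB F, n%:Z = q & p + q + 2 <= al F].
Proof.
move=> [[p0 q0 _ _] _] _ [_ _ _ [_ h2 h3]] [_ k1 k2 [_ _ k3]] ng.
have pn : - p <= n%:Z by lia.
have pn' : (n.+1%:Z < - p) = false by lia.
have nq : q < n.+1%:Z.
  rewrite ltNge; apply/negP => h; apply: ng.
  have h4 : m.+1%:Z < fA F + fB F by apply: h2 => //; clear -h; lia.
  by split=> //; split=> // hh; [rewrite pn' in hh|move: hh; rewrite ltNge h].
have k4 := k3 nq.
have nB : fB F <= m.+1%:Z.
  rewrite leNgt; apply/negP => h; apply: ng; split=> //; split=> //; first by rewrite pn'.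
  by move=> _; rewrite leNgt nq.
have nq' : n%:Z <= q by rewrite leNgt; apply/negP => /h3; clear -nB; lia.
by clear -nq nq' nB k4 k2; split; lia.
Qed.

Lemma in_graph_x F p q (k : nat) : is_cell F p q -> in_graph F p q k%:Z 0 <-> k%:Z < fA F + fB F.
Proof.
move=> [[p0 q0 pa pb] _]; split=> [[_ _ _ [_ h _]]|h]; first by apply: h; lia.
by clear -h p0 q0 pa pb; split; [lia..|split; lia].
Qed.

Lemma in_graph_y F p q (k : nat) : is_cell F p q -> 0 < fA F -> 0 < fB F ->
  in_graph F p q 0 k%:Z <-> k%:Z < al F - p.
Proof.
move=> [[p0 q0 pa pb] _] A1 B1; split=> [[_ _ h _]|h]; first by lia.
by clear -h p0 q0 pa pb A1 B1; split; [lia..|split; lia].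
Qed.

Lemma least_notinE (Gam : set 'rV[int]_3) pw (n : nat) (N : int) :
  ~ Gam (pw n) -> (forall k, (k < n)%N -> Gam (pw k)) -> 0 <= N ->
  (forall k : nat, Gam (pw k) <-> k%:Z < N) -> n%:Z = N.
Proof.
move=> h1 h2 N0 h; apply/eqP; rewrite eq_le; apply/andP; split.
  have [M eM] : exists M : nat, M%:Z = N by exists `|N|%N; clear -N0; lia.
  rewrite leNgt; apply/negP => Nn; have lt : (M < n)%N by clear -eM Nn; lia.
  by have /h := h2 _ lt; rewrite eM ltxx.
by rewrite leNgt; apply/negP => /h.
Qed.

Lemma mon_mono i j : mon i j 0 = mono i%:Z j%:Z.
Proof. by apply: rv3P; rewrite !vecE monE; clear; lia. Qed.

Lemma mon_monoN i k : mon i 0 k = mono i%:Z (- k%:Z).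
Proof. by apply: rv3P; rewrite !vecE monE; clear; lia. Qed.

Section Cases.
Variables (R : realType) (r a : nat).
Hypothesis r2 : (1 < r)%N.
Hypothesis ar : (a < r)%N.
Hypothesis cra : coprime r a.
Implicit Types (w g : 'rV[R]_3) (F : frame) (tau sig v E : set 'rV[R]_3).

Let r0 : 0 < r%:Z. Proof. by clear -r2; lia. Qed.
Let r2' : 1 < r%:Z. Proof. by clear -r2; lia. Qed.
Let rR : 0 < (r%:Z)%:~R :> R. Proof. by rewrite ltr0z. Qed.

Lemma four_edges_valency3 v c1 c2 : four_edges (r:=r) a v c1 c2 -> valency r a v 3 -> False.
Proof.
move=> [E1 [E2 [E3 [E4 [u [e1 _] [e2 _] [e3 _] [e4 _]]]]]] v3.
suff : (size [:: E1; E2; E3; E4] <= 3)%N by [].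
apply: (valency_ge v3 u) => E; rewrite !inE.
by case/or4P => /eqP ->.
Qed.

Lemma five_edges_valency4 v : five_edges r a v -> valency r a v 4 -> False.
Proof.
by move=> [s us [ss hs]] v4; have := valency_ge v4 us hs; rewrite ss.
Qed.

(** The mark of the fifth edge occurs only once, so that the two repeated marks
    are those of the four known edges. *)
Lemma four_edges_SC5 v c1 c2 chi : four_edges (r:=r) a v c1 c2 -> SC_valency5 a v chi -> chi = c1 + c2.
Proof.
move=> [E1 [E2 [E3 [E4 [u a1 a2 a3 a4]]]]].
move=> [t1 [t2 [t3 [t4 [t5 [l [m [n [[ev [ml1 ml2] [mm3 mm4] mn] [lm nl nm ->]]]]]]]]]].
have key E c : edge_at (r:=r) a v E c ->
    [\/ c = l /\ (E = t1 \/ E = t2), c = m /\ (E = t3 \/ E = t4) | c = n /\ E = t5].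
  move=> [+ mk]; rewrite ev => -[[[[|]|]|]|] /= e; subst E.
  - by apply: Or31; split; [rewrite -(mk l)|left].
  - by apply: Or31; split; [rewrite -(mk l)|right].
  - by apply: Or32; split; [rewrite -(mk m)|left].
  - by apply: Or32; split; [rewrite -(mk m)|right].
  - by apply: Or33; split; [rewrite -(mk n)|].
have [n12 [n13 [n14 [n23 [n24 n34]]]]] := uniq4P u.
have k1 := key _ _ a1; have k2 := key _ _ a2; have k3 := key _ _ a3; have k4 := key _ _ a4.
have h1 : c1 = l \/ c1 = m.
  case: k1 => [[-> _]|[-> _]|[e e1]]; [by left|by right|].
  by case: k2 => [[e' _]|[e' _]|[_ e2]]; exfalso; [apply: nl|apply: nm|apply: n12]; congruence.
have h2 : c2 = l \/ c2 = m.
  case: k3 => [[-> _]|[-> _]|[e e1]]; [by left|by right|].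
  by case: k4 => [[e' _]|[e' _]|[_ e2]]; exfalso; [apply: nl|apply: nm|apply: n34]; congruence.
have ne : c1 <> c2.
  move=> e; subst c2; case: h1 => e; subst c1.
    have f c x : [\/ l = l /\ (x = t1 \/ x = t2), l = m /\ c | l = n /\ x = t5] -> x = t1 \/ x = t2.
      by case=> [[_ //]|[/lm //]|[/esym/nl //]].
    by move: (f _ _ k1) (f _ _ k2) (f _ _ k3); intuition congruence.
  have f c x : [\/ m = l /\ c, m = m /\ (x = t3 \/ x = t4) | m = n /\ x = t5] -> x = t3 \/ x = t4.
    by case=> [[/esym/lm //]|[_ //]|[/esym/nm //]].
  by move: (f _ _ k1) (f _ _ k2) (f _ _ k3); intuition congruence.
case: h1 => f1; case: h2 => f2.
- by case: ne; rewrite f1 f2.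
- by rewrite f1 f2.
- by rewrite f1 f2 addrC.
- by case: ne; rewrite f1 f2.
Qed.

(** The difference of the two relations. *)
Lemma Zr_frame F : is_frame r%:Z a F -> (fA F + fB F)%:~R = a%:R * (al F - be F)%:~R :> 'Z_r.
Proof.
move=> [_ [_ [k1 e1] [k2 e2] _ _]].
have -> : a%:R * (al F - be F)%:~R = wt r a (mono 0 (al F - be F)) by rewrite (wt_mono r2 ar) add0r.
have -> : (fA F + fB F)%:~R = wt r a (mono (fA F + fB F) 0) by rewrite (wt_mono r2 ar) mulr0 addr0.
by apply/(wt_eq r2 ar); exists (k2 - k1); rewrite !px_mono !pn_mono subr0 sub0r mulrN mulrBr e1 e2; ring.
Qed.

Lemma mul_intD (n m : int) : a%:R * n%:~R + a%:R * m%:~R = a%:R * (n + m)%:~R :> 'Z_r.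
Proof. by rewrite intrD mulrDr. Qed.

(** If [al = be] then [(fA + fB, 0)] is a relation, hence [fA + fB >= r]. *)
Lemma frame_al_be F : is_frame r%:Z a F -> 2 <= al F -> al F <> be F.
Proof.
move=> [[a0 b0 A0 B0] [hr [k1 e1] [k2 e2] _ _]] a2 ab.
have e : al F * (fA F + fB F) = r%:Z by rewrite -hr -ab; ring.
have e' : fA F + fB F = (k2 - k1) * r%:Z.
  have : a%:Z * al F = a%:Z * be F by rewrite ab.
  by rewrite e1 e2 => h; rewrite mulrBl; clear -h; lia.
have AB : 0 < fA F + fB F by clear -e A0 B0 r0 a0; nia.
have := multiple_ge r2' e' AB; clear -e a2 AB.
by nia.
Qed.

Definition inner_vtx F (p q : int) := [/\ p + q < al F, p + q < be F, fA F != 0 & fB F != 0].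
Definition outer_vtx_b F (p q : int) := p + q = be F /\ be F < al F.
Definition outer_vtx_a F (p q : int) := p + q = al F /\ al F < be F.

Lemma vtx_types F p q : is_frame r%:Z a F -> is_vtx F p q ->
  [\/ inner_vtx F p q, outer_vtx_b F p q | outer_vtx_a F p q].
Proof.
move=> fF [[p1 q1 pa pb] [cA cB]].
have ne := frame_al_be fF.
have [e1|n1] := eqVneq (p + q) (be F).
  by apply: Or32; split=> //; rewrite lt_neqAle; apply/andP;
    split; [apply/eqP => e; apply: ne => //|]; ilia R.
have [e2|n2] := eqVneq (p + q) (al F).
  by apply: Or33; split=> //; rewrite lt_neqAle; apply/andP;
    split; [apply/eqP => e; apply: ne => //|]; ilia R.
apply: Or31; split; [ilia R|ilia R|apply/eqP => /cA e|apply/eqP => /cB e].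
  by rewrite e eqxx in n1.
by rewrite e eqxx in n2.
Qed.

(** On the lines [p + q = be] and [p + q = al] there would be five edges. *)
Lemma rigid_planar v F p q chi : vertex r a v -> is_frame r%:Z a F -> is_vtx F p q ->
  fA F != 0 -> fB F != 0 -> v (gv R F p q) -> valency r a v 4 ->
  (chi = a%:R * (al F - be F + q)%:~R \/ chi = a%:R * (al F - be F - p)%:~R) -> rigid (r:=r) a v chi.
Proof.
move=> vv fF vF An Bn vg v4 hchi.
have [[p1 q1 pa pb] _] := vF.
case: (vtx_types fF vF) => [[h1 h2 _ _]|[h1 h2]|[h1 h2]].
- have gd n : n = al F - be F + q \/ n = al F - be F - p -> good_row F p q n.
    by move=> h; split; ilia R.
  by case: hchi => e; apply: (rigid_vtx r2 ar cra vv fF vF vg (gd _ _) e); [left|right].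
- have [_ /(_ An) f] := edges_outer_b r2 ar cra vv fF p1 q1 h1 h2 vg.
  by case: (five_edges_valency4 f v4).
- have [_ /(_ Bn) f] := edges_outer_a r2 ar cra vv fF p1 q1 h1 h2 vg.
  by case: (five_edges_valency4 f v4).
Qed.

(** The valleys determine the widths and the heights of the frame, and the two
    walls meet in the grid point [(p + 1, q + 1)]. *)
Lemma SC3_rigid v chi : vertex r a v -> valency r a v 4 -> SC_two_lines a v chi -> rigid (r:=r) a v chi.
Proof.
move=> vv v4 [Gam [kx [ky [jx [jz [ix [jy [kz [t1 [t2]]]]]]]]]].
move=> [[gG _ vG] [[[y1 y2 y3 y4] [z1 z2 z3 z4] [ix1 ix2] [jy1 jy2] [kz1 kz2]]]].
move=> [[ft1 dt1 vt1 [_ _ _ _ d1]] [[ft2 dt2 vt2 [_ _ _ _ d2]] hchi]].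
have [F [p [q [fF cF eG]]]] := Ggraph_classify r2 ar cra gG; subst Gam.
have [[p0 q0 pa pb] [cA cB]] := cF.
have [[a0 b0 A0 B0] [hr [k1 e1] [k2 e2] _ _]] := fF.
have AB : 0 < fA F + fB F by clear -hr r0 A0 B0 a0 b0; nia.
rewrite !mon_mono in y1 y2 y3 y4; rewrite !mon_monoN in z1 z2 z3 z4.
have ngraph_of i n : ~ graph_of F p q (mono i n) -> ~ in_graph F p q i n by move=> h /graph_of_mono.
have [ekx eky qJ] := in_graph_yvalley cF (proj1 (graph_of_mono _ _ _ _ _) y1)
  (proj1 (graph_of_mono _ _ _ _ _) y2)
  (proj1 (graph_of_mono _ _ _ _ _) y3) (ngraph_of _ _ y4).
have [ejx ejz pK] : [/\ jx.+1%:Z = fA F, jz%:Z = p & p + q + 2 <= be F].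
  have z1' := in_graph_swap (proj1 (graph_of_mono _ _ _ _ _) z1).
  have z2' := in_graph_swap (proj1 (graph_of_mono _ _ _ _ _) z2).
  have z3' := in_graph_swap (proj1 (graph_of_mono _ _ _ _ _) z3).
  have z4' : ~ in_graph (fswap F) q p jx.+1%:Z jz.+1%:Z.
    move=> /in_graph_swap h; apply: (ngraph_of _ _ z4).
    by case: (F) h.
  rewrite !opprK in z1' z2' z3'.
  by have [? ? ?] := in_graph_yvalley (is_cell_swap cF) z1' z2' z3' z4'; split=> //; rewrite [p + q]addrC.
have A1 : 0 < fA F by rewrite -ejx.
have B1 : 0 < fB F by rewrite -ekx.
have An : fA F != 0 by rewrite gt_eqF.
have Bn : fB F != 0 by rewrite gt_eqF.
have eix : ix%:Z = fA F + fB F.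
  apply: (least_notinE (pw := fun n => mon n 0 0) ix1 ix2) => [|k]; first by ilia R.
  by rewrite mon_mono graph_of_mono in_graph_x.
have ejy : jy%:Z = al F - p.
  apply: (least_notinE (pw := fun n => mon 0 n 0) jy1 jy2) => [|k]; first by ilia R.
  by rewrite mon_mono graph_of_mono in_graph_y.
have ekz : kz%:Z = be F - q.
  apply: (least_notinE (pw := fun n => mon 0 0 n) kz1 kz2) => [|k]; first by ilia R.
  rewrite mon_monoN graph_of_mono; split=> [/in_graph_swap|h].
    by rewrite opprK => /(in_graph_y k (is_cell_swap cF) B1 A1).
  have := in_graph_swap (proj2 (in_graph_y k (is_cell_swap cF) B1 A1) h).
  by case: (F).
clear y1 y2 y3 y4 z1 z2 z3 z4 ix1 ix2 jy1 jy2 kz1 kz2 ngraph_of.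
have vF : is_vtx F (p + 1) (q + 1) by split; [split|split]; ilia R.
have [w vw wn] : exists2 w, v w & w != 0 by case: vv => _ dv _; apply: cone_dim1_neq0 dv.
have eU : wU F w = (p + 1)%:~R * wS w.
  have := d1 _ (vt1 _ vw); rewrite dotB !dotE !monE.
  have -> : (jy.-1%:Z) = al F - p - 1 by ilia R.
  rewrite ejx (_ : jz.+1%:Z = p + 1); last by ilia R.
  move=> h; apply/eqP; rewrite -subr_eq0; apply/eqP; rewrite -[RHS]h.
  by rewrite /wU /wS /fU /fS; ring.
have eV : wV F w = (q + 1)%:~R * wS w.
  have := d2 _ (vt2 _ vw); rewrite dotB !dotE !monE.
  have -> : (kz.-1%:Z) = be F - q - 1 by ilia R.
  rewrite ekx (_ : ky.+1%:Z = q + 1); last by ilia R.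
  move=> h; apply/eqP; rewrite -subr_eq0; apply/eqP; rewrite -[RHS]h.
  by rewrite /wV /wS /fV /fS; ring.
have rn : (r%:Z)%:~R != 0 :> R by rewrite gt_eqF.
have eg : (r%:Z)%:~R *: w = wS w *: gv R F (p + 1) (q + 1).
  apply: (coord_eq r2 fF); rewrite !wE ?(wS_gv _ _ _ fF) ?(wU_gv _ _ _ fF) ?(wV_gv _ _ _ fF) ?eU ?eV; ring.
have [x0 y0 z0] := vertex_ge0 r2 ar cra vv vw.
have S0 : 0 <= wS w by apply: addr_ge0.
have Sn : wS w != 0.
  apply: contra_neq wn => e; move/eqP: eg; rewrite e scale0r scaler_eq0 (negbTE rn) /=.
  by move/eqP.
have vg : v (gv R F (p + 1) (q + 1)).
  have -> : gv R F (p + 1) (q + 1) = ((wS w)^-1 * (r%:Z)%:~R) *: w.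
    by rewrite -scalerA eg scalerA mulVf // scale1r.
  have [[Gam' _ fv] _ _] := vv.
  by apply: (face_scale fv) => //; apply: mulr_ge0; [rewrite invr_ge0|exact: ltW].
apply: (rigid_planar vv fF vF An Bn vg v4).
case: hchi => ->; [left|right]; rewrite ?mon_mono ?mon_monoN (wt_mono r2 ar) eix (Zr_frame fF) mul_intD;
  congr (_ * _%:~R); ilia R.
Qed.

End Cases.

(** * The triple point *)

Section Triple.
Variables (R : realType) (r a : nat).
Hypothesis r2 : (1 < r)%N.
Implicit Types (w g h : 'rV[R]_3) (F : frame) (tau sig v E : set 'rV[R]_3).

(** The linear form defining the face is non-negative at [h1] and [h2].  If it
    vanished at both of them the face would have dimension 3, if at none it
    would be the ray of [g]. *)
Lemma face2 Gam tau g h1 h2 (f1 f2 : 'rV[R]_3 -> R) (k : R) :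
  face tau (sigma R r a Gam) -> cone_dim tau 2 -> tau g ->
  sigma R r a Gam h1 -> sigma R r a Gam h2 -> 0 < k ->
  (forall s t u : R, s *: g + t *: h1 + u *: h2 = 0 -> [/\ s = 0, t = 0 & u = 0]) ->
  (forall w, sigma R r a Gam w -> [/\ 0 <= f1 w, 0 <= f2 w &
     exists s, k *: w = s *: g + f1 w *: h1 + f2 w *: h2]) ->
  tau = [set w | sigma R r a Gam w /\ f1 w = 0]%classic \/
  tau = [set w | sigma R r a Gam w /\ f2 w = 0]%classic.
Proof.
move=> [c c0 et] [B [rB tB sB]] tg s1 s2 k0 ind dec.
pose sp (x : 'rV[R]_3) := (x *m c^T) 0 0.
have spD x y : sp (x + y) = sp x + sp y by rewrite /sp mulmxDl mxE.
have spZ x y : sp (x *: y) = x * sp y by rewrite /sp -scalemxAl mxE.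
have tE w : tau w <-> sigma R r a Gam w /\ sp w = 0.
  rewrite et; split=> -[sw h]; split=> //.
    by move: h; rewrite /plane /= /sp => ->; rewrite mxE.
  by apply/matrixP => i j; rewrite !ord1 [RHS]mxE; exact: h.
have spg : sp g = 0 by case/tE: tg.
have kn : k != 0 by rewrite gt_eqF.
have spw w : sigma R r a Gam w -> k * sp w = f1 w * sp h1 + f2 w * sp h2.
  move=> /dec[_ _ [s e]]; rewrite -spZ e !spD !spZ spg; ring.
have [c1 c2] := (c0 _ s1, c0 _ s2); rewrite -/(sp _) in c1; rewrite -/(sp _) in c2.
have [e1|n1] := eqVneq (sp h1) 0; have [e2|n2] := eqVneq (sp h2) 0.
- exfalso.
  have th1 : tau h1 by apply/tE.
  have th2 : tau h2 by apply/tE.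
  pose G : 'M[R]_(3, 3) := \matrix_(i < 3) nth 0 [:: g; h1; h2] i.
  have GB : (G <= B)%MS.
    apply/row_subP => i; rewrite rowK; apply: sB.
    by case: i => [[|[|[|//]]] hi].
  have freeG : row_free G.
    rewrite -kermx_eq0; apply/rowV0P => x /sub_kermxP.
    have -> : x *m G = x 0 o0 *: g + x 0 o1 *: h1 + x 0 o2 *: h2.
      by rewrite mulmx_sum_row sum3 !rowK.
    by move/ind => [? ? ?]; apply: rv3P; rewrite mxE.
  by have := mxrankS GB; move: rB freeG; rewrite /row_free => /eqP -> /eqP ->.
- have p2 : 0 < sp h2 by rewrite lt0r n2.
  right; apply/seteqP; split=> w.
    move=> /tE[sw h]; split=> //; have := spw _ sw.
    by rewrite h e1 !mulr0 add0r => /esym/eqP; rewrite mulf_eq0 (negbTE n2) orbF => /eqP.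
  move=> [sw h]; apply/tE; split=> //; have := spw _ sw.
  by rewrite h e1 mulr0 mul0r addr0 => /eqP; rewrite mulf_eq0 (negbTE kn) => /eqP.
- have p1 : 0 < sp h1 by rewrite lt0r n1.
  left; apply/seteqP; split=> w.
    move=> /tE[sw h]; split=> //; have := spw _ sw.
    by rewrite h e2 !mulr0 addr0 => /esym/eqP; rewrite mulf_eq0 (negbTE n1) orbF => /eqP.
  move=> [sw h]; apply/tE; split=> //; have := spw _ sw.
  by rewrite h e2 mulr0 mul0r addr0 => /eqP; rewrite mulf_eq0 (negbTE kn) => /eqP.
- exfalso.
  have p1 : 0 < sp h1 by rewrite lt0r n1.
  have p2 : 0 < sp h2 by rewrite lt0r n2.
  have Bg : (B <= g)%MS.
    apply/row_subP => i; have /tE [sw h] := tB i.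
    have [f10 f20 [s e]] := dec _ sw; have := spw _ sw; rewrite h mulr0 => e0.
    have m1 : 0 <= f1 (row i B) * sp h1 by rewrite mulr_ge0.
    have m2 : 0 <= f2 (row i B) * sp h2 by rewrite mulr_ge0.
    have z1 : f1 (row i B) * sp h1 = 0 by lra.
    have z2 : f2 (row i B) * sp h2 = 0 by lra.
    move/eqP: z1; rewrite mulf_eq0 (negbTE n1) orbF => /eqP z1.
    move/eqP: z2; rewrite mulf_eq0 (negbTE n2) orbF => /eqP z2.
    have -> : row i B = (k^-1 * s) *: g.
      by rewrite -scalerA; apply: (scalerI kn); rewrite e z1 z2 !scale0r !addr0 [RHS]scalerA mulfV // scale1r.
    exact: scalemx_sub.
  have := leq_trans (mxrankS Bg) (rank_leq_row g).
  by move: rB; rewrite /row_free => /eqP ->.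
Qed.

End Triple.

Section TripleEdges.
Variables (R : realType) (r a : nat).
Hypothesis r2 : (1 < r)%N.
Hypothesis ar : (a < r)%N.
Hypothesis cra : coprime r a.
Implicit Types (w g h : 'rV[R]_3) (F : frame) (tau sig v E : set 'rV[R]_3).

Let r0 : 0 < r%:Z. Proof. by clear -r2; lia. Qed.
Let r2' : 1 < r%:Z. Proof. by clear -r2; lia. Qed.

(** The frames of the cells that have an edge from [e_1] to the triple point of
    [F]. *)
Definition degY F := Frame r%:Z (be F) 0 1.
Definition degZ F := Frame (al F) r%:Z 1 0.

Lemma frame_eq F F' : al F = al F' -> be F = be F' -> fA F = fA F' -> fB F = fB F' -> F = F'.
Proof. by case: F F' => [? ? ? ?] [? ? ? ?] /= -> -> -> ->. Qed.

Lemma frame_uniq (x y c k l : int) : 0 < x -> x < r%:Z -> 0 < y -> y < r%:Z ->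
  a%:Z * x = c + k * r%:Z -> a%:Z * y = c + l * r%:Z -> x = y.
Proof.
move=> x0 xr y0 yr ex ey.
have e : a%:Z * (x - y) = (k - l) * r%:Z by rewrite mulrBr ex ey; ring.
have [m em] := dvd_unit (inv_a r2 ar cra) e.
have m0 : m = 0.
  clear -x0 xr y0 yr em r0.
  have h1 : m < 1 by nia.
  have h2 : -1 < m by nia.
  lia.
by clear -em m0; rewrite m0 mul0r in em; lia.
Qed.

Lemma deg_frame F : is_frame r%:Z a F -> fA F = 0 -> al F = r%:Z /\ fB F = 1.
Proof.
move=> [[a0 b0 A0 B0] [hr [k1 e1] [k2 e2] dA dB]] A00.
rewrite A00 add0r in e1; have [k e] := dvd_unit (inv_a r2 ar cra) e1.
have ra := multiple_ge r2' e a0; rewrite A00 mulr0 addr0 in hr.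
clear -hr ra r0 B0 a0.
have B1 : 0 < fB F by nia.
have B2 : fB F < 2 by nia.
have B3 : fB F = 1 by lia.
by rewrite B3 mulr1 in hr.
Qed.

Lemma deg_frame_swap F : is_frame r%:Z a F -> fB F = 0 -> be F = r%:Z /\ fA F = 1.
Proof.
move=> [[a0 b0 A0 B0] [hr [k1 e1] [k2 e2] dA dB]] B00.
rewrite B00 oppr0 add0r in e2; have [k e] := dvd_unit (inv_a r2 ar cra) e2.
have ra := multiple_ge r2' e b0; rewrite B00 mulr0 add0r in hr.
clear -hr ra r0 A0 b0.
have B1 : 0 < fA F by nia.
have B2 : fA F < 2 by nia.
have B3 : fA F = 1 by lia.
by rewrite B3 mulr1 in hr.
Qed.

(** The inequalities of the cell at the triple point give [fA' fB' r <= r] for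
    a frame [F'] with widths [fA'] and [fB']; so both are 1, or one is 0. *)
Lemma triple_graphs F F' p q : is_frame r%:Z a F -> fA F = 1 -> fB F = 1 ->
  is_frame r%:Z a F' -> is_cell F' p q -> in_cellv F' p q (gv R F 0 0) ->
  [\/ [/\ F' = F, p = 0 & q = 0], [/\ F' = degY F, p = be F - 1 & q = 0] |
      [/\ F' = degZ F, p = 0 & q = al F - 1]].
Proof.
move=> fF A1 B1 fF' cF' /in_cellvE[cU cV _ _].
have [[a0 b0 _ _] [hr [k1 e1] [k2 e2] _ _]] := fF.
have [[a0' b0' A0 B0] [hr' [k1' e1'] [k2' e2'] dA dB]] := fF'.
have [[p0 q0 pa pb] [cA cB]] := cF'.
rewrite A1 B1 !mulr1 in hr.
have eS := wS_gv R 0 0 fF.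
have eU : wU F' (gv R F 0 0) = (be F * (al F' - fA F' * al F))%:~R.
  by rewrite /wU /fU !vecE /gx /gy A1 B1 -!intrM -intrB; congr (_%:~R); ring.
have eV : wV F' (gv R F 0 0) = (al F * (be F' - fB F' * be F))%:~R.
  by rewrite /wV /fV !vecE /gx /gz A1 B1 -!intrM -intrB; congr (_%:~R); ring.
rewrite eS eU -!intrM !ler_int in cU; rewrite eS eV -!intrM !ler_int in cV.
clear eS eU eV.
have [A00|An] := eqVneq (fA F') 0.
  have [ea eB] := deg_frame fF' A00.
  have ebe : be F' = be F.
    by apply: (frame_uniq (c := -1) (k := k2') (l := k2)); rewrite ?e2 ?e2' ?B1 ?eB //;
      [rewrite -ea; exact: dA|clear -hr a0; lia].
  have epq := cA A00.
  have /andP[u1 u2] := cU (ltac:(by rewrite eB)).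
  rewrite A00 mul0r subr0 ea in u1 u2.
  apply: Or32; split.
  - by apply: frame_eq.
  - by clear -u1 u2 epq q0 ebe r0; nia.
  - by clear -u1 u2 epq q0 ebe r0; nia.
have [B00|Bn] := eqVneq (fB F') 0.
  have [eb eA] := deg_frame_swap fF' B00.
  have eal : al F' = al F.
    by apply: (frame_uniq (c := 1) (k := k1') (l := k1)); rewrite ?e1 ?e1' ?A1 ?eA //;
      [rewrite -eb; exact: dB|clear -hr b0; lia].
  have epq := cB B00.
  have /andP[u1 u2] := cV An.
  rewrite B00 mul0r subr0 eb in u1 u2.
  apply: Or33; split.
  - by apply: frame_eq.
  - by clear -u1 u2 epq p0 eal r0; nia.
  - by clear -u1 u2 epq p0 eal r0; nia.
have /andP[u1 _] := cU Bn; have /andP[v1 _] := cV An.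
have A1' : 1 <= fA F' by clear -An A0; lia.
have B1' : 1 <= fB F' by clear -Bn B0; lia.
have ga : fA F' * al F <= al F'.
  have h : 0 <= be F * (al F' - fA F' * al F).
    by apply: le_trans u1; rewrite mulr_ge0 // ltW.
  by move: h; rewrite pmulr_rge0 // subr_ge0.
have gb : fB F' * be F <= be F'.
  have h : 0 <= al F * (be F' - fB F' * be F).
    by apply: le_trans v1; rewrite mulr_ge0 // ltW.
  by move: h; rewrite pmulr_rge0 // subr_ge0.
have h1 : fA F' * al F * fB F' <= al F' * fB F' by rewrite ler_wpM2r.
have h2 : fB F' * be F * fA F' <= be F' * fA F' by rewrite ler_wpM2r.
have h3 : fA F' * fB F' * r%:Z <= r%:Z.
  by rewrite -[X in _ <= X]hr' -hr; clear -h1 h2; lia.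
have AB : fA F' * fB F' <= 1.
  by rewrite -(ler_pM2r r0) mul1r.
have eA : fA F' = 1 by clear -A1' B1' AB; nia.
have eB : fB F' = 1 by clear -A1' B1' AB; nia.
rewrite eA eB ?mul1r ?mulr1 in ga gb hr' u1 v1.
have ea : al F' = al F by clear -ga gb hr hr'; lia.
have eb : be F' = be F by clear -ga gb hr hr'; lia.
rewrite ea subrr mulr0 in u1; rewrite eb subrr mulr0 in v1.
apply: Or31; split.
- by apply: frame_eq; rewrite ?A1 ?B1.
- by clear -u1 p0 r0; nia.
- by clear -v1 q0 r0; nia.
Qed.

Section AtTriple.
Variable F : frame.
Hypothesis fF : is_frame r%:Z a F.
Hypothesis A1 : fA F = 1.
Hypothesis B1 : fB F = 1.

Let hr : al F + be F = r%:Z.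
Proof. by case: fF => _ [+ _ _ _ _]; rewrite A1 B1 !mulr1. Qed.

Lemma degY_is_frame : is_frame r%:Z a (degY F).
Proof.
have [[a0 b0 _ _] [_ [k1 e1] [k2 e2] _ _]] := fF.
split; first by split=> //=.
split=> //=; first by rewrite mulr0 mulr1 addr0.
- by exists a%:Z; ring.
- by exists k2; rewrite e2 B1.
- by move=> _; clear -hr a0; lia.
Qed.

Lemma degZ_is_frame : is_frame r%:Z a (degZ F).
Proof.
have [[a0 b0 _ _] [_ [k1 e1] [k2 e2] _ _]] := fF.
split; first by split=> //=.
split=> //=; first by rewrite mulr0 mulr1 add0r.
- by exists k1; rewrite e1 A1.
- by exists a%:Z; ring.
- by move=> _; clear -hr b0; lia.
Qed.

Lemma indep3 (g h1 h2 : 'rV[R]_3) (f1 f2 f3 : 'rV[R]_3 -> R) :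
  (forall f, f = f1 \/ f = f2 \/ f = f3 ->
    (forall x y, f (x + y) = f x + f y) /\ (forall t x, f (t *: x) = t * f x)) ->
  f1 g != 0 -> f2 h1 != 0 -> f3 h2 != 0 -> f2 g = 0 -> f2 h2 = 0 -> f3 g = 0 -> f3 h1 = 0 ->
  forall s t u : R, s *: g + t *: h1 + u *: h2 = 0 -> [/\ s = 0, t = 0 & u = 0].
Proof.
move=> lin n1 n2 n3 z1 z2 z3 z4 s t u e.
have ap f : f = f1 \/ f = f2 \/ f = f3 -> s * f g + t * f h1 + u * f h2 = 0.
  move=> hf; have [fD fZ] := lin f hf.
  by rewrite -!fZ -!fD e -[X in f X](scale0r 0) fZ mul0r.
have t0 : t = 0.
  have := ap f2 (or_intror (or_introl erefl)); rewrite z1 z2 !mulr0 add0r addr0 => /eqP.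
  by rewrite mulf_eq0 (negbTE n2) orbF => /eqP.
have u0 : u = 0.
  have := ap f3 (or_intror (or_intror erefl)); rewrite z3 z4 !mulr0 !add0r => /eqP.
  by rewrite mulf_eq0 (negbTE n3) orbF => /eqP.
split=> //; have := ap f1 (or_introl erefl); rewrite t0 u0 !mul0r !addr0 => /eqP.
by rewrite mulf_eq0 (negbTE n1) orbF => /eqP.
Qed.

End AtTriple.
End TripleEdges.

Section TripleStar.
Variables (R : realType) (r a : nat).
Hypothesis r2 : (1 < r)%N.
Hypothesis ar : (a < r)%N.
Hypothesis cra : coprime r a.
Implicit Types (w g h : 'rV[R]_3) (tau sig v E : set 'rV[R]_3).
Variable F : frame.
Hypothesis fF : is_frame r%:Z a F.
Hypothesis A1 : fA F = 1.
Hypothesis B1 : fB F = 1.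

Let r0 : 0 < r%:Z. Proof. by clear -r2; lia. Qed.
Let rR : 0 < (r%:Z)%:~R :> R. Proof. by rewrite ltr0z. Qed.
Let rn : (r%:Z)%:~R != 0 :> R. Proof. by rewrite gt_eqF. Qed.

Let hr : al F + be F = r%:Z.
Proof. by case: fF => _ [+ _ _ _ _]; rewrite A1 B1 !mulr1. Qed.

Let al0 : 0 < al F. Proof. by case: fF => [[]]. Qed.
Let be0 : 0 < be F. Proof. by case: fF => [[]]. Qed.

Let hrR : (r%:Z)%:~R = (al F)%:~R + (be F)%:~R :> R.
Proof. by rewrite -hr intrD. Qed.

Let alR : 1 <= (al F)%:~R :> R. Proof. by rewrite ler1z; clear -al0; lia. Qed.
Let beR : 1 <= (be F)%:~R :> R. Proof. by rewrite ler1z; clear -be0; lia. Qed.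

Let fY := degY_is_frame r2 fF A1 B1.
Let fZ := degZ_is_frame r2 fF A1 B1.

Lemma is_cell_F : is_cell F 0 0.
Proof. by split; [split|split] => //; rewrite ?A1 ?B1. Qed.

Lemma is_cell_degY : is_cell (degY r F) (be F - 1) 0.
Proof. by split; [split|split] => //=; clear -hr al0 be0; lia. Qed.

Lemma is_cell_degZ : is_cell (degZ r F) 0 (al F - 1).
Proof. by split; [split|split] => //=; clear -hr al0 be0; lia. Qed.

Definition tripleU := [set w | sigma R r a (graph_of F 0 0) w /\ wU F w = 0]%classic.
Definition tripleV := [set w | sigma R r a (graph_of F 0 0) w /\ wV F w = 0]%classic.

(** The cells of [F] and of [degY F] meet along this edge. *)
Lemma tripleU_degY : [set w | sigma R r a (graph_of (degY r F) (be F - 1) 0) w /\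
   (r%:Z)%:~R * ((be F)%:~R * wS w - (wU (degY r F) w + wV (degY r F) w)) = 0]%classic = tripleU.
Proof.
rewrite /tripleU (sigmaE r2 ar R fY is_cell_degY) (sigmaE r2 ar R fF is_cell_F).
apply/seteqP; split=> w [iC h]; split.
- have := in_cell_S0 r0 fY iC; rewrite -/(wS w) => S0.
  move/eqP: h; rewrite mulf_eq0 (negbTE rn) /= => /eqP h.
  move/in_cellvE: iC => /= [/(_ isT)/andP[u1 u2] _ _ _].
  have aS : wS w <= (al F)%:~R * wS w by rewrite ler_peMl.
  have bS : wS w <= (be F)%:~R * wS w by rewrite ler_peMl.
  apply/in_cellvE; rewrite A1 B1; move: S0 h u1 u2 aS bS; rewrite /wU /wV /wS /fU /fV /fS /= A1 B1 hrR intrB.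
  move=> S0 h u1 u2 aS bS; split=> [_|_||]; try (apply/andP; split); lra.
- move/eqP: h; rewrite mulf_eq0 (negbTE rn) /= => /eqP; rewrite /wU /wV /wS /fU /fV /fS /= A1 hrR => h.
  by lra.
- have := in_cell_S0 r0 fF iC; rewrite -/(wS w) => S0.
  move/in_cellvE: iC; rewrite A1 B1 => -[_ /(_ isT)/andP[v1 v2] _ _].
  have aS : 0 <= (al F)%:~R * wS w by rewrite mulr_ge0 // (le_trans ler01).
  apply/in_cellvE; move: S0 h v1 v2 aS; rewrite /wU /wV /wS /fU /fV /fS /= A1 B1 hrR intrB.
  move=> S0 h v1 v2 aS; split=> [_|//||]; try (apply/andP; split); lra.
- apply/eqP; rewrite mulf_eq0 (negbTE rn) /=; apply/eqP.
  by move: h; rewrite /wU /wV /wS /fU /fV /fS /= A1 hrR => h; lra.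
Qed.

Lemma tripleV_degZ : [set w | sigma R r a (graph_of (degZ r F) 0 (al F - 1)) w /\
   (r%:Z)%:~R * ((al F)%:~R * wS w - (wU (degZ r F) w + wV (degZ r F) w)) = 0]%classic = tripleV.
Proof.
rewrite /tripleV (sigmaE r2 ar R fZ is_cell_degZ) (sigmaE r2 ar R fF is_cell_F).
apply/seteqP; split=> w [iC h]; split.
- have := in_cell_S0 r0 fZ iC; rewrite -/(wS w) => S0.
  move/eqP: h; rewrite mulf_eq0 (negbTE rn) /= => /eqP h.
  move/in_cellvE: iC => /= [_ /(_ isT)/andP[u1 u2] _ _].
  have aS : wS w <= (al F)%:~R * wS w by rewrite ler_peMl.
  have bS : wS w <= (be F)%:~R * wS w by rewrite ler_peMl.
  apply/in_cellvE; rewrite A1 B1; move: S0 h u1 u2 aS bS; rewrite /wU /wV /wS /fU /fV /fS /= A1 B1 hrR intrB.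
  move=> S0 h u1 u2 aS bS; split=> [_|_||]; try (apply/andP; split); lra.
- move/eqP: h; rewrite mulf_eq0 (negbTE rn) /= => /eqP; rewrite /wU /wV /wS /fU /fV /fS /= B1 hrR => h.
  by lra.
- have := in_cell_S0 r0 fF iC; rewrite -/(wS w) => S0.
  move/in_cellvE: iC; rewrite A1 B1 => -[/(_ isT)/andP[v1 v2] _ _ _].
  have aS : 0 <= (be F)%:~R * wS w by rewrite mulr_ge0 // (le_trans ler01).
  apply/in_cellvE; move: S0 h v1 v2 aS; rewrite /wU /wV /wS /fU /fV /fS /= A1 B1 hrR intrB.
  move=> S0 h v1 v2 aS; split=> [//|_||]; try (apply/andP; split); lra.
- apply/eqP; rewrite mulf_eq0 (negbTE rn) /=; apply/eqP.
  by move: h; rewrite /wU /wV /wS /fU /fV /fS /= B1 hrR => h; lra.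
Qed.

Definition spokeY := [set w | sigma R r a (graph_of (degY r F) (be F - 1) 0) w /\
   (be F)%:~R * wS w - wU (degY r F) w = 0]%classic.
Definition spokeZ := [set w | sigma R r a (graph_of (degZ r F) 0 (al F - 1)) w /\
   (al F)%:~R * wS w - wV (degZ r F) w = 0]%classic.

Lemma lin_wS (f : 'rV[R]_3 -> R) : f = @wS R -> (forall x y, f (x + y) = f x + f y) /\
  (forall t x, f (t *: x) = t * f x).
Proof. by move=> ->; split; [exact: wSD|exact: wSZ]. Qed.
Lemma lin_wU F' (f : 'rV[R]_3 -> R) : f = @wU R F' -> (forall x y, f (x + y) = f x + f y) /\
  (forall t x, f (t *: x) = t * f x).
Proof. by move=> ->; split; [exact: wUD|exact: wUZ]. Qed.
Lemma lin_wV F' (f : 'rV[R]_3 -> R) : f = @wV R F' -> (forall x y, f (x + y) = f x + f y) /\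
  (forall t x, f (t *: x) = t * f x).
Proof. by move=> ->; split; [exact: wVD|exact: wVZ]. Qed.

(** An edge at the triple point is a face of one of the three cells there, and
    each cell has two faces of dimension 2 through the point. *)
Lemma triple_edges v E : vertex r a v -> v (gv R F 0 0) -> edges r a v E ->
  E \in [:: tripleU; tripleV; spokeY; spokeZ].
Proof.
move=> vv vg [[Gam gG fE] dE vE].
have Eg := vE _ vg.
have [F' [p [q [fF' cF' eG]]]] := Ggraph_classify r2 ar cra gG; subst Gam.
have iC : in_cellv F' p q (gv R F 0 0).
  by have [c _ e] := fE; move: Eg; rewrite e (sigmaE r2 ar R fF' cF') => -[].
have eY : gv R F 0 0 = gv R (degY r F) (be F) 0.
  by apply: rv3P; rewrite !vecE; congr (_%:~R); rewrite /gx /gy /gz /= ?A1 ?B1 -?hr; ring.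
have eZ : gv R F 0 0 = gv R (degZ r F) 0 (al F).
  by apply: rv3P; rewrite !vecE; congr (_%:~R); rewrite /gx /gy /gz /= ?A1 ?B1 -?hr; ring.
have red (X Y : set 'rV[R]_3) : E = X \/ E = Y -> X \in [:: tripleU; tripleV; spokeY; spokeZ] ->
    Y \in [:: tripleU; tripleV; spokeY; spokeZ] -> E \in [:: tripleU; tripleV; spokeY; spokeZ].
  by case=> ->.
case: (triple_graphs r2 ar cra fF A1 B1 fF' cF' iC) => [[e1 e2 e3]|[e1 e2 e3]|[e1 e2 e3]];
  subst F' p q.
- have se := sigmaE r2 ar R fF cF'.
  have gS p' q' := wS_gv R p' q' fF.
  have gU p' q' := wU_gv R p' q' fF.
  have gV p' q' := wV_gv R p' q' fF.
  have s1 : sigma R r a (graph_of F 0 0) (gv R F 1 0).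
    by rewrite se /=; apply: (in_cellv_gv R r2 fF); clear -al0 be0; lia.
  have s2 : sigma R r a (graph_of F 0 0) (gv R F 0 1).
    by rewrite se /=; apply: (in_cellv_gv R r2 fF); clear -al0 be0; lia.
  have := face2 (f1 := @wU R F) (f2 := @wV R F) fE dE Eg s1 s2 rR.
  move=> H; apply: (red tripleU tripleV); rewrite ?inE ?eqxx ?orbT //; apply: H.
    apply: (indep3 (f1 := @wS R) (f2 := @wU R F) (f3 := @wV R F)).
    + by move=> f [/lin_wS//|[/lin_wU//|/lin_wV//]].
    + by rewrite gS.
    + by rewrite gU mul1r.
    + by rewrite gV mul1r.
    + by rewrite gU mul0r.
    + by rewrite gU mul0r.
    + by rewrite gV mul0r.
    + by rewrite gV mul0r.
  move=> w; rewrite se => /in_cellvE; rewrite A1 B1 !mul0r => -[/(_ isT)/andP[u1 _] /(_ isT)/andP[v1 _] _ _].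
  split=> //; exists (wS w - wU F w - wV F w).
  by apply: (coord_eq r2 fF); rewrite !wE ?gS ?gU ?gV; ring.
- have se := sigmaE r2 ar R fY cF'.
  have gS p' q' := wS_gv R p' q' fY.
  have gU p' q' := wU_gv R p' q' fY.
  have gV p' q' := wV_gv R p' q' fY.
  have s1 : sigma R r a (graph_of (degY r F) (be F - 1) 0) (gv R (degY r F) (be F - 1) 1).
    by rewrite se /=; apply: (in_cellv_gv R r2 fY) => /=; clear -al0 be0 hr; lia.
  have s2 : sigma R r a (graph_of (degY r F) (be F - 1) 0) (e1 R).
    by rewrite se /=; apply: in_cellv_e1 => //; left.
  have := face2 (f1 := fun w => (be F)%:~R * wS w - wU (degY r F) w)
    (f2 := fun w => (r%:Z)%:~R * ((be F)%:~R * wS w - (wU (degY r F) w + wV (degY r F) w)))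
    fE dE Eg s1 s2 rR.
  rewrite tripleU_degY -/spokeY => H; apply: (red spokeY tripleU); rewrite ?inE ?eqxx ?orbT //; apply: H.
    rewrite eY; apply: (indep3 (f1 := @wS R) (f2 := fun w => (be F)%:~R * wS w - wU (degY r F) w)
      (f3 := fun w => (be F)%:~R * wS w - (wU (degY r F) w + wV (degY r F) w))).
    + move=> f [/lin_wS//|[->|->]]; split=> *; rewrite !wE; ring.
    + by rewrite gS.
    + by rewrite gS gU -mulrBl -intrB opprB addrC subrK mul1r.
    + by rewrite wS_e1 wU_e1 wV_e1 /= oppr0 mulr0 !add0r opprK oner_eq0.
    + by rewrite gS gU subrr.
    + by rewrite wS_e1 wU_e1 /= oppr0 mulr0 subrr.
    + by rewrite gS gU gV mul0r addr0 subrr.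
    + by rewrite gS gU gV intrB; ring.
  move=> w; rewrite se => /in_cellvE /= [/(_ isT)/andP[u1 u2] _ _ u3].
  rewrite subrK in u2.
  split; [by rewrite subr_ge0|by rewrite mulr_ge0 ?(ltW rR) // subr_ge0|].
  exists (wU (degY r F) w - (be F - 1)%:~R * wS w); rewrite eY.
  by apply: (coord_eq r2 fY); rewrite !wE ?gS ?gU ?gV ?wS_e1 ?wU_e1 ?wV_e1 /= intrB; ring.
- have se := sigmaE r2 ar R fZ cF'.
  have gS p' q' := wS_gv R p' q' fZ.
  have gU p' q' := wU_gv R p' q' fZ.
  have gV p' q' := wV_gv R p' q' fZ.
  have s1 : sigma R r a (graph_of (degZ r F) 0 (al F - 1)) (gv R (degZ r F) 1 (al F - 1)).
    by rewrite se /=; apply: (in_cellv_gv R r2 fZ) => /=; clear -al0 be0 hr; lia.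
  have s2 : sigma R r a (graph_of (degZ r F) 0 (al F - 1)) (e1 R).
    by rewrite se /=; apply: in_cellv_e1 => //; right.
  have := face2 (f1 := fun w => (al F)%:~R * wS w - wV (degZ r F) w)
    (f2 := fun w => (r%:Z)%:~R * ((al F)%:~R * wS w - (wU (degZ r F) w + wV (degZ r F) w)))
    fE dE Eg s1 s2 rR.
  rewrite tripleV_degZ -/spokeZ => H; apply: (red spokeZ tripleV); rewrite ?inE ?eqxx ?orbT //; apply: H.
    rewrite eZ; apply: (indep3 (f1 := @wS R) (f2 := fun w => (al F)%:~R * wS w - wV (degZ r F) w)
      (f3 := fun w => (al F)%:~R * wS w - (wU (degZ r F) w + wV (degZ r F) w))).
    + move=> f [/lin_wS//|[->|->]]; split=> *; rewrite !wE; ring.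
    + by rewrite gS.
    + by rewrite gS gV -mulrBl -intrB opprB addrC subrK mul1r.
    + by rewrite wS_e1 wU_e1 wV_e1 /= oppr0 mulr0 addr0 add0r opprK oner_eq0.
    + by rewrite gS gV subrr.
    + by rewrite wS_e1 wV_e1 /= oppr0 mulr0 subrr.
    + by rewrite gS gU gV mul0r add0r subrr.
    + by rewrite gS gU gV intrB; ring.
  move=> w; rewrite se => /in_cellvE /= [_ /(_ isT)/andP[u1 u2] u3 _].
  rewrite subrK in u2.
  split; [by rewrite subr_ge0|by rewrite mulr_ge0 ?(ltW rR) // subr_ge0|].
  exists (wV (degZ r F) w - (al F - 1)%:~R * wS w); rewrite eZ.
  by apply: (coord_eq r2 fZ); rewrite !wE ?gS ?gU ?gV ?wS_e1 ?wU_e1 ?wV_e1 /= intrB; ring.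
Qed.

Lemma triple_valency v n : vertex r a v -> v (gv R F 0 0) -> valency r a v n -> (n <= 4)%N.
Proof.
by move=> vv vg vn; apply: (valency_le vn (fun E => @triple_edges v E vv vg)).
Qed.

End TripleStar.

(** * Special characters are rigid *)

Section Core.
Variables (R : realType) (r a : nat).
Hypothesis r2 : (1 < r)%N.
Hypothesis ar : (a < r)%N.
Hypothesis cra : coprime r a.
Implicit Types (w g h : 'rV[R]_3) (F : frame) (tau sig v E : set 'rV[R]_3).

Let r0 : 0 < r%:Z. Proof. by clear -r2; lia. Qed.
Let rR : 0 < (r%:Z)%:~R :> R. Proof. by rewrite ltr0z. Qed.

(** At a grid point [x] is strictly cheaper than the powers of [y] and [z] of
    the same weight. *)
Lemma x_cheaper F (p q s t n : int) : 0 < al F -> 0 < be F -> 0 < fA F -> 0 < fB F ->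
  1 <= p -> 1 <= q -> p + q <= al F -> p + q <= be F ->
  -1 = s * fA F + t * fB F -> n = - s * al F + t * be F ->
  (0 <= n -> 0 < - s * p + t * (be F - q)) /\ (n <= 0 -> 0 < s * (al F - p) - t * q).
Proof.
move=> a0 b0 A0 B0 p1 q1 pa pb e en.
have bq : 0 < be F - q by lia.
have ap : 0 < al F - p by lia.
have [hs|hs] := leP s (-1); have [ht|ht] := leP t (-1).
- by exfalso; clear -e hs ht A0 B0; nia.
- split=> h; first by clear -hs ht p1 bq; nia.
  have t0 : 0 <= t by lia.
  by exfalso; clear -en h hs t0 a0 b0; nia.
- split=> h; last by clear -hs ht q1 ap; nia.
  have s0 : 0 <= s by lia.
  by exfalso; clear -en h s0 ht a0 b0; nia.
- by exfalso; have s0 : 0 <= s by [lia]; have t0 : 0 <= t by [lia]; clear -e s0 t0 A0 B0; nia.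
Qed.

(** In a chart containing [e_1] the monomial with the weight of [x] is a power
    of [y] or [z], as these cost 0 at [e_1]; but [x] is cheaper at the grid
    point. *)
Lemma no_spoke v F p q Gam : vertex r a v -> is_frame r%:Z a F -> is_vtx F p q ->
  fA F != 0 -> fB F != 0 -> v (gv R F p q) -> Ggraph r a Gam ->
  sigma R r a Gam (gv R F p q) -> sigma R r a Gam (e1 R) -> False.
Proof.
move=> vv fF [[p1 q1 pa pb] _] An Bn vg gG sg s1.
have [[a0 b0 A0 B0] [hr _ _ _ _]] := fF.
(* [(0, b')] has the weight of [x]. *)
have [b' [k eb]] := inv_a r2 ar cra.
have [m gm wm] := Ggraph_sur (wt r a (mono 1 0)) gG.
have mm := Ggraph_ismon gG gm.
have em := monoK mm (Ggraph_noyz r2 ar gG gm).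
have w1 : wt r a m = wt r a (mono 0 b').
  rewrite wm; apply/(wt_eq r2 ar); exists (- k); rewrite !px_mono !pn_mono.
  by rewrite subr0 sub0r mulrN eb; ring.
have mb : ismon (mono 0 b') by apply/ismon_mono.
have m1 : ismon (mono 1 0) by apply/ismon_mono.
have h1 := sigma_min r2 ar cra gG s1 gm mb w1.
have h2 := sigma_min r2 ar cra gG sg gm m1 wm.
have px0 : px m = 0.
  have p0 : 0 <= px m by case/ismonE: mm.
  move: h1; rewrite em !dot_mono /cost !vecE !mul0r !mul1r !oppr0 !if_same !addr0 ler_int px_mono.
  by clear -p0; lia.
rewrite em px0 in wm h2; move: (pn m) wm h2 => n wm h2 {h1 w1 em px0 m mm gm}.
move/(wt_eq r2 ar): wm => [l]; rewrite !px_mono !pn_mono => el.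
have [s [t [es et]]] := frame_lattice r0 fF el.
have A1 : 0 < fA F by rewrite lt0r An.
have B1 : 0 < fB F by rewrite lt0r Bn.
have en : n = - s * al F + t * be F by rewrite -et; ring.
have e1' : -1 = s * fA F + t * fB F by rewrite -es; ring.
have [u1 u2] := x_cheaper a0 b0 A1 B1 p1 q1 pa pb e1' en.
have eS := wS_gv R p q fF; have eU := wU_gv R p q fF; have eV := wV_gv R p q fF.
have [x0 y0 z0] := vertex_ge0 r2 ar cra vv vg.
move: h2 eS eU eV x0 y0 z0; rewrite !dot_mono /wS /wU /wV /fS /fU /fV.
move: (gv R F p q 0 o0) (gv R F p q 0 o1) (gv R F p q 0 o2) => x y z.
rewrite (costp _ _ _ 1) // => h2 eS eU eV x0 y0 z0.
have ex : - x = s%:~R * (fA F)%:~R * x + t%:~R * (fB F)%:~R * x.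
  by rewrite -mulrDl -!intrM -intrD -e1'; ring.
have [n0|n0] := leP 0 n.
  have := u1 n0; rewrite -(ltr0z R) => hp.
  have : 0 < (- s * p + t * (be F - q))%:~R * (r%:Z)%:~R :> R by rewrite mulr_gt0.
  have -> : (- s * p + t * (be F - q))%:~R * (r%:Z)%:~R = y * n%:~R - x.
    rewrite ex en.
    have -> : (- s * p + t * (be F - q))%:~R * (r%:Z)%:~R =
      - s%:~R * (p%:~R * (r%:Z)%:~R) + t%:~R * ((be F)%:~R * (r%:Z)%:~R - q%:~R * (r%:Z)%:~R) :> R by ring.
    by rewrite -eU -eV -eS; ring.
  by move: h2; rewrite costp //; lra.
have := u2 (ltW n0); rewrite -(ltr0z R) => hp.
have : 0 < (s * (al F - p) - t * q)%:~R * (r%:Z)%:~R :> R by rewrite mulr_gt0.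
have -> : (s * (al F - p) - t * q)%:~R * (r%:Z)%:~R = - (z * n%:~R) - x.
  rewrite ex en.
  have -> : (s * (al F - p) - t * q)%:~R * (r%:Z)%:~R =
    s%:~R * ((al F)%:~R * (r%:Z)%:~R - p%:~R * (r%:Z)%:~R) - t%:~R * (q%:~R * (r%:Z)%:~R) :> R by ring.
  by rewrite -eU -eV -eS; ring.
by move: h2; rewrite costn; [lra|exact: ltW].
Qed.

Lemma axis_e1 tau : (axis R 0 `<=` tau)%classic -> tau (e1 R).
Proof.
move=> h; apply: h; exists 1 => //=.
by rewrite scale1r; apply: rv3P; rewrite vecE !mxE.
Qed.

(** The orthogonality fixes the proportion of [j] and [i], and [i + j] is a
    multiple of [r] by invariance; primitivity leaves the smallest
    possibility. *)
Lemma ratio_yz tau (i j : nat) w (Y : int) : monomial_ratio r a tau (mon 0 j 0) (mon 0 0 i) ->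
  tau w -> w 0 o1 = Y%:~R -> w 0 o2 = (r%:Z - Y)%:~R -> i%:Z = Y /\ j%:Z = r%:Z - Y.
Proof.
move=> [_ _ _ [iu un pu] ort] tw eY eZ.
have := ort _ tw; rewrite dotB !dotE !monE eY eZ !mulr0 !add0r !addr0 -!intrM -intrB.
move/eqP; rewrite intr_eq0 => /eqP e.
move/(inv_eq r2 ar): iu => [k]; rewrite /px /pn !rvB !monE => ek.
have ek' : a%:Z * (j%:Z + i%:Z) = k * r%:Z by rewrite -ek; ring.
have [l el] := dvd_unit (inv_a r2 ar cra) ek'.
have rn : r%:Z != 0 by rewrite gt_eqF.
have ei : i%:Z = l * Y.
  apply: (mulIf rn); have -> : i%:Z * r%:Z = Y * (j%:Z + i%:Z) by clear -e; lia.
  by rewrite el; ring.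
have ej : j%:Z = l * (r%:Z - Y) by rewrite mulrBr -el -ei; ring.
have [||h|h] := pu l (vec 0 (r%:Z - Y) (- Y)).
- by apply/(inv_eq r2 ar); exists a%:Z; rewrite /px /pn !vecE; ring.
- by apply: rv3P; rewrite rvB !monE [in RHS]mxE !vecE ?ei ?ej; ring.
- by rewrite ei ej h !mul1r.
exfalso; rewrite h in ei ej; clear -ei ej r0; lia.
Qed.

Lemma wt_x : wt r a (mon 1 0 0) = 1.
Proof. by rewrite (wtE r2 ar) /px /pn !monE subrr mulr0 addr0. Qed.

Lemma wt_y (j : nat) : wt r a (mon 0 j 0) = a%:R * (j%:Z)%:~R.
Proof. by rewrite (wtE r2 ar) /px /pn !monE subr0 add0r. Qed.

Lemma Zr_r (n : int) : a%:R * (r%:Z + n)%:~R = a%:R * n%:~R :> 'Z_r.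
Proof.
have W m : a%:R * m%:~R = wt r a (mono 0 m) by rewrite (wt_mono r2 ar) add0r.
by rewrite !W; apply/(wt_eq r2 ar); exists a%:Z; rewrite !px_mono !pn_mono; ring.
Qed.

(** By [no_spoke], an edge to [e_1] forces [fA = 0] or [fB = 0].  Then the ratio
    of that edge can be computed from the coordinates of the vertex. *)
Lemma SC2_rigid v F p q chi : vertex r a v -> is_frame r%:Z a F -> is_vtx F p q ->
  v (gv R F p q) -> SC_valency4 a v chi -> rigid (r := r) a v chi.
Proof.
move=> vv fF vF vg [tau [i [j [[Ft dt vt] at' mr ->]]]].
have [[p1 q1 pa pb] [cA cB]] := vF.
have [[a0 b0 A0 B0] [_ _ _ dA dB]] := fF.
have tg := vt _ vg.
rewrite wt_y.
have [A00|An] := eqVneq (fA F) 0.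
  have [ea eB] := deg_frame r2 ar cra fF A00.
  have eb := cA A00; have ba := dA A00.
  have [_ ej] : i%:Z = p /\ j%:Z = r%:Z - p.
    apply: (ratio_yz mr tg); rewrite !vecE; congr (_%:~R);
      by rewrite /gy /gz A00 eB ?ea; ring.
  apply: (rigid_vtx (n0 := al F - be F - p) r2 ar cra vv fF vF vg).
    by split; clear -eb ba p1 q1 pa pb; lia.
  have -> : wt r a (mon 1 0 0) = (fA F + fB F)%:~R by rewrite wt_x A00 eB.
  by rewrite (Zr_frame r2 ar fF) mul_intD ej addrCA Zr_r.
have [B00|Bn] := eqVneq (fB F) 0.
  have [eb eA] := deg_frame_swap r2 ar cra fF B00.
  have ea := cB B00; have ba := dB B00.
  have [_ ej] : i%:Z = r%:Z - q /\ j%:Z = r%:Z - (r%:Z - q).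
    apply: (ratio_yz mr tg); rewrite !vecE; congr (_%:~R);
      by rewrite /gy /gz B00 eA ?eb; ring.
  apply: (rigid_vtx (n0 := al F - be F + q) r2 ar cra vv fF vF vg).
    by split; clear -ea ba p1 q1 pa pb; lia.
  have -> : wt r a (mon 1 0 0) = (fA F + fB F)%:~R by rewrite wt_x B00 eA.
  rewrite (Zr_frame r2 ar fF) mul_intD ej; congr (_ * _%:~R); ring.
exfalso; have [Gam gG [c _ et]] := Ft.
have ts x : tau x -> sigma R r a Gam x by rewrite et => -[].
exact: (no_spoke vv fF vF An Bn vg gG (ts _ tg) (ts _ (axis_e1 at'))).
Qed.

Lemma SC_rigid_vtx v F p q chi : vertex r a v -> is_frame r%:Z a F -> is_vtx F p q ->
  v (gv R F p q) -> SC a v chi -> rigid (r := r) a v chi.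
Proof.
move=> vv fF vF vg; have [[p1 q1 pa pb] _] := vF.
have [c1 [c2 [f4 hn]]] : exists c1 c2, four_edges (r := r) a v c1 c2 /\
   exists2 n, good_row F p q n & c1 + c2 = a%:R * n%:~R.
  case: (vtx_types r2 ar cra fF vF) => [[h1 h2 An Bn]|[h1 h2]|[h1 h2]].
  - exists (a%:R * (al F - p)%:~R), (a%:R * (q - be F)%:~R); split.
      exact: (four_edges_inner r2 ar cra vv fF An Bn p1 q1 h1 h2 vg).
    exists (al F - p + (q - be F)); last by rewrite mul_intD.
    by split; clear -h1 h2 p1 q1; lia.
  - exists (fA F + fB F)%:~R, (a%:R * (q - be F)%:~R); split.
      by have [] := edges_outer_b r2 ar cra vv fF p1 q1 h1 h2 vg.
    exists (al F - be F + (q - be F)); last by rewrite (Zr_frame r2 ar fF) mul_intD.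
    by split; clear -h1 h2 p1 q1; lia.
  - exists (fA F + fB F)%:~R, (a%:R * (al F - p)%:~R); split.
      by have [] := edges_outer_a r2 ar cra vv fF p1 q1 h1 h2 vg.
    exists (al F - be F + (al F - p)); last by rewrite (Zr_frame r2 ar fF) mul_intD.
    by split; clear -h1 h2 p1 q1; lia.
case=> [v3 _|_ _ sc|v4 _ sc|_ sc].
- by case: (four_edges_valency3 f4 v3).
- exact: (SC2_rigid vv fF vF vg sc).
- exact: (SC3_rigid r2 ar cra vv v4 sc).
- have [n gn en] := hn; rewrite (four_edges_SC5 f4 sc).
  exact: (rigid_vtx r2 ar cra vv fF vF vg gn en).
Qed.

Lemma SC_rigid_triple v F chi : vertex r a v -> is_frame r%:Z a F -> fA F = 1 -> fB F = 1 ->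
  v (gv R F 0 0) -> SC a v chi -> rigid (r := r) a v chi.
Proof.
move=> vv fF A1 B1 vg.
have e2 : 1 + 1 = a%:R * (al F - be F)%:~R :> 'Z_r.
  by rewrite -(Zr_frame r2 ar fF) A1 B1.
case=> [_ ->|_ _ [tau [i [j [[Ft dt vt] _ mr ->]]]]|v4 _ sc|v5 _].
- by apply: (rigid_triple r2 ar cra vv fF A1 B1 vg); rewrite wt_x.
- apply: (rigid_triple r2 ar cra vv fF A1 B1 vg).
  have hr : al F + be F = r%:Z by have [_ [+ _ _ _ _]] := fF; rewrite A1 B1 !mulr1.
  have [_ ej] : i%:Z = be F /\ j%:Z = r%:Z - be F.
    apply: (ratio_yz mr (vt _ vg)); rewrite !vecE; congr (_%:~R);
      by rewrite /gy /gz A1 B1 -?hr; ring.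
  rewrite wt_x wt_y ej -e2; congr (_ + _).
  have -> : r%:Z - be F = al F by rewrite -hr; ring.
  have [_ [_ [k ek] _ _ _]] := fF.
  have W m : a%:R * m%:~R = wt r a (mono 0 m) by rewrite (wt_mono r2 ar) add0r.
  rewrite -[RHS]wt_x mon_mono W; apply/(wt_eq r2 ar); exists k; rewrite !px_mono !pn_mono subr0 ek A1; ring.
- exact: (SC3_rigid r2 ar cra vv v4 sc).
- by have := triple_valency r2 ar cra fF A1 B1 vv vg v5.
Qed.

Lemma SC_rigid v chi : vertex r a v -> SC a v chi -> rigid (r := r) a v chi.
Proof.
move=> vv sc; have [x [y [z [nf vg gn]]]] := vertex_normal_pt r2 ar cra vv.
case: nf => [[F [p [q [fF vF [ex ey ez]]]]]|[F [fF A1 B1 [ex ey ez]]]]; subst x y z.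
  exact: (SC_rigid_vtx vv fF vF vg sc).
apply: (SC_rigid_triple vv fF A1 B1 _ sc).
suff -> : gv R F 0 0 = vecz R (al F * be F) (be F) (al F) by [].
by apply: rv3P; rewrite !vecE; congr (_%:~R); rewrite /gx /gy /gz ?A1 ?B1; ring.
Qed.

End Core.

Theorem corollary3p17 (R : realType) (r a : nat) (hr : (0 < r)%N)
    (ha : (0 < a)%N) (hra : coprime r a) (har : (a < r - a)%N)
    (chi : 'Z_r) (hchi : chi <> 0%R) :
  qsheaf_iso r a (taut_on_D R a chi) (O_D R a chi).
Proof.
have r2 : (1 < r)%N by lia.
have ar : (a < r)%N by lia.
by apply: (taut_iso r2 ar hra) => v vv sc; exact: (SC_rigid r2 ar hra vv sc).
Qed.
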